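(* Let $\Omega$ be a Polish space, $c\in L^\infty(\Omega\times\Omega)$, $P,Q$ Borel probability measures on $\Omega$, and $\eta\in L^\infty(\Omega\times\Omega)$. For $N\in\mathbb N\cup\{\infty\}$ define \begin{align*} \hat\sigma^2_{n,m,N}(\eta)=&\frac{m}{n+m}\operatorname{Var}_{X\sim P_n}\Big[\sum_{k=0}^N(A_{Q_m}A_{P_n})^k\big(\hat\eta_{\mathrm x,n,m}-A_{Q_m}\hat\eta_{\mathrm y,n,m}\big)(X)\Big]\\ &+\frac{n}{n+m}\operatorname{Var}_{Y\sim Q_m}\Big[\sum_{k=0}^N(A_{P_n}A_{Q_m})^k\big(\hat\eta_{\mathrm y,n,m}-A_{P_n}\hat\eta_{\mathrm x,n,m}\big)(Y)\Big]. \end{align*} Then for any choice $N=N(n,m)\in\mathbb N\cup\{\infty\}$ with $N\to\infty$ as $n,m\to\infty$ and $\frac{m}{n+m}\to\lambda\in(0,1)$, one has $\hat\sigma^2_{n,m,N}(\eta)\to\sigma^2_\lambda(\eta)$ in probability, where $$\sigma_\lambda^2(\eta)=\lambda\operatorname{Var}_{X\sim P}\big[(I_{L^2_0(P)}-A_QA_P)^{-1}(\eta_{\mathrm x}-A_Q\eta_{\mathrm y})(X)\big]+(1-\lambda)\operatorname{Var}_{Y\sim Q}\big[(I_{L^2_0(Q)}-A_PA_Q)^{-1}(\eta_{\mathrm y}-A_P\eta_{\mathrm x})(Y)\big].$$ Consequently, if $\sigma^2_\lambda(\eta)>0$, then $$\sqrt{\frac{nm}{n+m}}\;\frac{\mathbb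 E_{(X,Y)\sim\pi_{P_n,Q_m}}[\eta(X,Y)]-\mathbb E_{(X,Y)\sim\pi_{P,Q}}[\eta(X,Y)]}{\hat\sigma_{n,m,N}(\eta)}\to\mathcal N(0,1)\quad\text{in distribution}.$$
   Context: $L^\infty$ denotes bounded Borel-measurable functions. Put $C(x,y)=\exp(-c(x,y))$. For Borel probability measures $P,Q$ on $\Omega$, the entropic optimal transport plan $\pi_{P,Q}$ is the unique minimizer of $\int c\,d\pi+\mathrm{KL}(\pi\mid P\otimes Q)$ over couplings $\pi\in\Pi(P,Q)$. The potentials are the unique bounded measurable $f_{P,Q},g_{P,Q}:\Omega\to\mathbb R$ with, everywhere on $\Omega$, $f_{P,Q}=-\log\int C(\cdot,y)e^{g_{P,Q}(y)}dQ(y)$, $g_{P,Q}=-\log\int C(x,\cdot)e^{f_{P,Q}(x)}dP(x)$, and $\int g_{P,Q}\,dQ=0$. With $\xi_{P,Q}(x,y)=C(x,y)e^{f_{P,Q}(x)+g_{P,Q}(y)}$ on $\Omega\times\Omega$, $d\pi_{P,Q}=\xi_{P,Q}\,d(P\otimes Q)$. The same definitions apply to $(P_n,Q_m)$. Samples: $X_1,\dots,X_n$ i.i.d. $\sim P$ and $Y_1,\dots,Y_m$ i.i.d. $\sim Q$ are mutually independent, $P_n=\frac1n\sum_i\delta_{X_i}$, $Q_m=\frac1m\sum_j\delta_{Y_j}$. Operators: $(A_Pf)(y)=\int\xi_{P,Q}(x,y)f(x)dP(x)$, $(A_Qg)(x)=\int\xi_{P,Q}(x,y)g(y)dQ(y)$;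 empirical versions $(A_{P_n}f)(y)=\int\xi_{P_n,Q_m}(x,y)f(x)dP_n(x)$, $(A_{Q_m}g)(x)=\int\xi_{P_n,Q_m}(x,y)g(y)dQ_m(y)$. $L^2_0(\mu)$ denotes the mean-zero functions in $L^2(\mu)$; $I_{L^2_0(P)}-A_QA_P$ and $I_{L^2_0(Q)}-A_PA_Q$ have bounded inverses on $L_0^2(P)$ and $L_0^2(Q)$. Functions: $\eta_{\mathrm x}(x)=\int\eta(x,y)\xi_{P,Q}(x,y)dQ(y)$, $\eta_{\mathrm y}(y)=\int\eta(x,y)\xi_{P,Q}(x,y)dP(x)$, $\hat\eta_{\mathrm x,n,m}(x)=\int\eta(x,y)\xi_{P_n,Q_m}(x,y)dQ_m(y)$, $\hat\eta_{\mathrm y,n,m}(y)=\int\eta(x,y)\xi_{P_n,Q_m}(x,y)dP_n(x)$. For $N=\infty$ the series are understood in $L^2_0(P_n)$ and $L^2_0(Q_m)$, respectively. $\hat\sigma_{n,m,N}(\eta)$ is the nonnegative square root of $\hat\sigma^2_{n,m,N}(\eta)$. *)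

(* Defs.v *)
From HB Require Import structures.
From mathcomp Require Import all_boot all_order all_algebra.
From mathcomp Require Import all_classical all_reals all_analysis.
Set Implicit Arguments.
Unset Strict Implicit.
Unset Printing Implicit Defensive.
Import Order.TTheory GRing.Theory Num.Theory.
Import numFieldNormedType.Exports.
Local Open Scope classical_set_scope.
Local Open Scope ring_scope.

Definition is_metric (R : realType) (T : Type) (dist : T -> T -> R) : Prop :=
  [/\ forall x y, 0 <= dist x y,
      forall x y, dist x y = 0 <-> x = y,
      forall x y, dist x y = dist y x &
      forall x y z, dist x z <= dist x y + dist y z].

(* Separable and completely metrizable; the metric is not part of the data. *)
Definition polish (R : realType) (T : topologicalType) : Prop :=
  (exists D : set T, countable D /\ dense D) /\
  exists dist : T -> T -> R,
    [/\ is_metric dist,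
        forall (x : T) (A : set T),
          nbhs x A <-> exists2 e : R, 0 < e & [set y | dist x y < e] `<=` A &
        forall u : nat -> T,
          (forall e : R, 0 < e ->
             exists K, forall i j, (K <= i)%N -> (K <= j)%N ->
               dist (u i) (u j) < e) ->
          exists l : T, u @ \oo --> l].

Notation borel T := (g_sigma_algebraType (@open T)).

(* On a product this refers to the product sigma-algebra, which for Borel
   sigma-algebras of Polish spaces is the Borel sigma-algebra of the product. *)
Definition Linfty d (T : measurableType d) (R : realType) (f : T -> R) : Prop :=
  measurable_fun setT f /\ exists M : R, forall x, `|f x| <= M.

Section probability_notions.
Context d (W : measurableType d) (R : realType) (Pr : probability W R).

Definition mutual_independence d' (T : measurableType d') (I : choiceType)
    (Z : I -> W -> T) : Prop :=
  forall (J : seq I) (A : I -> set T),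
    uniq J -> (forall i, measurable (A i)) ->
    Pr (\bigcap_(i in [set` J]) (Z i @^-1` A i)) =
    (\prod_(i <- J) Pr (Z i @^-1` A i))%E.

Definition has_law d' (T : measurableType d') (X : {RV Pr >-> T})
    (P : probability T R) : Prop :=
  forall A, measurable A -> distribution Pr X A = P A.

Definition cvg_in_probability (Z : nat -> W -> R) (l : R) : Prop :=
  (forall k, measurable_fun setT (Z k)) /\
  forall e : R, 0 < e -> Pr [set w | e <= `|Z k w - l|] @[k --> \oo] --> 0%E.

Definition cvg_in_distribution (Z : nat -> W -> R)
    (mu : probability (measurableTypeR R) R) : Prop :=
  (forall k, measurable_fun setT (Z k)) /\
  forall h : R -> R, continuous h -> (exists M : R, forall x, `|h x| <= M) ->
    \int[Pr]_w h (Z k w) @[k --> \oo] --> \int[mu]_x h x.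

End probability_notions.

Section empirical.
Context d (T : measurableType d) (R : realType).

(* The dirac argument only matters for n = 0, see empiricalE. *)
Definition empirical (n : nat) (x : nat -> T) : probability T R :=
  mnormalize (msum (fun i => \d_(x i) : {measure set T -> \bar R}) n)
             (\d_(x 0%N) : probability T R).

Lemma empiricalE (n : nat) (x : nat -> T) (A : set T) : (0 < n)%N ->
  empirical n x A = ((n%:R^-1)%:E * \sum_(i < n) \d_(x i) A)%E.
Proof.
move=> n0; rewrite /empirical /= /mnormalize /= /msum.
have -> : (\sum_(k < n) \d_(x k) [set: T] = n%:R%:E :> \bar R)%E.
  under eq_bigr do rewrite diracT.
  by rewrite sumEFin big_const_ord iter_addr addr0.
by rewrite orbF eqe pnatr_eq0 gtn_eqF// muleC.
Qed.

End empirical.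

Section L2.
Context d (T : measurableType d) (R : realType) (mu : probability T R).

(* Functions stand for their mu-almost-everywhere classes. *)
Definition L20 (f : T -> R) : Prop :=
  f \in Lfun mu 2%:E /\ \int[mu]_x f x = 0.

(* A representative of (I - K)^-1 u, the inverse being taken on L20. *)
Definition resolvent (K : (T -> R) -> T -> R) (u : T -> R) : T -> R :=
  xget (cst 0) [set h | L20 h /\ {ae mu, forall x, h x - K h x = u x}].

(* A representative of the sum of the series in L20. *)
Definition L20_series (u : nat -> T -> R) : T -> R :=
  xget (cst 0) [set s | L20 s /\
    ('N[mu]_2%:E [EFin \o (fun x => \sum_(k < n) u k x - s x)%R])%E
      @[n --> \oo] --> 0%E].

(* \sum_(k = 0)^N K^k u, with None standing for N = oo. *)
Definition neumann_sum (K : (T -> R) -> T -> R) (u : T -> R) (N : option nat) :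
    T -> R :=
  match N with
  | Some N => fun x => \sum_(k < N.+1) iter k K u x
  | None => L20_series (fun k => iter k K u)
  end.

Definition Var (f : T -> R) : R := fine (variance mu f).

End L2.

Definition cvg_to_infinity (N : nat -> option nat) : Prop :=
  forall K : nat, \forall k \near \oo, if N k is Some n then (K <= n)%N else true.

Section KL.
Local Open Scope ereal_scope.
Local Open Scope charge_scope.
Context d (T : measurableType d) (R : realType).

Definition KL (nu mu : probability T R) : \bar R :=
  if `[< nu `<< mu >]
  then \int[nu]_x lne (('d (charge_of_finite_measure nu) '/d mu) x)
  else +oo.

End KL.

Section entropic_optimal_transport.
Context d (T : measurableType d) (R : realType) (c : T * T -> R).
Implicit Types (P Q : probability T R) (pi : probability (T * T)%type R).

Definition coupling P Q pi : Prop :=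
  forall A, measurable A ->
    pi (A `*` setT) = P A /\ pi (setT `*` A) = Q A.

Definition entropic_cost P Q pi : \bar R :=
  (\int[pi]_z (c z)%:E + KL pi (P \x Q))%E.

Definition is_entropic_plan P Q pi : Prop :=
  coupling P Q pi /\
  forall pi', coupling P Q pi' -> (entropic_cost P Q pi <= entropic_cost P Q pi')%E.

(* The minimizer and the potentials below exist and are unique for bounded
   measurable c, so the default argument of xget plays no role. *)
Definition entropic_plan P Q : probability (T * T)%type R :=
  xget ((P \x Q)%E : probability (T * T)%type R) [set pi | is_entropic_plan P Q pi].

Definition C (z : T * T) : R := expR (- c z).

Definition are_potentials P Q (fg : (T -> R) * (T -> R)) : Prop :=
  [/\ Linfty fg.1 /\ Linfty fg.2,
      forall x, fg.1 x = - ln (\int[Q]_y (C (x, y) * expR (fg.2 y))),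
      forall y, fg.2 y = - ln (\int[P]_x (C (x, y) * expR (fg.1 x))) &
      \int[Q]_y fg.2 y = 0].

Definition potentials P Q : (T -> R) * (T -> R) :=
  xget (cst 0, cst 0) [set fg | are_potentials P Q fg].

Definition xi P Q (z : T * T) : R :=
  C z * expR ((potentials P Q).1 z.1 + (potentials P Q).2 z.2).

(* A_P P Q and A_Q P Q are the operators written A_P and A_Q; replacing P, Q by
   empirical measures gives A_(P_n) and A_(Q_m). *)
Definition A_P P Q (f : T -> R) (y : T) : R := \int[P]_x (xi P Q (x, y) * f x).

Definition A_Q P Q (g : T -> R) (x : T) : R := \int[Q]_y (xi P Q (x, y) * g y).

Variable eta : T * T -> R.

Definition eta_x P Q (x : T) : R := \int[Q]_y (eta (x, y) * xi P Q (x, y)).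

Definition eta_y P Q (y : T) : R := \int[P]_x (eta (x, y) * xi P Q (x, y)).

Definition sigma2 (lambda : R) P Q : R :=
  lambda * Var P (resolvent P (A_Q P Q \o A_P P Q)
                    (eta_x P Q \- A_Q P Q (eta_y P Q))) +
  (1 - lambda) * Var Q (resolvent Q (A_P P Q \o A_Q P Q)
                          (eta_y P Q \- A_P P Q (eta_x P Q))).

(* To be used with P := P_n and Q := Q_m. *)
Definition sigma2_hat (n m : nat) (N : option nat) P Q : R :=
  m%:R / (n + m)%:R *
    Var P (neumann_sum P (A_Q P Q \o A_P P Q)
             (eta_x P Q \- A_Q P Q (eta_y P Q)) N) +
  n%:R / (n + m)%:R *
    Var Q (neumann_sum Q (A_P P Q \o A_Q P Q)
             (eta_y P Q \- A_P P Q (eta_x P Q)) N).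

End entropic_optimal_transport.

(* Main.v *)
(** All functions involved are bounded. When [|c| <= M], the Sinkhorn map
    contracts oscillations, so the potentials are limits of Sinkhorn iterates
    (hence measurable in the sample) and the density [xi] lies between
    [exp (- 6 M)] and [exp (6 M)]. The lower bound makes [A_Q A_P] a contraction
    of bounded mean-zero functions, at a rate that does not depend on the
    sample: the Neumann series converge uniformly and can be truncated.

    Let [D] be the difference between the empirical and the population
    log-densities, a sum of a function of [x] and a function of [y]. Since the
    empirical density has exact marginals, the integral of [(xi_nm - xi) D]
    against [P_n x Q_m] only involves the marginal defects of [xi], and
    [exp] is increasing, so the squared L2 norm of [D] is bounded by the
    squared marginal defects, whose mean is of order [1/n + 1/m]. This yields
    consistency. For the limit law, choose [phi], [psi] with
    [phi + A_Q psi = eta_x] and [psi + A_P phi = eta_y]. Then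
    [eta - phi - psi] has vanishing conditional means under the plan, so that
    the error of the empirical plan is the mean of [phi] under [P_n - P] plus
    the mean of [psi] under [Q_m - Q], up to a degenerate U-statistic and
    terms quadratic in [D], all of order [1/n + 1/m]. The linear part is
    compared with a Gaussian by replacing the samples one by one by a step of
    the heat semigroup. *)

Require Import Defs.
From HB Require Import structures.
From mathcomp Require Import all_boot all_order all_algebra.
From mathcomp Require Import all_classical all_reals all_analysis.
From mathcomp Require Import measurable_realfun ring lra.
Set Implicit Arguments.
Unset Strict Implicit.
Unset Printing Implicit Defensive.
Import Order.TTheory GRing.Theory Num.Theory.
Import numFieldNormedType.Exports.
Local Open Scope classical_set_scope.
Local Open Scope ring_scope.

(** * Bounded measurable functions *)

(** Whatever the statement selects with [xget] (plan, potentials, resolvent, infinite Neumann sum)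
    shows nothing of its dependence on the sample, and the last two are known only almost
    everywhere. Each is therefore matched with an explicit construction or a limit of iterates. This
    is where measurability in the sample comes from, and it lets the estimates be made on bounded
    functions defined everywhere. All random errors are recorded in one form: dominated by variables
    whose mean is at most a multiple of [rho = 1/n + 1/m]. The scale [a = sqrt (n m / (n + m))]
    satisfies [a ^+ 2 * rho = 1], so an error of mean order [rho] still vanishes after
    multiplication by [a], whereas one of order [sqrt rho] need not. Hence the remainder of the plan
    must be controlled at order [rho] itself: this forces the choice of scores that remove the
    first-order terms, and a second moment of order [1/(n m)] for the degenerate part. In the
    Gaussian comparison derivatives fall on the Gaussian density only, so the test function enters
    through its supremum, and the smoothing time depends on the tolerance alone. *)

Section real_sequences.
Context (R : realType).
Implicit Types u v : nat -> R.

Lemma cvgn_epsP u (l : R) : u n @[n --> \oo] --> l <->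
  forall e : R, 0 < e -> exists N, forall n, (N <= n)%N -> `|u n - l| <= e.
Proof.
split=> [ul e e0|h].
  have /cvgrPdist_le/(_ _ e0)[N _ hN] := ul.
  by exists N => n Nn; rewrite distrC; exact: hN.
apply/cvgrPdist_le => e /h[N hN]; exists N => // n Nn /=.
by rewrite distrC; exact: hN.
Qed.

Lemma cvgn_dist_le u (l a M : R) : u n @[n --> \oo] --> l ->
  (forall n, `|u n - a| <= M) -> `|l - a| <= M.
Proof.
move=> /cvgn_epsP ul uM; apply/ler_addgt0Pr => e /ul[N /(_ _ (leqnn N)) hN].
rewrite (_ : l - a = (u N - a) - (u N - l)); last by ring.
by rewrite (le_trans (ler_normB _ _))// lerD.
Qed.

Lemma cvgn_unique u (l l' : R) : u n @[n --> \oo] --> l -> u n @[n --> \oo] --> l' -> l = l'.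
Proof. exact: cvg_unique. Qed.

Lemma cvgn_squeeze0 u v : (forall n, `|u n| <= v n) -> v n @[n --> \oo] --> (0 : R) ->
  u n @[n --> \oo] --> (0 : R).
Proof.
move=> uv /cvgn_epsP v0; apply/cvgn_epsP => e /v0[N hN]; exists N => n /hN.
by rewrite !subr0 => /(le_trans (ler_norm _)); apply: le_trans.
Qed.

End real_sequences.

(** Inversion is not continuous at 0, so it is rewritten through [expR] and [ln] on each open
    half-line. It serves for quotients whose denominator may vanish: a Radon-Nikodym density, and
    the estimated standard deviation. *)
Lemma measurable_invr (R : realType) : measurable_fun [set: R] (@GRing.inv R).
Proof.
rewrite (_ : GRing.inv = fun x : R => if 0 < x then expR (- ln x) else
  if x < 0 then - expR (- ln (- x)) else 0); last first.
  apply/funext => x; case: ltgtP => [x0|x0|<-]; last by rewrite invr0.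
    by rewrite expRN lnK ?posrE.
  by rewrite expRN lnK ?posrE ?oppr_gt0// invrN opprK.
apply: measurable_fun_ifT.
- exact: measurable_fun_ltr.
- by apply: measurableT_comp => //; apply: measurableT_comp => //; exact: measurable_ln.
- apply: measurable_fun_ifT => //; first exact: measurable_fun_ltr.
  apply: measurableT_comp => //; apply: measurableT_comp => //.
  apply: measurableT_comp => //; apply: measurableT_comp => //; exact: measurable_ln.
Qed.

Section Linfty_closure.
Context d (T : measurableType d) (R : realType).
Implicit Types f g : T -> R.

Lemma Linfty_cst (r : R) : Linfty (fun _ : T => r).
Proof. by split; [exact: measurable_cst|exists `|r|]. Qed.

Lemma LinftyD f g : Linfty f -> Linfty g -> Linfty (fun x => f x + g x).
Proof.
move=> [mf [M fM]] [mg [N gN]]; split; first exact: measurable_funD.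
by exists (M + N) => x; rewrite (le_trans (ler_normD _ _))// lerD.
Qed.

Lemma LinftyN f : Linfty f -> Linfty (fun x => - f x).
Proof.
move=> [mf [M fM]]; split; first exact: measurableT_comp.
by exists M => x; rewrite normrN.
Qed.

Lemma LinftyB f g : Linfty f -> Linfty g -> Linfty (fun x => f x - g x).
Proof. by move=> hf /LinftyN; exact: LinftyD. Qed.

Lemma LinftyM f g : Linfty f -> Linfty g -> Linfty (fun x => f x * g x).
Proof.
move=> [mf [M fM]] [mg [N gN]]; split; first exact: measurable_funM.
by exists (M * N) => x; rewrite normrM ler_pM.
Qed.

Lemma Linfty_sqr f : Linfty f -> Linfty (fun x => f x ^+ 2).
Proof. by move=> hf; apply: (LinftyM hf hf). Qed.

Lemma Linfty_sum (I : Type) (s : seq I) (F : I -> T -> R) :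
  (forall i, Linfty (F i)) -> Linfty (fun x => \sum_(i <- s) F i x).
Proof.
move=> hF; elim: s => [|i s ih].
  by under eq_fun do rewrite big_nil; exact: Linfty_cst.
by under eq_fun do rewrite big_cons; exact: LinftyD.
Qed.

Lemma Linfty_norm f : Linfty f -> Linfty (fun x => `|f x|).
Proof.
move=> [mf [M fM]]; split; first exact: measurableT_comp.
by exists M => x; rewrite normr_id.
Qed.

Lemma Linfty_expR f : Linfty f -> Linfty (fun x => expR (f x)).
Proof.
move=> [mf [M fM]]; split; first exact: measurableT_comp.
exists (expR M) => x; rewrite ger0_norm ?expR_ge0// ler_expR.
by rewrite (le_trans _ (fM x))// ler_norm.
Qed.

Lemma Linfty_ln f (a : R) : 0 < a -> (forall x, a <= f x) -> Linfty f ->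
  Linfty (fun x => ln (f x)).
Proof.
move=> a0 af [mf [M fM]]; split; first exact: measurableT_comp.
exists (`|ln a| + `|ln M|) => x.
have fx : 0 < f x by apply: lt_le_trans (af x).
have fxM : f x <= M by apply: le_trans (fM x); exact: ler_norm.
have h1 : ln a <= ln (f x) by rewrite ler_ln ?posrE.
have h2 : ln (f x) <= ln M by rewrite ler_ln ?posrE// (lt_le_trans fx).
have := ler_norm (ln M); have := ler_norm (- ln a); rewrite normrN.
rewrite ler_norml => *; have := normr_ge0 (ln a); have := normr_ge0 (ln M).
by move=> *; apply/andP; split; lra.
Qed.

Lemma Linfty_comp d' (T' : measurableType d') f (h : T' -> T) :
  measurable_fun setT h -> Linfty f -> Linfty (fun x => f (h x)).
Proof.
move=> mh [mf [M fM]]; split; first exact: measurableT_comp.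
by exists M => x; exact: fM.
Qed.

Lemma Linfty_lim (u : nat -> T -> R) f (M : R) :
  (forall n, measurable_fun setT (u n)) ->
  (forall n x, `|u n x| <= M) -> (forall x, u n x @[n --> \oo] --> f x) -> Linfty f.
Proof.
move=> mu uM uf; split.
  by apply: measurable_fun_cvg mu _ => x _; exact: uf.
exists M => x; rewrite -[f x]subr0; apply: cvgn_dist_le (uf x) _ => n.
by rewrite subr0.
Qed.

End Linfty_closure.

Section Linfty_integral.
Context d (T : measurableType d) (R : realType) (mu : probability T R).
Implicit Types f g : T -> R.

Lemma Linfty_integrable f : Linfty f -> mu.-integrable setT (EFin \o f).
Proof.
move=> [mf [M fM]]; apply: measurable_bounded_integrable => //.
  by rewrite -ge0_fin_numE// fin_num_measure.
exists M; split; first exact: num_real.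
by move=> r Mr x _ /=; rewrite (le_trans (fM x))// ltW.
Qed.

Lemma Rintegral_cstT (r : R) : \int[mu]_x r = r.
Proof. by rewrite Rintegral_cst//= probability_setT mulr1. Qed.

Lemma RintD f g : Linfty f -> Linfty g ->
  \int[mu]_x (f x + g x) = \int[mu]_x f x + \int[mu]_x g x.
Proof. by move=> hf hg; rewrite RintegralD//; exact: Linfty_integrable. Qed.

Lemma RintB f g : Linfty f -> Linfty g ->
  \int[mu]_x (f x - g x) = \int[mu]_x f x - \int[mu]_x g x.
Proof. by move=> hf hg; rewrite RintegralB//; exact: Linfty_integrable. Qed.

Lemma RintZl f (r : R) : Linfty f -> \int[mu]_x (r * f x) = r * \int[mu]_x f x.
Proof. by move=> hf; rewrite RintegralZl//; exact: Linfty_integrable. Qed.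

Lemma RintZr f (r : R) : Linfty f -> \int[mu]_x (f x * r) = \int[mu]_x f x * r.
Proof. by move=> hf; rewrite RintegralZr//; exact: Linfty_integrable. Qed.

Lemma le_Rint f g : Linfty f -> Linfty g -> (forall x, f x <= g x) ->
  \int[mu]_x f x <= \int[mu]_x g x.
Proof. by move=> hf hg fg; apply: le_Rintegral => //; exact: Linfty_integrable. Qed.

Lemma Rint_le_cst f (M : R) : Linfty f -> (forall x, f x <= M) -> \int[mu]_x f x <= M.
Proof.
move=> hf fM; rewrite -[leRHS]Rintegral_cstT; apply: le_Rint => //.
exact: Linfty_cst.
Qed.

Lemma Rint_ge_cst f (M : R) : Linfty f -> (forall x, M <= f x) -> M <= \int[mu]_x f x.
Proof.
move=> hf fM; rewrite -[leLHS]Rintegral_cstT; apply: le_Rint => //.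
exact: Linfty_cst.
Qed.

Lemma Rint_norm_le f (M : R) : Linfty f -> (forall x, `|f x| <= M) ->
  `|\int[mu]_x f x| <= M.
Proof.
move=> hf fM; rewrite ler_norml Rint_ge_cst ?Rint_le_cst// => x;
  by have := fM x; rewrite ler_norml => /andP[].
Qed.

Lemma le_norm_Rint f : Linfty f -> `|\int[mu]_x f x| <= \int[mu]_x `|f x|.
Proof. by move=> hf; apply: le_normr_Rintegral => //; exact: Linfty_integrable. Qed.

Lemma Rint_sum (I : Type) (s : seq I) (F : I -> T -> R) :
  (forall i, Linfty (F i)) ->
  \int[mu]_x (\sum_(i <- s) F i x) = \sum_(i <- s) \int[mu]_x F i x.
Proof.
move=> hF; elim: s => [|i s ih].
  by under eq_Rintegral do rewrite big_nil; rewrite big_nil Rintegral_cstT.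
under eq_Rintegral do rewrite big_cons.
by rewrite RintD ?ih ?big_cons//; exact: Linfty_sum.
Qed.

(** Expand the nonnegative integral of [(f - m) ^+ 2], where [m] is the mean. *)
Lemma sqr_Rint_le f : Linfty f -> (\int[mu]_x f x) ^+ 2 <= \int[mu]_x (f x ^+ 2).
Proof.
move=> hf; set m := \int[mu]_x f x.
have : 0 <= \int[mu]_x ((f x - m) ^+ 2) by apply: Rintegral_ge0 => x _; exact: sqr_ge0.
have -> : \int[mu]_x ((f x - m) ^+ 2) = \int[mu]_x (f x ^+ 2 - (2 * m * f x - m ^+ 2)).
  by apply: eq_Rintegral => x _; ring.
have h : Linfty (fun x => 2 * m * f x) by apply: LinftyM => //; exact: Linfty_cst.
have h2 := Linfty_cst T (m ^+ 2).
rewrite RintB; [|exact: Linfty_sqr|exact: LinftyB].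
rewrite RintB// RintZl// Rintegral_cstT -/m; lra.
Qed.

Lemma eq_Rint f g : f =1 g -> \int[mu]_x f x = \int[mu]_x g x.
Proof. by move=> fg; apply: eq_Rintegral => x _; exact: fg. Qed.

End Linfty_integral.

Section Linfty_product.
Context d1 d2 (T1 : measurableType d1) (T2 : measurableType d2) (R : realType).
Implicit Types (h : T1 * T2 -> R) (P : probability T1 R) (Q : probability T2 R).

Lemma Linfty_fst (f : T1 -> R) : Linfty f -> Linfty (fun z : T1 * T2 => f z.1).
Proof. exact: Linfty_comp. Qed.

Lemma Linfty_snd (f : T2 -> R) : Linfty f -> Linfty (fun z : T1 * T2 => f z.2).
Proof. exact: Linfty_comp. Qed.

Lemma Linfty_section1 h x : Linfty h -> Linfty (fun y => h (x, y)).
Proof. by apply: Linfty_comp; exact: pair1_measurable. Qed.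

Lemma Linfty_section2 h y : Linfty h -> Linfty (fun x => h (x, y)).
Proof. by apply: Linfty_comp; exact: pair2_measurable. Qed.

Lemma Linfty_int2 Q h : Linfty h -> Linfty (fun x => \int[Q]_y h (x, y)).
Proof.
move=> hh; have [mh [M hM]] := hh; split.
  apply: (measurableT_comp (f := @fine R)) => //.
  (* The measurability of partial integrals is stated for a function integrable for a product
     measure; a Dirac mass serves as an arbitrary first factor. *)
  apply: (measurable_fubini_F (m1 := @dirac _ T1 point R)
           (m2 := Q) (f := EFin \o h)).
  exact: (@Linfty_integrable _ _ _ ((@dirac _ T1 point R : probability T1 R) \x Q)%E).
by exists M => x; apply: Rint_norm_le => //; exact: Linfty_section1.
Qed.

Lemma Rint_prod1 P Q h : Linfty h ->
  \int[(P \x Q)%E]_z h z = \int[P]_x \int[Q]_y h (x, y).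
Proof.
move=> hh; rewrite /Rintegral.
rewrite -(integral12_prod_meas1 (f := EFin \o h)); last exact: Linfty_integrable.
congr fine; apply: eq_integral => x _.
rewrite /fubini_F/= fineK//; apply: integrable_fin_num => //.
by apply: Linfty_integrable; exact: Linfty_section1.
Qed.

Lemma Rint_prod2 P Q h : Linfty h ->
  \int[(P \x Q)%E]_z h z = \int[Q]_y \int[P]_x h (x, y).
Proof.
move=> hh; rewrite /Rintegral.
rewrite -(integral21_prod_meas1 (f := EFin \o h)); last exact: Linfty_integrable.
congr fine; apply: eq_integral => x _.
rewrite /fubini_G/= fineK//; apply: integrable_fin_num => //.
by apply: Linfty_integrable; exact: Linfty_section2.
Qed.

Lemma Rint_swap P Q h : Linfty h ->
  \int[P]_x \int[Q]_y h (x, y) = \int[Q]_y \int[P]_x h (x, y).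
Proof. by move=> hh; rewrite -Rint_prod1// Rint_prod2. Qed.

End Linfty_product.

Lemma Linfty_swap d1 d2 (T1 : measurableType d1) (T2 : measurableType d2)
  (R : realType) (h : T1 * T2 -> R) : Linfty h -> Linfty (fun z : T2 * T1 => h (z.2, z.1)).
Proof.
by apply: Linfty_comp; exact: measurable_swap.
Qed.

Lemma Linfty_int1 d1 d2 (T1 : measurableType d1) (T2 : measurableType d2)
  (R : realType) (P : probability T1 R) (h : T1 * T2 -> R) :
  Linfty h -> Linfty (fun y => \int[P]_x h (x, y)).
Proof. by move=> /Linfty_swap; exact: Linfty_int2. Qed.

#[global] Hint Resolve Linfty_cst : core.
Ltac linf := try first [ assumption | exact: Linfty_cst | lazymatch goal with
  | |- Linfty (fun x => - _) => apply: LinftyN; linf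
  | |- Linfty (fun x => _ + _) => apply: LinftyD; linf
  | |- Linfty (fun x => _ ^+ 2) => apply: Linfty_sqr; linf
  | |- Linfty (fun x => _ * _) => apply: LinftyM; linf
  | |- Linfty (fun x => `|_|) => apply: Linfty_norm; linf
  | |- Linfty (fun x => expR _) => apply: Linfty_expR; linf
  end | (apply: Linfty_fst; assumption) | (apply: Linfty_snd; assumption) ].
(* [generalize] abstracts up to syntactic equality, whereas letting [lra] compare
   two integrals up to conversion takes minutes. *)
Ltac lra_goal :=
  repeat match goal with H : is_true _ |- _ => clear H end;
  repeat match goal with
    | |- context [Rintegral ?m ?D ?f] => generalize (Rintegral m D f)
    | |- context [ln ?x] => generalize (ln x)
    | |- context [expR ?x] => generalize (expR x)
  end; intros; lra.
#[local] Opaque Rintegral expR ln.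


(** * Sinkhorn iterations and potentials *)

Section geometric.
Context (R : realType).

Lemma geometric_cvg (u : nat -> R) (A k : R) : 0 <= A -> 0 <= k < 1 ->
  (forall n, `|u n.+1 - u n| <= A * k ^+ n) ->
  exists2 l, u n @[n --> \oo] --> l & forall n, `|u n - l| <= A * k ^+ n / (1 - k).
Proof.
move=> A0 /andP[k0 k1] hu.
have k1' : 0 < 1 - k by lra.
(* The exact value of the finite geometric sum is kept so that the induction closes with an
   equality; it is weakened afterwards. *)
have tail n m : `|u (n + m)%N - u n| <= A * k ^+ n * (1 - k ^+ m) / (1 - k).
  elim: m => [|m ih]; first by rewrite addn0 subrr normr0 expr0 subrr mulr0 mul0r.
  rewrite addnS (_ : _ - u n = (u (n + m).+1 - u (n + m)%N) + (u (n + m)%N - u n)); last by ring.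
  rewrite (le_trans (ler_normD _ _))//.
  have -> : A * k ^+ n * (1 - k ^+ m.+1) / (1 - k) =
      A * k ^+ (n + m) + A * k ^+ n * (1 - k ^+ m) / (1 - k).
    by rewrite exprD exprS; field; rewrite gt_eqF.
  by rewrite lerD.
have tail' n m : `|u (n + m)%N - u n| <= A * k ^+ n / (1 - k).
  apply: le_trans (tail n m) _.
  by rewrite ler_pM2r ?invr_gt0// ler_piMr ?mulr_ge0 ?exprn_ge0// gerBl exprn_ge0.
have k_cvg : A * k ^+ n / (1 - k) @[n --> \oo] --> (0 : R).
  rewrite (_ : (fun n => _) = fun n => A / (1 - k) * k ^+ n); last first.
    by apply/funext => n; rewrite mulrAC.
  rewrite -(mulr0 (A / (1 - k))).
  by apply: cvgMr; apply: cvg_expr; rewrite ger0_norm.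
have uc : cvgn u.
  apply: cauchy_cvg; apply: cauchy_exP => e e0.
  have /cvgn_epsP/(_ (e / 2)) := k_cvg.
  have e20 : 0 < e / 2 by lra.
  move=> /(_ e20)[N /(_ N (leqnn N))]; rewrite subr0 => hN.
  exists (u N); exists N => // n /= Nn.
  rewrite -ball_normE /= distrC -(subnKC Nn) (le_lt_trans (tail' _ _))//.
  rewrite (le_lt_trans (ler_norm _))// (le_lt_trans hN)//; lra.
exists (lim (u @ \oo)) => // n.
have := @cvgn_dist_le _ (fun m => u (m + n)%N) (lim (u @ \oo)) (u n) _ _ (fun m => _).
rewrite distrC; apply.
  by rewrite cvg_shiftn.
by move=> m; rewrite addnC; exact: tail'.
Qed.

End geometric.

(** Scalar core of the contraction of a Sinkhorn half-step. Here [i], [j] stand for the integrals of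
    [exp g] and [exp g'] against the kernel at one point, and [i'], [j'] for those at another, so
    [j / i] and [j' / i'] are averages of [exp (g' - g)], with values up to [E = exp (a + w)].
    Comparing kernels twice, at a factor [exp (- 2 M)] each, gives the constant
    [D = exp (- 4 M)]. *)
Lemma ln_ratio_contraction (R : realType) (M a w L i j i' j' : R) :
  0 <= M -> 0 <= w <= L -> 0 < i -> 0 < j -> 0 < i' -> 0 < j' ->
  expR a * i' <= j' -> j' <= expR (a + w) * i' -> expR (- (2 * M)) * i <= i' ->
  expR (- (2 * M)) * (expR (a + w) * i' - j') <= expR (a + w) * i - j ->
  (ln j - ln i) - (ln j' - ln i') <= (1 - expR (- (4 * M)) * expR (- L)) * w.
Proof.
set E := expR (a + w); set s := expR (- (2 * M)); pose D := expR (- (4 * M)).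
move=> M0 /andP[w0 wL] i0 j0 i'0 j'0 aj jE si sE.
have s0 : 0 < s by exact: expR_gt0.
have sD : D = s * s by rewrite /D /s -expRD; congr expR; ring.
have D1 : D <= 1 by rewrite /D -[leRHS]expR0 ler_expR; lra.
have D0 : 0 < D by exact: expR_gt0.
pose p := j / i; pose p' := j' / i'.
have ap' : expR a <= p' by rewrite ler_pdivlMr.
have p'E : p' <= E by rewrite ler_pdivrMr.
have p'0 : 0 < p' by exact: divr_gt0.
have pp' : D * (E - p') <= E - p.
  have e1 : E * i - j = (E - p) * i by rewrite mulrBl divfK ?gt_eqF.
  have e2 : E * i' - j' = (E - p') * i' by rewrite mulrBl divfK ?gt_eqF.
  move: sE; rewrite e1 e2 => sE.
  rewrite -(ler_pM2r i0) (le_trans _ sE)// sD -!mulrA ler_pM2l//.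
  by rewrite mulrCA ler_wpM2l ?subr_ge0.
have ratio : p / p' <= D + (1 - D) * expR w.
  rewrite ler_pdivrMr//.
  have : (1 - D) * E <= (1 - D) * expR w * p'.
    rewrite -mulrA ler_wpM2l ?subr_ge0// /E addrC expRD.
    by rewrite ler_pM2l ?expR_gt0.
  by move: pp'; lra_goal.
(* The left side is [exp w * (1 - D * (1 - exp (- w)))]. An a priori bound [L] on [w] is what makes
   [1 - exp (- w)] at least a fixed multiple of [w], hence the rate uniform. *)
have bound : D + (1 - D) * expR w <= expR ((1 - D * expR (- L)) * w).
  have hw1 : w * expR (- L) <= 1 - expR (- w).
    have hew : w * expR (- w) <= 1 - expR (- w).
      have := expR_ge1Dx w.
      by rewrite -(ler_pM2r (expR_gt0 (- w))) expRxMexpNx_1; lra_goal.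
    by apply: le_trans hew; rewrite ler_wpM2l// ler_expR lerN2.
  rewrite (_ : (1 - _) * w = w + - (D * (w * expR (- L)))); last by ring.
  rewrite expRD; have -> : D + (1 - D) * expR w = expR w * (1 - D * (1 - expR (- w))).
    transitivity (expR w - D * (expR w * 1 - expR w * expR (- w))); last by ring.
    by rewrite expRxMexpNx_1; ring.
  rewrite ler_pM2l ?expR_gt0//; apply: le_trans (expR_ge1Dx _).
  by rewrite lerD2l lerN2 ler_pM2l.
have -> : ln j - ln i - (ln j' - ln i') = ln (p / p').
  by rewrite ln_div ?posrE ?divr_gt0// !ln_div ?posrE.
rewrite -[leRHS]expRK ler_ln ?posrE ?expR_gt0 ?divr_gt0//.
exact: le_trans bound.
Qed.

(** * The soft [c]-transform and its contraction of oscillations *)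

Section softmin.
Context d1 d2 (T1 : measurableType d1) (T2 : measurableType d2) (R : realType).
Variables (c : T1 * T2 -> R) (M : R).
Hypotheses (hc : Linfty c) (cM : forall z, `|c z| <= M).
Implicit Types (Q : probability T2 R) (g : T2 -> R).

Definition osc_le U (h : U -> R) (w : R) := forall x y, h x - h y <= w.

Lemma osc_le_range U (u0 : U) (h : U -> R) (w K : R) : (forall x, `|h x| <= K) ->
  osc_le h w -> exists a, forall x, a <= h x <= a + w.
Proof.
move=> hK hw; have lb : has_lbound (range h).
  by exists (- K) => _ [x _ <-]; have := hK x; rewrite ler_norml => /andP[].
have ne : range h !=set0 by exists (h u0); exists u0.
exists (inf (range h)) => x; apply/andP; split.
  by apply: ge_inf => //; exists x.
rewrite -lerBlDr; apply: lb_le_inf => // _ [y _ <-].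
by have := hw x y; lra.
Qed.

(** The soft [c]-transform, half of a Sinkhorn step: the potential equations say that each potential
    is the transform of the other one. *)
Definition softmin Q g x : R := - ln (\int[Q]_y (expR (- c (x, y)) * expR (g y))).

Let I Q g x : R := \int[Q]_y (expR (- c (x, y)) * expR (g y)).

Let hk : Linfty (fun z => expR (- c z)). Proof. by linf. Qed.

Let hI (x : T1) g : Linfty g -> Linfty (fun y => expR (- c (x, y)) * expR (g y)).
Proof. by move=> hg; apply: LinftyM; [exact: Linfty_section1 hk|linf]. Qed.

Let kM x y : expR (- M) <= expR (- c (x, y)) <= expR M.
Proof.
by rewrite !ler_expR; have := cM (x, y); rewrite ler_norml => /andP[? ?]; apply/andP; split; lra.
Qed.

Let I_gt0 Q g : Linfty g -> exists2 a, 0 < a & forall x, a <= I Q g x.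
Proof.
move=> hg; have [mg [G gG]] := hg.
exists (expR (- M) * expR (- G)) => [|x]; first by rewrite mulr_gt0 ?expR_gt0.
apply: Rint_ge_cst; first exact: hI.
move=> y; apply: ler_pM; rewrite ?expR_ge0//; first by have /andP[] := kM x y.
by rewrite ler_expR; have := gG y; rewrite ler_norml => /andP[].
Qed.

Let I_pos Q g x : Linfty g -> 0 < I Q g x.
Proof. by move=> /(I_gt0 Q)[a a0 /(_ x)]; exact: lt_le_trans. Qed.

Lemma Linfty_softmin Q g : Linfty g -> Linfty (softmin Q g).
Proof.
move=> hg; apply: LinftyN; have [a a0 aI] := I_gt0 Q hg.
apply: (Linfty_ln a0 aI); apply: (@Linfty_int2 _ _ _ _ _ Q (fun z => expR (- c z) * expR (g z.2))).
by linf.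
Qed.

Lemma softmin_shift Q g (a : R) x : Linfty g ->
  softmin Q (fun y => g y + a) x = softmin Q g x - a.
Proof.
move=> hg; rewrite /softmin.
rewrite (@eq_Rint _ _ _ Q _ (fun y => expR (- c (x, y)) * expR (g y) * expR a)); last first.
  by move=> y; rewrite expRD mulrA.
rewrite RintZr; last exact: hI.
by rewrite lnM ?posrE ?expR_gt0 ?I_pos// expRK; ring.
Qed.

Lemma softmin_mass Q g x : Linfty g ->
  \int[Q]_y (expR (- c (x, y)) * expR (softmin Q g x + g y)) = 1.
Proof.
move=> hg; rewrite (@eq_Rint _ _ _ Q _
  (fun y => expR (- c (x, y)) * expR (g y) * (I Q g x)^-1)).
  by rewrite RintZr ?divff ?gt_eqF ?I_pos//; exact: hI.
move=> y; rewrite expRD /softmin [expR (- ln _)]expRN lnK ?posrE ?I_pos// -/(I Q g x); ring.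
Qed.

Lemma softmin_le Q g g' x : Linfty g -> Linfty g' -> (forall y, g y <= g' y) ->
  softmin Q g' x <= softmin Q g x.
Proof.
move=> hg hg' gg'; rewrite lerN2 ler_ln ?posrE ?I_pos//.
apply: le_Rint; [exact: hI|exact: hI|move=> y].
by rewrite ler_pM2l ?expR_gt0// ler_expR.
Qed.

(** Follows from the two structural properties alone: the transform reverses order, and adding a
    constant to [g] subtracts it from the transform. *)
Lemma softmin_nonexpansive Q g g' (e : R) x : Linfty g -> Linfty g' ->
  (forall y, `|g y - g' y| <= e) -> `|softmin Q g x - softmin Q g' x| <= e.
Proof.
move=> hg hg' gg'.
have he := Linfty_cst T2 e.
have h1 : softmin Q (fun y => g' y + e) x <= softmin Q g x.
  apply: softmin_le => //; first exact: LinftyD.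
  by move=> y; have := gg' y; rewrite ler_norml => /andP[]; lra_goal.
have h2 : softmin Q (fun y => g y + e) x <= softmin Q g' x.
  apply: softmin_le => //; first exact: LinftyD.
  by move=> y; have := gg' y; rewrite ler_norml => /andP[]; lra_goal.
move: h1 h2; rewrite !softmin_shift//.
generalize (softmin Q g x) (softmin Q g' x) => u v h1 h2.
by rewrite ler_norml; apply/andP; split; lra.
Qed.

Lemma softmin_norm_le Q g (G : R) x : Linfty g -> (forall y, `|g y| <= G) ->
  `|softmin Q g x| <= M + G.
Proof.
move=> hg gG; have hb y : expR (- (M + G)) <= expR (- c (x, y)) * expR (g y) <= expR (M + G).
  rewrite -expRD !ler_expR; have := cM (x, y); have := gG y.
  by rewrite !ler_norml => /andP[? ?] /andP[? ?]; apply/andP; split; lra.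
rewrite /softmin normrN ler_norml; apply/andP; split.
  rewrite -[leLHS]expRK ler_ln ?posrE ?expR_gt0 ?I_pos//.
  by apply: Rint_ge_cst => [|y]; [exact: hI|case/andP: (hb y)].
rewrite -[leRHS]expRK ler_ln ?posrE ?expR_gt0 ?I_pos//.
by apply: Rint_le_cst => [|y]; [exact: hI|case/andP: (hb y)].
Qed.

Let k_ratio x x' y : expR (- (2 * M)) * expR (- c (x', y)) <= expR (- c (x, y)).
Proof.
rewrite -expRD ler_expR; have := cM (x, y); have := cM (x', y).
by rewrite !ler_norml => /andP[? ?] /andP[? ?]; lra.
Qed.

Let I_ratio Q x x' (h : T2 -> R) : Linfty h -> (forall y, 0 <= h y) ->
  expR (- (2 * M)) * \int[Q]_y (expR (- c (x', y)) * h y) <=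
  \int[Q]_y (expR (- c (x, y)) * h y).
Proof.
move=> hh h0.
have hm z : Linfty (fun y => expR (- c (z, y)) * h y).
  by apply: LinftyM => //; exact: Linfty_section1 hk.
rewrite -RintZl//; apply: le_Rint => //; first exact: LinftyM.
by move=> y; rewrite mulrA ler_wpM2r.
Qed.

(** Moving [x] changes the kernel by a factor at most [exp (2 M)], whatever weight [exp g] it is
    integrated against; hence a bound free of [g]. *)
Lemma softmin_osc Q g : Linfty g -> osc_le (softmin Q g) (2 * M).
Proof.
move=> hg x x'; rewrite /softmin -/(I Q g x) -/(I Q g x').
have hg' : Linfty (fun y => expR (g y)) by linf.
have := I_ratio Q x x' hg' (fun=> expR_ge0 _).
rewrite -/(I Q g x) -/(I Q g x') => h.
have : - (2 * M) + ln (I Q g x') <= ln (I Q g x).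
  rewrite -{1}[- (2 * M)]expRK -lnM ?posrE ?expR_gt0 ?I_pos// ler_ln ?posrE ?I_pos//.
  by rewrite mulr_gt0 ?expR_gt0 ?I_pos.
by lra_goal.
Qed.

(* If [a <= g' - g <= a + w], then [p x = I g' x / I g x] is an average of
   [exp (g' - g)] with respect to a probability [mu_x], and
   [mu_x >= exp (- 4 M) mu_x'], whatever [g] is. *)
Lemma softmin_contraction Q g g' (w L : R) : Linfty g -> Linfty g' -> 0 <= w <= L ->
  osc_le (fun y => g' y - g y) w ->
  osc_le (fun x => softmin Q g x - softmin Q g' x) ((1 - expR (- (4 * M)) * expR (- L)) * w).
Proof.
move=> hg hg' /andP[w0 wL] ow x x'.
have [_ [K hK]] := LinftyB hg' hg.
have [a ha] := osc_le_range (point : T2) hK ow.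
pose E := expR (a + w).
have hE : Linfty (fun y => E * expR (g y) - expR (g' y)) by linf.
have hE0 y : 0 <= E * expR (g y) - expR (g' y).
  by rewrite subr_ge0 -expRD ler_expR; have /andP[] := ha y; lra_goal.
have IE z : \int[Q]_y (expR (- c (z, y)) * (E * expR (g y) - expR (g' y))) =
   E * I Q g z - I Q g' z.
  rewrite (@eq_Rint _ _ _ Q _ (fun y => E * (expR (- c (z, y)) * expR (g y))
     - expR (- c (z, y)) * expR (g' y))); last by move=> y; ring.
  have h1 := hI z hg; have h2 := hI z hg'.
  by rewrite RintB ?RintZl//; exact: LinftyM.
have := I_ratio Q x x' hE hE0; rewrite !IE.
have hg1 : Linfty (fun y => expR (g y)) by linf.
have := I_ratio Q x' x hg1 (fun=> expR_ge0 _).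
rewrite -/(I Q g x) -/(I Q g x').
have Ix := I_pos Q x hg; have Ix' := I_pos Q x' hg.
have Jx := I_pos Q x hg'; have Jx' := I_pos Q x' hg'.
have h3 : expR a * I Q g x' <= I Q g' x'.
  rewrite -RintZl; last exact: hI.
  apply: le_Rint; [by apply: LinftyM => //; exact: hI|exact: hI|move=> y].
  by rewrite mulrCA ler_pM2l ?expR_gt0// -expRD ler_expR; have /andP[] := ha y; lra_goal.
have h4 : I Q g' x' <= E * I Q g x'.
  rewrite -RintZl; last exact: hI.
  apply: le_Rint; [exact: hI|by apply: LinftyM => //; exact: hI|move=> y].
  by rewrite [leRHS]mulrCA ler_pM2l ?expR_gt0// -expRD ler_expR; have /andP[] := ha y; lra_goal.
move=> h2 h1.
have M0 : 0 <= M := le_trans (normr_ge0 _) (cM (x, point)).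
have := @ln_ratio_contraction R M a w L _ _ _ _ M0 _ Ix Jx Ix' Jx' h3 h4 h2 h1.
rewrite w0 wL => /(_ isT); apply: le_trans.
rewrite /softmin -/(I Q g x) -/(I Q g' x) -/(I Q g x') -/(I Q g' x').
by generalize (ln (I Q g x)) (ln (I Q g' x)) (ln (I Q g x')) (ln (I Q g' x')); lra_goal.
Qed.

End softmin.

(** Average [h z - h x] over [z]. Contraction only controls functions up to constants, and this is
    how a normalization turns it into a bound on values. *)
Lemma osc_le_mean0 d (T : measurableType d) (R : realType) (mu : probability T R)
    (h : T -> R) (w : R) : Linfty h -> osc_le h w -> \int[mu]_x h x = 0 ->
  forall x, `|h x| <= w.
Proof.
move=> hh hw h0 x; rewrite ler_norml; apply/andP; split.
  have : \int[mu]_z (h z - h x) <= w by apply: Rint_le_cst => //; exact: LinftyB.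
  by rewrite RintB// h0 Rintegral_cstT sub0r lerNl.
have : \int[mu]_z (h x - h z) <= w by apply: Rint_le_cst => //; exact: LinftyB.
by rewrite RintB// h0 Rintegral_cstT subr0.
Qed.

Section potentials.
Context d (T : measurableType d) (R : realType) (c : T * T -> R) (M : R).
Hypotheses (hc : Linfty c) (cM : forall z, `|c z| <= M).
Implicit Types (P Q : probability T R) (g : T -> R).

Definition transpose (h : T * T -> R) (z : T * T) := h (z.2, z.1).

Definition sinkhorn P Q g : T -> R := softmin (transpose c) P (softmin c Q g).

Let hct : Linfty (transpose c). Proof. exact: Linfty_swap. Qed.
Let ctM z : `|transpose c z| <= M. Proof. exact: cM. Qed.

Let M0 : 0 <= M. Proof. exact: le_trans (normr_ge0 _) (cM (point, point)). Qed.

Lemma Linfty_sinkhorn P Q g : Linfty g -> Linfty (sinkhorn P Q g).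
Proof. by move=> hg; apply: (Linfty_softmin hct ctM); exact: (Linfty_softmin hc cM). Qed.

Let rate (L : R) := 1 - expR (- (4 * M)) * expR (- L).

Let rate01 L : 0 <= L -> 0 <= rate L < 1.
Proof.
move=> L0; rewrite /rate -expRD; have e0 : 0 < expR (- (4 * M) - L) by exact: expR_gt0.
have e1 : expR (- (4 * M) - L) <= 1.
  by rewrite -[leRHS]expR0 ler_expR; have := M0; lra.
by apply/andP; split; lra.
Qed.

(** Both half-steps contract, but one factor [rate L] suffices and the second is bounded by 1. Since
    a half-step reverses order, [g] and [g'] exchange roles between the two applications. *)
Lemma sinkhorn_contraction P Q g g' (w L : R) : Linfty g -> Linfty g' -> 0 <= w <= L ->
  osc_le (fun y => g' y - g y) w ->
  osc_le (fun y => sinkhorn P Q g' y - sinkhorn P Q g y) (rate L * w).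
Proof.
move=> hg hg' /andP[w0 wL] ow.
have wL' : 0 <= w <= L by rewrite w0.
have h1 := softmin_contraction hc cM Q hg hg' wL' ow.
have /andP[r0 r1] := rate01 (le_trans w0 wL).
have rw0 : 0 <= rate L * w by exact: mulr_ge0.
have rwL : rate L * w <= L.
  by rewrite (le_trans _ wL)// ler_piMl// ltW.
have rwL' : 0 <= rate L * w <= L by rewrite rw0.
have h2 := softmin_contraction hct ctM P (Linfty_softmin hc cM Q hg')
  (Linfty_softmin hc cM Q hg) rwL' h1.
move=> x y; apply: le_trans (h2 x y) _.
by rewrite ler_piMl// ltW.
Qed.

(** Both second components are fixed by [sinkhorn], so the oscillation of their difference is
    multiplied by a rate below 1 as often as desired. It is therefore zero, and the common
    normalization removes the remaining constant. *)
Lemma potentials_unique P Q fg fg' : are_potentials c P Q fg ->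
  are_potentials c P Q fg' -> fg = fg'.
Proof.
case: fg fg' => f g [f' g'] [/= [hf hg] fE gE g0] [/= [hf' hg'] fE' gE' g0'].
have gS : sinkhorn P Q g = g.
  apply/funext => y; rewrite [RHS]gE; congr (- ln _); apply: eq_Rint => x.
  by rewrite [f x]fE.
have gS' : sinkhorn P Q g' = g'.
  apply/funext => y; rewrite [RHS]gE'; congr (- ln _); apply: eq_Rint => x.
  by rewrite [f' x]fE'.
have hD : Linfty (fun y => g' y - g y) by exact: LinftyB.
have [_ [K hK]] := hD.
have K0 : 0 <= 2 * K by rewrite mulr_ge0// (le_trans _ (hK point)).
have /andP[r0 r1] := rate01 K0.
have osc0 : osc_le (fun y => g' y - g y) (2 * K).
  move=> x y; have := hK x; have := hK y; rewrite !ler_norml => /andP[+ _] /andP[_ +].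
  by lra_goal.
have iter_osc n : osc_le (fun y => g' y - g y) (rate (2 * K) ^+ n * (2 * K)).
  elim: n => [|n ih]; first by rewrite expr0 mul1r.
  have := @sinkhorn_contraction P Q g g' _ (2 * K) hg hg' _ ih.
  rewrite gS gS' exprS -mulrA; apply.
  rewrite mulr_ge0 ?exprn_ge0//= ler_piMl//.
  by rewrite exprn_ile1// ltW.
have osc00 : osc_le (fun y => g' y - g y) 0.
  move=> x y; have hr : rate (2 * K) ^+ n * (2 * K) @[n --> \oo] --> (0 : R).
    rewrite -(mul0r (2 * K)); apply: cvgMl; apply: cvg_expr.
    by rewrite ger0_norm.
  have /cvgn_epsP hr' := hr.
  apply/ler_addgt0Pr => e /hr'[N /(_ _ (leqnn N))]; rewrite subr0 add0r => hN.
  by apply: le_trans (iter_osc N x y) _; apply: le_trans hN; exact: ler_norm.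
have gg' : g' = g.
  apply/funext => y; apply/eqP; rewrite -subr_eq0 -normr_le0.
  apply: (osc_le_mean0 (mu := Q) hD osc00).
  by rewrite RintB// g0 g0' subrr.
congr pair; last by rewrite gg'.
by apply/funext => x; rewrite fE fE' gg'.
Qed.

(** Recentring after every step, since a Sinkhorn step contracts only modulo constants. *)
Definition sinkhorn0 P Q g y := sinkhorn P Q g y - \int[Q]_z sinkhorn P Q g z.

Definition sinkhorn_iter P Q n : T -> R := iter n (sinkhorn0 P Q) (cst 0).

Lemma sinkhorn_iterS P Q n :
  sinkhorn_iter P Q n.+1 = sinkhorn0 P Q (sinkhorn_iter P Q n).
Proof. by []. Qed.

Lemma Linfty_sinkhorn_iter P Q n : Linfty (sinkhorn_iter P Q n).
Proof.
elim: n => [|n ih]; first exact: Linfty_cst.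
by apply: LinftyB => //; exact: Linfty_sinkhorn.
Qed.

Lemma sinkhorn_mean0 P Q g : Linfty g -> \int[Q]_y sinkhorn0 P Q g y = 0.
Proof. by move=> hg; rewrite RintB ?Rintegral_cstT ?subrr//; exact: Linfty_sinkhorn. Qed.

Let sinkhorn0_osc P Q g g' w :
  osc_le (fun y => sinkhorn P Q g' y - sinkhorn P Q g y) w ->
  osc_le (fun y => sinkhorn0 P Q g' y - sinkhorn0 P Q g y) w.
Proof.
move=> + x y => /(_ x y); rewrite /sinkhorn0.
generalize (sinkhorn P Q g' x) (sinkhorn P Q g x) (sinkhorn P Q g' y) (sinkhorn P Q g y).
by lra_goal.
Qed.

Lemma sinkhorn0_nonexpansive P Q g g' (e : R) : Linfty g -> Linfty g' ->
  (forall y, `|g y - g' y| <= e) ->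
  forall y, `|sinkhorn0 P Q g y - sinkhorn0 P Q g' y| <= 2 * e.
Proof.
move=> hg hg' gg' y.
have S1 z : `|sinkhorn P Q g z - sinkhorn P Q g' z| <= e.
  apply: (softmin_nonexpansive hct ctM) => [||x]; [exact: (Linfty_softmin hc cM)..|].
  exact: (softmin_nonexpansive hc cM).
have S2 : `|\int[Q]_z sinkhorn P Q g z - \int[Q]_z sinkhorn P Q g' z| <= e.
  rewrite -RintB; [|exact: Linfty_sinkhorn..].
  by apply: Rint_norm_le => //; apply: LinftyB; exact: Linfty_sinkhorn.
have := S1 y; move: S2; rewrite /sinkhorn0 !ler_norml => /andP[? ?] /andP[? ?].
generalize dependent (sinkhorn P Q g y); generalize dependent (sinkhorn P Q g' y).
generalize dependent (\int[Q]_z sinkhorn P Q g z).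
generalize dependent (\int[Q]_z sinkhorn P Q g' z).
by move=> *; apply/andP; split; lra.
Qed.

(** The first step already has oscillation at most [2 * M] whatever the starting point, which
    provides both the initial width and the a priori bound [L] of the contraction for all later
    steps. *)
Lemma sinkhorn_iter_step P Q n y :
  `|sinkhorn_iter P Q n.+1 y - sinkhorn_iter P Q n y| <= (2 * M) * rate (2 * M) ^+ n.
Proof.
have M20 : 0 <= 2 * M by rewrite mulr_ge0.
have /andP[r0 r1] := rate01 M20.
have h n := @Linfty_sinkhorn_iter P Q n.
move: y; apply: (osc_le_mean0 (mu := Q)); first by apply: LinftyB; exact: h.
  elim: n => [|n ih].
    rewrite expr0 mulr1 sinkhorn_iterS => x y.
    have := softmin_osc hct ctM P (Linfty_softmin hc cM Q (h 0%N)) x y.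
    rewrite -/(sinkhorn P Q (sinkhorn_iter P Q 0)) /sinkhorn0.
    rewrite (_ : sinkhorn_iter P Q 0 x = 0)// (_ : sinkhorn_iter P Q 0 y = 0)//.
    generalize (sinkhorn P Q (sinkhorn_iter P Q 0) x).
    generalize (sinkhorn P Q (sinkhorn_iter P Q 0) y).
    by lra_goal.
  rewrite exprS mulrCA [sinkhorn_iter P Q n.+2]sinkhorn_iterS.
  rewrite {2}[sinkhorn_iter P Q n.+1]sinkhorn_iterS.
  apply: sinkhorn0_osc; apply: (sinkhorn_contraction P Q (h n) (h n.+1) _ ih).
  by rewrite mulr_ge0 ?exprn_ge0//= ler_piMr ?exprn_ile1 ?(ltW r1).
have e n' : \int[Q]_y sinkhorn_iter P Q n' y = 0.
  case: n' => [|n']; first exact: Rintegral_cstT.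
  by rewrite sinkhorn_iterS sinkhorn_mean0//; exact: h.
by rewrite RintB// !e subrr.
Qed.

(** The limit is first known to be fixed by the recentred map only, so that the second potential
    equation holds up to a constant [k0], which is then shown to vanish. The convergence is part of
    the conclusion because measurability in the sample is deduced from it. *)
Lemma potentials_exist P Q : exists2 fg, are_potentials c P Q fg &
  forall y, sinkhorn_iter P Q n y @[n --> \oo] --> fg.2 y.
Proof.
have M20 : 0 <= 2 * M by rewrite mulr_ge0.
have r01 := rate01 M20; have /andP[r0 r1] := r01.
have h n := @Linfty_sinkhorn_iter P Q n.
have lims y := geometric_cvg M20 r01 (fun n => sinkhorn_iter_step P Q n y).
pose g y := sval (cid2 (lims y)).
have gl y : sinkhorn_iter P Q n y @[n --> \oo] --> g y by rewrite /g; case: cid2.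
have gb n y : `|sinkhorn_iter P Q n y - g y| <=
    2 * M * rate (2 * M) ^+ n / (1 - rate (2 * M)).
  by rewrite /g; case: cid2.
set B := fun n => 2 * M * rate (2 * M) ^+ n / (1 - rate (2 * M)).
have r1' : 0 < 1 - rate (2 * M) by rewrite subr_gt0.
have B0 : B n @[n --> \oo] --> (0 : R).
  rewrite (_ : B = fun n => 2 * M / (1 - rate (2 * M)) * rate (2 * M) ^+ n); last first.
    by apply/funext => n; rewrite /B mulrAC.
  rewrite -(mulr0 (2 * M / (1 - rate (2 * M)))).
  by apply: cvgMr; apply: cvg_expr; rewrite ger0_norm.
have hg : Linfty g.
  apply: (Linfty_lim (u := sinkhorn_iter P Q) (M := B 0%N + B 0%N)) => // [n|n y].
    by have [] := h n.
  have b0 : `|g y| <= B 0%N by have := gb 0%N y; rewrite sub0r normrN.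
  rewrite -[sinkhorn_iter _ _ _ _](subrK (g y)) (le_trans (ler_normD _ _))// lerD//.
  apply: le_trans (gb n y) _.
  rewrite /B ler_wpM2r ?invr_ge0 ?(ltW r1')// ler_wpM2l// expr0.
  by rewrite exprn_ile1// ltW.
have mean0 : \int[Q]_y g y = 0.
  have hn n : \int[Q]_y sinkhorn_iter P Q n y = 0.
    case: n => [|n]; first exact: Rintegral_cstT.
    by rewrite sinkhorn_iterS sinkhorn_mean0//; exact: h.
  apply/eqP; rewrite -normr_le0; apply/ler_addgt0Pr => e e0.
  have /cvgn_epsP/(_ _ e0)[N /(_ N (leqnn N))] := B0; rewrite subr0 => hN.
  rewrite add0r -[X in `|X|]subr0 -(hn N) -RintB//.
  apply: Rint_norm_le; first exact: LinftyB.
  by move=> y; rewrite distrC (le_trans (gb N y))// (le_trans _ hN)// ler_norm.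
set f := softmin c Q g; have hf : Linfty f := Linfty_softmin hc cM Q hg.
have gS y : g y = sinkhorn0 P Q g y.
  apply: (@cvgn_unique _ (fun n => sinkhorn_iter P Q n.+1 y)).
    by rewrite (cvg_shiftS (fun n => sinkhorn_iter P Q n y)).
  apply/cvgn_epsP => e e0; have e20 : 0 < e / 2 by rewrite divr_gt0.
  have /cvgn_epsP/(_ _ e20)[N hN] := B0; exists N => n /hN; rewrite subr0 => Bn.
  rewrite sinkhorn_iterS (le_trans (sinkhorn0_nonexpansive P Q _ hg (e := e / 2) _ _))//.
    by move=> z; rewrite (le_trans (gb n z))// (le_trans _ Bn)// ler_norm.
  by rewrite mulrC divfK.
have SgE y : sinkhorn P Q g y = g y + \int[Q]_z sinkhorn P Q g z.
  by rewrite [in RHS]gS subrK.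
set k0 := \int[Q]_z _ in SgE.
(* The total mass of [exp (f + g - c)] is [1] in both orders of integration. *)
have k00 : k0 = 0.
  have m1 : \int[P]_x \int[Q]_y (expR (- c (x, y)) * expR (f x + g y)) = 1.
    rewrite -[RHS](Rintegral_cstT P); apply: eq_Rint => x.
    exact: (softmin_mass hc cM).
  have m2 : \int[Q]_y \int[P]_x (expR (- c (x, y)) * expR (f x + g y) * expR k0) = 1.
    rewrite -[RHS](Rintegral_cstT Q); apply: eq_Rint => y.
    rewrite -[RHS](softmin_mass hct ctM P y hf); apply: eq_Rint => x.
    rewrite -mulrA -expRD -/(sinkhorn P Q g) SgE; congr (_ * expR _); ring.
  have hh : Linfty (fun z : T * T => expR (- c z) * expR (f z.1 + g z.2)) by linf.
  have hh2 := LinftyM hh (Linfty_cst _ (expR k0)).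
  move: m2; rewrite -(@Rint_swap _ _ _ _ _ P Q _ hh2).
  rewrite (@eq_Rint _ _ _ P _ (fun x =>
      (\int[Q]_y (expR (- c (x, y)) * expR (f x + g y))) * expR k0)); last first.
    by move=> x; rewrite RintZr//; exact: (Linfty_section1 x hh).
  rewrite RintZr; last exact: (Linfty_int2 Q hh).
  by rewrite m1 mul1r => /(congr1 (@ln R)); rewrite expRK ln1.
exists (f, g) => //; split => //= y.
by rewrite -[LHS]addr0 -k00 -SgE.
Qed.

Lemma potentialsP P Q : are_potentials c P Q (potentials c P Q).
Proof.
by have [fg h _] := potentials_exist P Q; apply: (@xgetPex _ (cst 0, cst 0)); exists fg.
Qed.

Lemma sinkhorn_iter_cvg P Q y : sinkhorn_iter P Q n y @[n --> \oo] --> (potentials c P Q).2 y.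
Proof.
by have [fg h +] := potentials_exist P Q; rewrite (potentials_unique h (potentialsP P Q)).
Qed.

Lemma potential1E P Q x : (potentials c P Q).1 x = softmin c Q (potentials c P Q).2 x.
Proof. by have [_ -> _ _] := potentialsP P Q. Qed.

Lemma potential2E P Q y :
  (potentials c P Q).2 y = softmin (transpose c) P (potentials c P Q).1 y.
Proof. by have [_ _ -> _] := potentialsP P Q. Qed.

Lemma Linfty_potential1 P Q : Linfty (potentials c P Q).1.
Proof. by have [[]] := potentialsP P Q. Qed.

Lemma Linfty_potential2 P Q : Linfty (potentials c P Q).2.
Proof. by have [[]] := potentialsP P Q. Qed.

Lemma Linfty_xi P Q : Linfty (xi c P Q).
Proof.
have h1 := Linfty_potential1 P Q; have h2 := Linfty_potential2 P Q.
suff : Linfty (fun z => expR (- c z) *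
  expR ((potentials c P Q).1 z.1 + (potentials c P Q).2 z.2)) by [].
by linf.
Qed.

Lemma potential2_norm P Q y : `|(potentials c P Q).2 y| <= 2 * M.
Proof.
have [_ _ _ g0] := potentialsP P Q.
apply: (osc_le_mean0 (mu := Q) (Linfty_potential2 P Q) _ g0) => y1 y2.
by rewrite !potential2E; apply: (softmin_osc hct ctM); exact: Linfty_potential1.
Qed.

Lemma potential1_norm P Q x : `|(potentials c P Q).1 x| <= 3 * M.
Proof.
rewrite potential1E (_ : 3 * M = M + 2 * M); last by ring.
apply: (softmin_norm_le hc cM); first exact: Linfty_potential2.
exact: potential2_norm.
Qed.

(** The exponent is at most [M + 3 M + 2 M]: the cost and the two potentials. *)
Lemma xi_bounds P Q z : expR (- (6 * M)) <= xi c P Q z <= expR (6 * M).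
Proof.
rewrite /xi /C -expRD !ler_expR.
have := potential1_norm P Q z.1; have := potential2_norm P Q z.2; have := cM z.
by rewrite !ler_norml => /andP[? ?] /andP[? ?] /andP[? ?]; apply/andP; split; lra.
Qed.

Lemma xi_marginal1 P Q x : \int[Q]_y xi c P Q (x, y) = 1.
Proof.
rewrite -[RHS](softmin_mass hc cM Q x (Linfty_potential2 P Q)).
by apply: eq_Rint => y; rewrite -potential1E.
Qed.

Lemma xi_marginal2 P Q y : \int[P]_x xi c P Q (x, y) = 1.
Proof.
rewrite -[RHS](softmin_mass hct ctM P y (Linfty_potential1 P Q)).
by apply: eq_Rint => x; rewrite -potential2E addrC.
Qed.

End potentials.


(** * The density of the entropic plan *)

#[local] Transparent Rintegral.

Lemma ln_lt_sub1 (R : realType) (t : R) : 0 < t -> t != 1 -> ln t < t - 1.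
Proof.
move=> t0 t1; rewrite -ltr_expR lnK ?posrE//.
have := @expR_gt1Dx R (t - 1); rewrite subr_eq0 => /(_ t1).
by rewrite addrC subrK.
Qed.

Lemma ln_le_sub1 (R : realType) (t : R) : 0 < t -> ln t <= t - 1.
Proof.
by move=> t0; have [->|/(ln_lt_sub1 t0)/ltW//] := eqVneq t 1; rewrite ln1 subrr.
Qed.

(** Applying the inequality to the complement reverses it, both total masses being 1. *)
Lemma probability_le_eq d (S : measurableType d) (R : realType) (p q : probability S R) :
  (forall A, measurable A -> (p A <= q A)%E) -> forall A, measurable A -> p A = q A.
Proof.
move=> pq A mA; apply/eqP; rewrite eq_le pq//=.
have := pq _ (measurableC mA); rewrite !probability_setC//.
by rewrite leeD2lE// leeN2.
Qed.

Definition is_density d (S : measurableType d) (R : realType) (m : probability S R)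
  (h : S -> R) := [/\ Linfty h, forall z, 0 <= h z & \int[m]_z h z = 1].

(** The probability with density [h]. Carrying the proof of [is_density] as an argument lets the
    measure and probability structures be inferred from the term [tilt dh]. *)
Definition tilt d (S : measurableType d) (R : realType) (m : probability S R)
    (h : S -> R) (_ : is_density m h) (A : set S) : \bar R :=
  \int[m]_(z in A) (h z)%:E.

Section tilt.
Context d (S : measurableType d) (R : realType) (m : probability S R) (h : S -> R)
  (dh : is_density m h).

Let tilt0 : tilt dh set0 = 0%E. Proof. by rewrite /tilt integral_set0. Qed.

Let tilt_ge0 A : (0 <= tilt dh A)%E.
Proof. by apply: integral_ge0 => z _; rewrite lee_fin; case: dh. Qed.

Let tilt_sigma_additive : semi_sigma_additive (tilt dh).
Proof.
have [[mh _] h0 _] := dh; apply: semi_sigma_additive_nng_induced.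
  exact/measurable_EFinP.
by move=> x; rewrite lee_fin.
Qed.

HB.instance Definition _ := isMeasure.Build _ _ _ (tilt dh)
  tilt0 tilt_ge0 tilt_sigma_additive.

Let tilt_setT : tilt dh setT = 1%E.
Proof.
have [hh h0 h1] := dh; rewrite /tilt -[LHS]fineK ?[fine _]h1//.
by apply: integrable_fin_num => //; exact: Linfty_integrable.
Qed.

HB.instance Definition _ := @Measure_isProbability.Build _ _ R (tilt dh) tilt_setT.

Lemma tilt_dominates : tilt dh `<< m.
Proof.
apply/null_content_dominatesP => A mA mA0; apply: null_set_integral => //.
by apply/measurable_EFinP; apply: measurable_funTS; case: dh => -[].
Qed.

Lemma tilt_RN : ae_eq m setT
  (Radon_Nikodym (charge_of_finite_measure (tilt dh)) m) (EFin \o h).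
Proof.
have [[mh _] h0 h1] := dh.
apply: integral_ae_eq => //.
- by apply: Radon_Nikodym_integrable; exact: tilt_dominates.
- exact/measurable_EFinP.
- move=> E _ mE; rewrite -Radon_Nikodym_integral//; exact: tilt_dominates.
Qed.

Lemma Rint_tilt (f : S -> R) : Linfty f ->
  \int[tilt dh]_z f z = \int[m]_z (f z * h z).
Proof.
move=> hf; have [[mh _] h0 h1] := dh; have [mf _] := hf.
rewrite /Rintegral -(Radon_Nikodym_change_of_variables tilt_dominates)//; last first.
  exact: Linfty_integrable.
congr fine; apply: ae_eq_integral => //.
- apply: emeasurable_funM; first exact/measurable_EFinP.
  apply: measurable_int; apply: Radon_Nikodym_integrable; exact: tilt_dominates.
- by apply/measurable_EFinP; exact: measurable_funM.
- apply: filterS tilt_RN => x /= + _ => /(_ I) ->.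
  by rewrite EFinM.
Qed.

End tilt.

Lemma measurable_lne d (S : measurableType d) (R : realType) (f : S -> \bar R) :
  (forall z, f z \is a fin_num) -> measurable_fun setT f ->
  measurable_fun setT (fun z => lne (f z)).
Proof.
move=> ffin mf; rewrite (_ : (fun z => _) = fun z =>
    if 0 < fine (f z) then (ln (fine (f z)))%:E else -oo%E); last first.
  apply/funext => z; have /fineK <- := ffin z.
  rewrite [fine (fine _)%:E]/=; case: ltP => fz; first by rewrite lne_EFin.
  by rewrite le0_lneNy// lee_fin.
apply: measurable_fun_ifT => //.
  by apply: measurable_fun_ltr => //; exact: measurableT_comp.
by apply/measurable_EFinP; apply: measurableT_comp => //; exact: measurableT_comp.
Qed.

(** * The Gibbs variational principle for relative entropy *)

Section gibbs.
Context d (S : measurableType d) (R : realType) (m : probability S R) (h : S -> R) (a : R).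
Hypotheses (dh : is_density m h) (a0 : 0 < a) (ah : forall z, a <= h z).

Let hh : Linfty h. Proof. by case: dh. Qed.
Let mh : measurable_fun setT h. Proof. by case: hh. Qed.
Let h0 z : 0 < h z. Proof. exact: lt_le_trans (ah z). Qed.
Let hln : Linfty (fun z => ln (h z)). Proof. exact: Linfty_ln ah _. Qed.

Variable nu : probability S R.
Hypothesis numu : nu `<< m.

Let f0 := Radon_Nikodym_SigmaFinite.f nu m.
Let r z := fine (f0 z).
Let f0E z : f0 z = (r z)%:E.
Proof. by rewrite /r fineK//; exact: Radon_Nikodym_SigmaFinite.f_fin_num. Qed.
Let r0 z : 0 <= r z.
Proof. by rewrite -lee_fin -f0E; exact: Radon_Nikodym_SigmaFinite.f_ge0. Qed.
Let mr : measurable_fun setT r.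
Proof.
apply: measurableT_comp => //; apply: measurable_int.
exact: Radon_Nikodym_SigmaFinite.f_integrable.
Qed.

Let nu_r A : measurable A -> nu A = (\int[m]_(z in A) (r z)%:E)%E.
Proof.
move=> mA; rewrite (Radon_Nikodym_SigmaFinite.f_integral numu mA).
by apply: eq_integral => z _; rewrite -f0E.
Qed.

Let mpos : measurable [set z | 0 < r z].
Proof. by rewrite -[X in measurable X]setTI; exact: measurable_fun_ltr. Qed.

Let r_pos : {ae nu, forall z, 0 < r z}.
Proof.
exists (~` [set z | 0 < r z]); split => //; first exact: measurableC.
rewrite nu_r; last exact: measurableC.
apply: integral0_eq => z /= /negP; rewrite -leNgt => rz.
by congr EFin; apply/eqP; rewrite eq_le rz r0.
Qed.

(** With [r] the density of [nu], the inequality [ln t <= t - 1] at [t = h / r] reads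
    [ln r >= ln h + 1 - q], and [u] is the gap. Where [r] vanishes, a [nu]-null set, [q] is 0 by the
    convention on inverses and [l] receives the value that makes [u] zero. *)
Let q z := h z / r z.
Let l z := if 0 < r z then ln (r z) else ln (h z) + 1.
Let u z := l z - (ln (h z) + 1 - q z).

Let mq : measurable_fun setT q.
Proof.
apply: measurable_funM => //; apply: measurableT_comp => //.
exact: measurable_invr.
Qed.

Let ml : measurable_fun setT l.
Proof.
apply: measurable_fun_ifT => //.
- exact: measurable_fun_ltr.
- exact: measurableT_comp.
- by apply: measurable_funD => //; case: hln.
Qed.

Let q_ge0 z : 0 <= q z. Proof. by rewrite divr_ge0// ltW. Qed.

(** This integral is the integral of [h] over the set where [r] is positive; it may fall short of 1
    when [r] vanishes somewhere. *)
Let int_q : (\int[nu]_z (q z)%:E <= 1)%E.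
Proof.
rewrite -(Radon_Nikodym_SigmaFinite.change_of_variables numu)//; last first.
  exact/measurable_EFinP.
have <- : (\int[m]_z (h z)%:E = 1)%E.
  have [_ _ h1] := dh; rewrite -[LHS]fineK ?[fine _]h1//.
  by apply: integrable_fin_num => //; exact: Linfty_integrable.
apply: ge0_le_integral => //.
- move=> z _; rewrite -/f0 f0E -EFinM lee_fin; exact: mulr_ge0.
- apply: emeasurable_funM; first exact/measurable_EFinP.
  by apply: measurable_int; exact: Radon_Nikodym_SigmaFinite.f_integrable.
- exact/measurable_EFinP.
move=> z _; rewrite -/f0 f0E -EFinM lee_fin /q.
have [->|rz] := eqVneq (r z) 0; first by rewrite mulr0 ltW.
by rewrite divfK.
Qed.

Let iq : nu.-integrable setT (EFin \o q).
Proof.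
apply/integrableP; split; first exact/measurable_EFinP.
under eq_integral do rewrite /= ger0_norm//.
by rewrite (le_lt_trans int_q)// ltry.
Qed.

Let ilow : nu.-integrable setT (EFin \o (fun z => ln (h z) + 1 - q z)).
Proof.
have hln1 : Linfty (fun z => ln (h z) + 1) by exact: LinftyD.
exact: (integrableB measurableT (Linfty_integrable nu hln1) iq).
Qed.

Let u_ge0 z : 0 <= u z.
Proof.
rewrite /u /l; case: ifPn => [rz|].
  have := ln_le_sub1 (divr_gt0 (h0 z) rz).
  by rewrite ln_div ?posrE// -/(q z); lra_goal.
rewrite -leNgt => rz; have {}rz : r z = 0 by apply/eqP; rewrite eq_le rz r0.
by rewrite /q rz invr0 mulr0 subr0 subrr.
Qed.

Let u_eq0 z : 0 < r z -> u z = 0 -> r z = h z.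
Proof.
rewrite /u /l => rz; rewrite rz => uz.
have [/divr1_eq//|hr] := eqVneq (h z / r z) 1.
have := ln_lt_sub1 (divr_gt0 (h0 z) rz) hr.
by rewrite ln_div ?posrE//; move: uz; rewrite /q; lra_goal.
Qed.

Let KL_l : KL nu m = (\int[nu]_z (l z)%:E)%E.
Proof.
rewrite /KL ifT; last exact/asboolP.
have mRN : measurable_fun setT (Radon_Nikodym (charge_of_finite_measure nu) m).
  by apply: measurable_int; apply: Radon_Nikodym_integrable.
apply: ae_eq_integral => //.
- apply: measurable_lne => // z; exact: Radon_Nikodym_fin_num.
- exact/measurable_EFinP.
- have [N [mN N0 hN]] := ae_eq_Radon_Nikodym_SigmaFinite numu measurableT.
  have nuN : nu N = 0%E by move/null_content_dominatesP : numu; exact.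
  have : {ae nu, forall z, Radon_Nikodym_SigmaFinite.f nu m z =
      Radon_Nikodym (charge_of_finite_measure nu) m z}.
    by exists N; split => // z /= hz; apply: hN => /= /(_ I).
  apply: filterS2 r_pos => z rz fE _.
  by rewrite -fE -/f0 f0E lne_EFin// /l rz.
Qed.

(** The negative part of [l] is dominated by the integrable lower bound [ln h + 1 - q], so the
    integral can diverge only to [+oo]. *)
Let int_l_cases : (\int[nu]_z (l z)%:E = +oo)%E \/ nu.-integrable setT (EFin \o l).
Proof.
have [lint|] := ltP (\int[nu]_z `|(l z)%:E|)%E +oo%E.
  by right; apply/integrableP; split => //; exact/measurable_EFinP.
rewrite leye_eq => /eqP lint; left.
rewrite integralE.
have neg : (\int[nu]_z ((EFin \o l)^\- z) < +oo)%E.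
  have /integrableP[_] := ilow; apply: le_lt_trans.
  apply: ge0_le_integral => //.
  - by apply: measurable_funeneg; exact/measurable_EFinP.
  - by apply: measurableT_comp => //; exact: measurable_int ilow.
  - move=> z _; rewrite funenegE ge_max abse_ge0 andbT /= lee_fin.
    have := u_ge0 z; rewrite /u subr_ge0 => lz.
    by rewrite -normrN (le_trans _ (ler_norm _))// lerN2.
have pos : (\int[nu]_z ((EFin \o l)^\+ z) = +oo)%E.
  have : (\int[nu]_z `|(EFin \o l) z| = \int[nu]_z ((EFin \o l)^\+ z) + \int[nu]_z ((EFin \o l)^\- z))%E.
    rewrite -ge0_integralD//.
    - by apply: eq_integral => z _; rewrite -[RHS]/(((EFin \o l)^\+ \+ (EFin \o l)^\-)%E z) -fune_abse.
    - by apply: measurable_funepos; exact/measurable_EFinP.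
    - by apply: measurable_funeneg; exact/measurable_EFinP.
  rewrite lint => /esym; case: (\int[nu]_z _)%E => //= s.
  move: neg; case: (\int[nu]_z _)%E => //=.
have ooB (x : \bar R) : (x < +oo)%E -> (+oo - x = +oo)%E by case: x.
by rewrite [X in (X - _)%E]pos; exact: ooB.
Qed.

Let Rint_l : nu.-integrable setT (EFin \o l) ->
  \int[nu]_z ln (h z) + \int[nu]_z u z <= \int[nu]_z l z.
Proof.
move=> il.
have hln1 : Linfty (fun z => ln (h z) + 1) by exact: LinftyD.
have -> : \int[nu]_z u z =
    \int[nu]_z l z - (\int[nu]_z ln (h z) + 1 - \int[nu]_z q z).
  transitivity (\int[nu]_z l z - \int[nu]_z (ln (h z) + 1 - q z)).
    by rewrite -RintegralB.
  by rewrite (RintegralB measurableT (Linfty_integrable nu hln1) iq) RintD// Rintegral_cstT.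
have : \int[nu]_z q z <= 1.
  by rewrite -lee_fin /Rintegral fineK//; apply: integrable_fin_num.
by lra_goal.
Qed.

Lemma KL_ge_tilt : ((\int[nu]_z ln (h z))%:E <= KL nu m)%E.
Proof.
rewrite KL_l; have [->|il] := int_l_cases; first by rewrite leey.
rewrite -(fineK (integrable_fin_num _ il))// lee_fin.
apply: le_trans (Rint_l il); rewrite lerDl.
exact: Rintegral_ge0.
Qed.

(** Equality makes the nonnegative gap [u] vanish [nu]-almost everywhere, and the strict inequality
    [ln t < t - 1] for [t != 1] then gives [r = h] there. This yields [nu <= tilt dh] on measurable
    sets, hence equality of the two probabilities. *)
Lemma KL_le_tilt : (KL nu m <= (\int[nu]_z ln (h z))%:E)%E ->
  forall A, measurable A -> nu A = tilt dh A.
Proof.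
rewrite KL_l; have [->|il] := int_l_cases; first by rewrite leye_eq.
rewrite -(fineK (integrable_fin_num _ il))// lee_fin => le1.
have iu : nu.-integrable setT (EFin \o u) by exact: (integrableB measurableT il ilow).
have u0 : \int[nu]_z u z = 0.
  apply/eqP; rewrite eq_le Rintegral_ge0// andbT.
  have {}le1 : \int[nu]_z l z <= \int[nu]_z ln (h z) by [].
  by have := Rint_l il; move: le1; lra_goal.
have uae : ae_eq nu setT (EFin \o u) (cst 0%E).
  apply/(ae_eq_integral_abs _ measurableT); first exact: measurable_int iu.
  under eq_integral do rewrite gee0_abs ?lee_fin//.
  by rewrite -(fineK (integrable_fin_num _ iu))// [fine _]u0.
have rh : {ae nu, forall z, r z = h z}.
  by apply: filterS2 r_pos uae => z rz /(_ I)[uz]; exact: u_eq0.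
have [N [mN N0 hN]] := rh.
apply: (@probability_le_eq _ _ _ nu (tilt dh)) => A mA.
have -> : nu A = nu (A `\` N).
  rewrite (measureDI nu mA mN) [X in (_ + X)%E](_ : _ = 0%E) ?adde0//.
  by apply: (subset_measure0 _ mN _ N0) => //; exact: measurableI.
rewrite nu_r; last exact: measurableD.
rewrite (eq_integral (EFin \o h)); last first.
  move=> z; rewrite inE => -[_ zN]; congr EFin; apply: contrapT => rz.
  exact/zN/hN.
rewrite -/(tilt dh (A `\` N)); apply: le_measure; rewrite ?inE//.
exact: measurableD.
Qed.

End gibbs.

Section entropic_plan.
Context d (T : measurableType d) (R : realType) (c : T * T -> R) (M : R).
Hypotheses (hc : Linfty c) (cM : forall z, `|c z| <= M).
Variables (P Q : probability T R).

Let h := xi c P Q.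
Let hf := Linfty_potential1 hc cM P Q.
Let hg := Linfty_potential2 hc cM P Q.
Let a := expR (- (6 * M)).
Let a0 : 0 < a. Proof. exact: expR_gt0. Qed.
Let ah z : a <= h z. Proof. by have /andP[] := xi_bounds hc cM P Q z. Qed.

Let dh : is_density (P \x Q)%E h.
Proof.
split=> [|z|]; [exact: Linfty_xi hc cM P Q|exact: le_trans (ltW a0) (ah z)|].
rewrite Rint_prod1; last exact: Linfty_xi hc cM P Q.
rewrite -[RHS](Rintegral_cstT P); apply: eq_Rint => x.
exact: (xi_marginal1 hc cM).
Qed.

Let pi0 : probability (T * T)%type R := tilt dh.

Lemma Rint_coupling (pi : probability (T * T)%type R) (f g : T -> R) :
  coupling P Q pi -> Linfty f -> Linfty g ->
  \int[pi]_z (f z.1 + g z.2) = \int[P]_x f x + \int[Q]_y g y.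
Proof.
move=> cpl hf' hg'; rewrite RintD; [|exact: Linfty_fst|exact: Linfty_snd].
have [mf _] := hf'; have [mg _] := hg'.
congr (_ + _); congr fine.
- transitivity (\int[pushforward pi fst]_x (f x)%:E)%E.
    rewrite integral_pushforward ?preimage_setT//; first exact/measurable_EFinP.
    have i1 : Linfty (fun z : T * T => f z.1) by exact: Linfty_fst.
    exact: (Linfty_integrable pi i1).
  apply: eq_measure_integral => A mA _; have [e _] := cpl A mA; rewrite -[RHS]e.
  by congr (pi _); apply/seteqP; split => -[x y] //= [].
- transitivity (\int[pushforward pi snd]_x (g x)%:E)%E.
    rewrite integral_pushforward ?preimage_setT//; first exact/measurable_EFinP.
    have i2 : Linfty (fun z : T * T => g z.2) by exact: Linfty_snd.
    exact: (Linfty_integrable pi i2).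
  apply: eq_measure_integral => A mA _; have [_ e] := cpl A mA; rewrite -[RHS]e.
  by congr (pi _); apply/seteqP; split => -[x y] //= [].
Qed.

Let coupling_pi0 : coupling P Q pi0.
Proof.
move=> A mA.
have e (B : set (T * T)) : measurable B ->
    pi0 B = (\int[(P \x Q)%E]_z (\1_B z * h z))%:E.
  move=> mB; have hB : Linfty (\1_B : T * T -> R).
    split=> //; exists 1 => z; rewrite indicE; case: (z \in B) => //=.
      by rewrite normr1.
    by rewrite normr0.
  rewrite -(Rint_tilt dh)// /Rintegral integral_indic// setIT fineK//.
  by rewrite fin_num_measure.
have ind (B : set T) : measurable B -> Linfty (\1_B : T -> R).
  move=> mB; split=> //; exists 1 => z; rewrite indicE; case: (z \in B) => //=.
    by rewrite normr1.
  by rewrite normr0.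
have hh : Linfty h by case: dh.
have fB (p : probability T R) (B : set T) : measurable B -> p B = (\int[p]_x \1_B x)%:E.
  by move=> mB; rewrite /Rintegral integral_indic// setIT fineK// fin_num_measure.
split; rewrite e ?fB//; try exact: measurableX.
- rewrite (@eq_Rint _ _ _ _ _ (fun z => \1_A z.1 * h z)); last first.
    by move=> -[x y]; rewrite !indicE in_setX in_setT andbT.
  rewrite Rint_prod1; last by apply: LinftyM => //; apply: Linfty_fst; exact: ind.
  congr EFin; apply: eq_Rint => x /=; rewrite RintZl; last exact: Linfty_section1.
  by rewrite (xi_marginal1 hc cM) mulr1.
- rewrite (@eq_Rint _ _ _ _ _ (fun z => \1_A z.2 * h z)); last first.
    by move=> -[x y]; rewrite !indicE in_setX in_setT.
  rewrite Rint_prod2; last by apply: LinftyM => //; apply: Linfty_snd; exact: ind.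
  congr EFin; apply: eq_Rint => y /=; rewrite RintZl; last exact: Linfty_section2.
  by rewrite (xi_marginal2 hc cM) mulr1.
Qed.

Let value := \int[P]_x (potentials c P Q).1 x + \int[Q]_y (potentials c P Q).2 y.

Let hln : Linfty (fun z => ln (h z)).
Proof. by apply: Linfty_ln a0 ah _; case: dh. Qed.

(** Since [ln xi + c] is the sum of the two potentials, its integral depends on the marginals only.
    Minimizing the entropic cost over couplings therefore amounts to minimizing [KL] minus the
    integral of [ln xi], the quantity treated by the Gibbs principle. *)
Let cost_ln (pi : probability (T * T)%type R) : coupling P Q pi ->
  \int[pi]_z c z + \int[pi]_z ln (h z) = value.
Proof.
move=> cpl; rewrite -RintD// /value -(Rint_coupling cpl hf hg); apply: eq_Rint => z.
by rewrite /h /xi /C -expRD expRK; ring.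
Qed.

Let cost_ge pi : coupling P Q pi -> (value%:E <= entropic_cost c P Q pi)%E.
Proof.
move=> cpl; rewrite -(cost_ln cpl) EFinD /entropic_cost.
rewrite [(\int[pi]_z (c z)%:E)%E](_ : _ = (\int[pi]_z c z)%:E); last first.
  by rewrite /Rintegral fineK//; apply: integrable_fin_num => //; exact: Linfty_integrable.
rewrite leeD2lE//.
have [dom|ndom] := pselect (pi `<< (P \x Q)%E); first exact: (KL_ge_tilt dh a0 ah dom).
by rewrite /KL ifF ?leey//; apply/asboolP.
Qed.

Let cost_le pi : coupling P Q pi -> (entropic_cost c P Q pi <= value%:E)%E ->
  forall A, measurable A -> pi A = pi0 A.
Proof.
move=> cpl; rewrite -(cost_ln cpl) EFinD /entropic_cost.
rewrite [(\int[pi]_z (c z)%:E)%E](_ : _ = (\int[pi]_z c z)%:E); last first.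
  by rewrite /Rintegral fineK//; apply: integrable_fin_num => //; exact: Linfty_integrable.
rewrite leeD2lE//.
have [dom|ndom] := pselect (pi `<< (P \x Q)%E); first exact: (KL_le_tilt dh a0 ah dom).
by rewrite /KL ifF ?leye_eq//; apply/asboolP.
Qed.

Let KL_pi0 : KL pi0 (P \x Q)%E = (\int[pi0]_z ln (h z))%:E.
Proof.
have dom := tilt_dominates dh; have [mh _] : Linfty h by case: dh.
rewrite /KL ifT; last exact/asboolP.
rewrite /Rintegral fineK; last first.
  by apply: integrable_fin_num => //; exact: Linfty_integrable.
apply: ae_eq_integral => //.
- apply: measurable_lne => [z|]; first exact: Radon_Nikodym_fin_num.
  by apply: measurable_int; exact: Radon_Nikodym_integrable.
- by apply/measurable_EFinP; case: hln.
- have [N [mN N0 hN]] := tilt_RN dh.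
  have tN : pi0 N = 0%E by move/null_content_dominatesP : dom; exact.
  exists N; split => // z /= hz; apply: hN => /= /(_ I) RNz; apply: hz => _.
  transitivity (lne (h z)%:E); first by congr lne.
  by rewrite lne_EFin// (lt_le_trans a0).
Qed.

Let cost_pi0 : entropic_cost c P Q pi0 = value%:E.
Proof.
rewrite -(cost_ln coupling_pi0) EFinD /entropic_cost KL_pi0; congr (_ + _)%E.
by rewrite /Rintegral fineK//; apply: integrable_fin_num => //; exact: Linfty_integrable.
Qed.

(** The plan is known only as a minimizer selected by [xget]; here it is identified with the tilted
    product measure, after which only [xi] is handled. *)
Lemma Rint_entropic_plan (f : T * T -> R) : Linfty f ->
  \int[entropic_plan c P Q]_z f z = \int[P]_x \int[Q]_y (f (x, y) * xi c P Q (x, y)).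
Proof.
move=> hf'.
have [cpl opt] : is_entropic_plan c P Q (entropic_plan c P Q).
  apply: (@xgetPex _ ((P \x Q)%E : probability (T * T)%type R)); exists pi0; split => //.
  by move=> pi' cpl'; rewrite cost_pi0; exact: cost_ge.
have eqpi : forall A, measurable A -> entropic_plan c P Q A = pi0 A.
  by apply: cost_le => //; rewrite -cost_pi0; exact: opt.
transitivity (\int[pi0]_z f z).
  by congr fine; apply: eq_measure_integral => A mA _; exact: eqpi.
rewrite Rint_tilt// Rint_prod1//; apply: LinftyM => //.
by case: dh.
Qed.

End entropic_plan.
#[local] Opaque Rintegral.


(** * Neumann series of Markov kernels *)

#[local] Transparent Rintegral.

Lemma cvg_expr0 (R : realType) (k : R) : 0 <= k < 1 -> k ^+ n @[n --> \oo] --> (0 : R).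
Proof. by move=> /andP[k0 k1]; apply: cvg_expr; rewrite ger0_norm. Qed.

Lemma le_geometric0 (R : realType) (a k G : R) : 0 <= k < 1 ->
  (forall n, a <= k ^+ n * G) -> a <= 0.
Proof.
move=> k01 h; have /cvgn_epsP kc : k ^+ n * G @[n --> \oo] --> (0 : R).
  by rewrite -(mul0r G); apply: cvgMl; exact: cvg_expr0.
apply/ler_addgt0Pr => e /kc[N /(_ _ (leqnn N))]; rewrite subr0 add0r => hN.
by rewrite (le_trans (h N))// (le_trans _ hN)// ler_norm.
Qed.

Definition kernel_op d1 d2 (T1 : measurableType d1) (T2 : measurableType d2)
    (R : realType) (k : T1 * T2 -> R) (Q : probability T2 R) (g : T2 -> R) (x : T1) : R :=
  \int[Q]_y (k (x, y) * g y).

Section kernel_op.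
Context d1 d2 (T1 : measurableType d1) (T2 : measurableType d2) (R : realType).
Variables (k : T1 * T2 -> R) (P : probability T1 R) (Q : probability T2 R) (dl : R).
Hypotheses (hk : Linfty k) (dl0 : 0 < dl) (kdl : forall z, dl <= k z).
Hypotheses (k1 : forall x, \int[Q]_y k (x, y) = 1) (k2 : forall y, \int[P]_x k (x, y) = 1).
Implicit Types g : T2 -> R.

Let hks x : Linfty (fun y => k (x, y)). Proof. exact: Linfty_section1. Qed.

Let hkg x g : Linfty g -> Linfty (fun y => k (x, y) * g y).
Proof. by move=> hg; exact: LinftyM. Qed.

Lemma Linfty_kernel_op g : Linfty g -> Linfty (kernel_op k Q g).
Proof.
by move=> hg; apply: (@Linfty_int2 _ _ _ _ _ Q (fun z => k z * g z.2)); linf.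
Qed.

Lemma kernel_opB g g' x : Linfty g -> Linfty g' ->
  kernel_op k Q (fun y => g y - g' y) x = kernel_op k Q g x - kernel_op k Q g' x.
Proof.
move=> hg hg'; rewrite /kernel_op -RintB; [|exact: hkg..].
by apply: eq_Rint => y; rewrite mulrBr.
Qed.

Let weighted_le (w g : T2 -> R) (G : R) : Linfty w -> Linfty g ->
  (forall y, 0 <= w y) -> (forall y, `|g y| <= G) ->
  `|\int[Q]_y (w y * g y)| <= \int[Q]_y w y * G.
Proof.
move=> hw hg w0 gG; rewrite -RintZr//; have hwg := LinftyM hw hg.
rewrite (le_trans (le_norm_Rint _ hwg))//; apply: le_Rint.
- exact: Linfty_norm.
- exact: LinftyM.
- by move=> y; rewrite normrM ger0_norm// ler_wpM2l.
Qed.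

Lemma kernel_op_norm_le g (G : R) x : Linfty g -> (forall y, `|g y| <= G) ->
  `|kernel_op k Q g x| <= G.
Proof.
move=> hg gG; rewrite -[leRHS]mul1r -(k1 x); apply: weighted_le => // y.
by rewrite ltW// (lt_le_trans dl0).
Qed.

(** Doeblin's argument: subtracting the constant [dl] from the kernel does not affect its action on
    mean-zero functions and leaves a nonnegative kernel of mass [1 - dl]. *)
Lemma kernel_op_contraction g (G : R) x : Linfty g -> \int[Q]_y g y = 0 ->
  (forall y, `|g y| <= G) -> `|kernel_op k Q g x| <= (1 - dl) * G.
Proof.
move=> hg g0 gG; have hd := Linfty_cst T2 dl.
have -> : kernel_op k Q g x = \int[Q]_y ((k (x, y) - dl) * g y).
  rewrite (@eq_Rint _ _ _ _ (fun y => (k (x, y) - dl) * g y)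
    (fun y => k (x, y) * g y - dl * g y)); last by move=> y; rewrite mulrBl.
  by rewrite RintB ?RintZl ?g0 ?mulr0 ?subr0//; [exact: hkg|exact: LinftyM].
have -> : 1 - dl = \int[Q]_y (k (x, y) - dl) by rewrite RintB// k1 Rintegral_cstT.
by apply: weighted_le => // [|y]; [exact: LinftyB|rewrite subr_ge0].
Qed.

Lemma kernel_op_mean g : Linfty g -> \int[P]_x kernel_op k Q g x = \int[Q]_y g y.
Proof.
move=> hg; have h : Linfty (fun z : T1 * T2 => k z * g z.2) by linf.
rewrite /kernel_op (Rint_swap P Q h); apply: eq_Rint => y /=.
by rewrite RintZr ?k2 ?mul1r//; exact: Linfty_section2.
Qed.

Lemma dl_le1 : dl <= 1.
Proof. by rewrite -(k1 point); apply: Rint_ge_cst. Qed.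

End kernel_op.

(** * Variances of bounded functions *)

Section variance_Linfty.
Context d1 (T1 : measurableType d1) (R : realType) (P : probability T1 R).

Lemma Linfty_Lfun2 (f : T1 -> R) : Linfty f -> f \in Lfun P 2%:E.
Proof.
move=> hf; have [mf [G fG]] := hf.
have G0 : 0 <= G by exact: le_trans (fG point).
rewrite inE; apply/andP; split; rewrite inE//=.
rewrite /finite_norm unlock poweR_lty//.
have -> : (\int[P]_x (`|(EFin \o f) x| `^ 2) = \int[P]_x ((f x) ^+ 2)%:E)%E.
  by apply: eq_integral => x _; rewrite -[`|(EFin \o f) x|%E]/(`|f x|%:E) poweR_EFin powR_mulrn// real_normK// num_real.
apply: integrable_lty => //.
exact: (Linfty_integrable P (Linfty_sqr hf)).
Qed.

Lemma Lnorm2E (f : T1 -> R) : Linfty f ->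
  'N[P]_2%:E [EFin \o f]%E = (Num.sqrt (\int[P]_x (f x ^+ 2)))%:E.
Proof.
move=> hf; rewrite unlock.
have -> : (\int[P]_x (`|(EFin \o f) x| `^ 2) = (\int[P]_x ((f x) ^+ 2))%:E)%E.
  transitivity (\int[P]_x ((f x) ^+ 2)%:E)%E.
    by apply: eq_integral => x _; rewrite -[`|(EFin \o f) x|%E]/(`|f x|%:E) poweR_EFin powR_mulrn// real_normK// num_real.
  rewrite /Rintegral fineK//; apply: integrable_fin_num => //.
  exact: (Linfty_integrable P (Linfty_sqr hf)).
rewrite poweR_EFin powR12_sqrt//.
by apply: Rintegral_ge0 => x _; exact: sqr_ge0.
Qed.

Lemma VarE (f : T1 -> R) : Linfty f ->
  Var P f = \int[P]_x (f x ^+ 2) - (\int[P]_x f x) ^+ 2.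
Proof.
move=> hf; rewrite /Var varianceE; last exact: Linfty_Lfun2.
have i1 := integrable_fin_num measurableT (Linfty_integrable P hf).
have i2 := integrable_fin_num measurableT (Linfty_integrable P (Linfty_sqr hf)).
rewrite unlock -(fineK i1) -EFin_expe.
rewrite [X in (X - _)%E](_ : _ = (\int[P]_x (f x ^+ 2))%:E) -?EFinB//.
by rewrite /Rintegral fineK//; exact: i2.
Qed.

Lemma Var_ae (h f : T1 -> R) : measurable_fun setT h -> Linfty f ->
  {ae P, forall x, h x = f x} -> Var P h = Var P f.
Proof.
move=> mh hf hfE; have [mf _] := hf; rewrite /Var /variance !covariance.unlock.
have e1 : 'E_P[h]%E = 'E_P[f]%E.
  rewrite !expectation.unlock; apply: ae_eq_integral => //; try exact/measurable_EFinP.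
  by apply: filterS hfE => x ->.
rewrite e1 !expectation.unlock; congr fine; apply: ae_eq_integral => //.
- by apply/measurable_EFinP; apply: measurable_funM; exact: measurable_funB.
- by apply/measurable_EFinP; apply: measurable_funM; exact: measurable_funB.
- by apply: filterS hfE => x hx _ /=; rewrite /GRing.mul/= hx.
Qed.

(** The second moments and the squared means each differ by at most [2 * B] times the L2 distance;
    squaring the sum of the two gives the factor [(4 * B) ^+ 2]. *)
Lemma Var_dist_le (f g : T1 -> R) (B : R) : Linfty f -> Linfty g ->
  (forall x, `|f x| <= B) -> (forall x, `|g x| <= B) ->
  `|Var P f - Var P g| ^+ 2 <= (4 * B) ^+ 2 * \int[P]_x ((f x - g x) ^+ 2).
Proof.
move=> hf hg fB gB; rewrite !VarE//; set I := \int[P]_x ((f x - g x) ^+ 2).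
have B0 : 0 <= B by exact: le_trans (fB point).
have hf2 := Linfty_sqr hf; have hg2 := Linfty_sqr hg; have hfg := LinftyB hf hg.
have h1 : `|\int[P]_x f x - \int[P]_x g x| ^+ 2 <= I.
  by rewrite -RintB// real_normK ?num_real//; exact: sqr_Rint_le.
have h2 : `|\int[P]_x (f x ^+ 2) - \int[P]_x (g x ^+ 2)| ^+ 2 <= (2 * B) ^+ 2 * I.
  rewrite -RintB// real_normK ?num_real//.
  apply: le_trans (sqr_Rint_le P (LinftyB hf2 hg2)) _.
  have hI := Linfty_sqr hfg; have hc := Linfty_cst T1 ((2 * B) ^+ 2).
  rewrite /I -RintZl//; apply: le_Rint; [by apply: Linfty_sqr; exact: LinftyB|exact: LinftyM|].
  move=> x; rewrite subr_sqr exprMn mulrC ler_wpM2r ?sqr_ge0//.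
  rewrite -[leLHS]real_normK ?num_real// lerXn2r ?nnegrE ?mulr_ge0//.
  by rewrite (le_trans (ler_normD _ _))// (le_trans (lerD (fB x) (gB x)))// mulr2n mulrDl !mul1r.
have I0 : 0 <= I by apply: Rintegral_ge0 => x _; exact: sqr_ge0.
have mf : `|\int[P]_x f x| <= B by exact: Rint_norm_le.
have mg : `|\int[P]_x g x| <= B by exact: Rint_norm_le.
move: h1 h2 mf mg I0; generalize I; clear I.
generalize (\int[P]_x (f x ^+ 2)) (\int[P]_x (g x ^+ 2)) (\int[P]_x f x) (\int[P]_x g x).
move=> a b u v I h1 h2 mu mv I0.
have h3 : `|u ^+ 2 - v ^+ 2| ^+ 2 <= (2 * B) ^+ 2 * I.
  rewrite subr_sqr normrM exprMn mulrC ler_pM// ?sqr_ge0//.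
  rewrite lerXn2r ?nnegrE ?mulr_ge0// (le_trans (ler_normD _ _))//.
  by rewrite (le_trans (lerD mu mv))// mulr2n mulrDl !mul1r.
have h4 : `|a - u ^+ 2 - (b - v ^+ 2)| <= `|a - b| + `|u ^+ 2 - v ^+ 2|.
  rewrite (_ : a - u ^+ 2 - (b - v ^+ 2) = (a - b) - (u ^+ 2 - v ^+ 2)); last by ring.
  exact: ler_normB.
have h5 : `|a - u ^+ 2 - (b - v ^+ 2)| ^+ 2 <= (`|a - b| + `|u ^+ 2 - v ^+ 2|) ^+ 2.
  by rewrite lerXn2r ?nnegrE// addr_ge0.
apply: le_trans h5 _; move: h2 h3; generalize (`|a - b|) (`|u ^+ 2 - v ^+ 2|) => p q h2 h3.
have : 0 <= (p - q) ^+ 2 by exact: sqr_ge0.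
by move: h2 h3; clear; nra.
Qed.

End variance_Linfty.

Section neumann.
Context d1 d2 (T1 : measurableType d1) (T2 : measurableType d2) (R : realType).
Variables (k : T1 * T2 -> R) (P : probability T1 R) (Q : probability T2 R) (dl : R).
Hypotheses (hk : Linfty k) (dl0 : 0 < dl) (kdl : forall z, dl <= k z).
Hypotheses (k1 : forall x, \int[Q]_y k (x, y) = 1) (k2 : forall y, \int[P]_x k (x, y) = 1).

Let kt (z : T2 * T1) := k (z.2, z.1).
Let hkt : Linfty kt. Proof. exact: Linfty_swap. Qed.

Let K (g : T1 -> R) : T1 -> R := kernel_op k Q (kernel_op kt P g).

Let r := 1 - dl.
Let r01 : 0 <= r < 1.
Proof. by rewrite /r subr_ge0 (dl_le1 hk kdl k1)/= gtrBl. Qed.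

Let LinftyK g : Linfty g -> Linfty (K g).
Proof. by move=> hg; do 2 apply: Linfty_kernel_op => //. Qed.

Let KB g g' x : Linfty g -> Linfty g' -> K (fun x => g x - g' x) x = K g x - K g' x.
Proof.
move=> hg hg'; rewrite /K -kernel_opB//; [|exact: Linfty_kernel_op..].
by congr (kernel_op k Q _ x); apply/funext => y; rewrite kernel_opB.
Qed.

Let K_mean g : Linfty g -> \int[P]_x K g x = \int[P]_x g x.
Proof.
move=> hg; rewrite /K (kernel_op_mean Q hk k2); last exact: Linfty_kernel_op.
exact: (kernel_op_mean P hkt k1).
Qed.

(** The inner operator contracts; the outer one is merely used as nonexpansive, so the rate is
    [1 - dl] and not its square. *)
Let K_contraction g G : Linfty g -> \int[P]_x g x = 0 -> (forall x, `|g x| <= G) ->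
  forall x, `|K g x| <= r * G.
Proof.
move=> hg g0 gG x; apply: (kernel_op_norm_le hk dl0 kdl k1) => [|y].
  exact: Linfty_kernel_op.
by apply: (kernel_op_contraction hkt) => // z; exact: kdl.
Qed.

Let K_norm_le g G : Linfty g -> (forall x, `|g x| <= G) -> forall x, `|K g x| <= G.
Proof.
move=> hg gG x; apply: (kernel_op_norm_le hk dl0 kdl k1) => [|y].
  exact: Linfty_kernel_op.
by apply: (kernel_op_norm_le hkt dl0) => // z; exact: kdl.
Qed.

Let K_fix0 g : Linfty g -> \int[P]_x g x = 0 -> (forall x, K g x = g x) ->
  forall x, g x = 0.
Proof.
move=> hg g0 gK; have [_ [G gG]] := hg.
have h n : forall x, `|g x| <= r ^+ n * G.
  elim: n => [|n ih] x; first by rewrite expr0 mul1r.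
  by rewrite -gK exprS -mulrA; exact: K_contraction.
move=> x; apply/eqP; rewrite -normr_le0.
exact: (le_geometric0 (G := G) r01).
Qed.

(** Constants are fixed by [K], so the recentred function is a mean-zero fixed point, which the
    contraction forces to vanish. *)
Lemma fixed_point_const g : Linfty g -> (forall x, K g x = g x) ->
  forall x, g x = \int[P]_z g z.
Proof.
move=> hg gK x; set t := \int[P]_z g z.
have ht := Linfty_cst T1 t.
have Kt y : K (fun=> t) y = t.
  rewrite /K /kernel_op (@eq_Rint _ _ _ _ _ (fun y' => k (y, y') * t)); last first.
    move=> y'; congr (_ * _); rewrite RintZr; last exact: (Linfty_section1 y' hkt).
    by rewrite [X in X * _](k2 y') mul1r.
  by rewrite RintZr ?k1 ?mul1r//; exact: Linfty_section1.
apply/eqP; rewrite -subr_eq0; apply/eqP; move: x.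
apply: (@K_fix0 (fun x => g x - t)); first exact: LinftyB.
  by rewrite RintB// Rintegral_cstT subrr.
by move=> x; rewrite KB// gK Kt.
Qed.

Lemma Linfty_iter_op u n : Linfty u -> Linfty (iter n K u).
Proof. by move=> hu; elim: n => [|n ih] //=; exact: LinftyK. Qed.

Lemma mean_iter_op u n : Linfty u -> \int[P]_x u x = 0 -> \int[P]_x iter n K u x = 0.
Proof.
by move=> hu u0; elim: n => [|n ih] //=; rewrite K_mean//; exact: Linfty_iter_op.
Qed.

Variables (u : T1 -> R) (B : R).
Hypotheses (hu : Linfty u) (u0 : \int[P]_x u x = 0) (uB : forall x, `|u x| <= B).

Let S n x := \sum_(i < n) iter i K u x.

Lemma iter_op_norm_le n x : `|iter n K u x| <= B * r ^+ n.
Proof.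
elim: n x => [|n ih] x; first by rewrite expr0 mulr1.
rewrite iterS exprS mulrCA; apply: K_contraction => //.
  exact: Linfty_iter_op.
exact: mean_iter_op.
Qed.

Let hS n : Linfty (S n).
Proof. by apply: Linfty_sum => i; exact: Linfty_iter_op. Qed.

Let B0 : 0 <= B. Proof. exact: le_trans (uB point). Qed.

Let SS n x : S n.+1 x = S n x + iter n K u x.
Proof. by rewrite /S big_ord_recr. Qed.

Let KS n x : K (S n) x = S n.+1 x - u x.
Proof.
elim: n x => [|n ih] x.
  rewrite SS /S big_ord0 add0r subrr; apply/eqP; rewrite -normr_le0.
  apply: K_norm_le => [|z]; first exact: hS 0%N.
  by rewrite big_ord0 normr0.
have eS : S n.+1 = (fun x => S n x - (- iter n K u x)).
  by apply/funext => z; rewrite SS opprK.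
rewrite {1}eS.
have hi := Linfty_iter_op n hu.
rewrite KB//; last exact: LinftyN.
have -> : K (fun x => - iter n K u x) x = - K (iter n K u) x.
  have := @KB (fun=> 0) (iter n K u) x (Linfty_cst _ _) hi.
  have -> : K (fun=> 0) x = 0.
    by apply/eqP; rewrite -normr_le0; apply: K_norm_le => // z; rewrite normr0.
  rewrite sub0r => <-; rewrite (_ : (fun x => - iter n K u x) = (fun x => 0 - iter n K u x))//.
  by apply/funext => z; rewrite sub0r.
by rewrite ih opprK [S n.+2 x]SS iterS addrAC.
Qed.

(** The partial sums converge uniformly, so [phi] is bounded and solves [phi - K phi = u] at every
    point. It is the reference with which the classes behind [resolvent] and [L20_series] are
    compared. *)
Lemma neumann_limit : exists phi, [/\ Linfty phi, \int[P]_x phi x = 0,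
  forall n x, `|S n x - phi x| <= B * r ^+ n / (1 - r) &
  forall x, phi x - K phi x = u x].
Proof.
have r1 : 0 < 1 - r by case/andP: r01 => _; rewrite subr_gt0.
have step n x : `|S n.+1 x - S n x| <= B * r ^+ n.
  by rewrite SS addrC addKr; exact: iter_op_norm_le.
pose phi x := sval (cid2 (geometric_cvg B0 r01 (fun n => step n x))).
have Sphi x : S n x @[n --> \oo] --> phi x by rewrite /phi; case: cid2.
have Sb n x : `|S n x - phi x| <= B * r ^+ n / (1 - r) by rewrite /phi; case: cid2.
have S0 x : S 0%N x = 0 by rewrite /S big_ord0.
have [r0 _] := andP r01.
have Bn n : B * r ^+ n / (1 - r) <= B / (1 - r).
  rewrite ler_wpM2r ?invr_ge0 ?(ltW r1)// ler_piMr// exprn_ile1//.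
  by case/andP: r01 => _ /ltW.
have hphi : Linfty phi.
  apply: (Linfty_lim (u := S) (M := B / (1 - r) + B / (1 - r))) => // [n|n x].
    by case: (hS n).
  rewrite -[S n x](subrK (phi x)) (le_trans (ler_normD _ _))// lerD//.
    exact: le_trans (Sb n x) (Bn n).
  by have := le_trans (Sb 0%N x) (Bn 0%N); rewrite S0 sub0r normrN.
have lim0 (a : R) : (forall n, `|a| <= 2 * (B * r ^+ n / (1 - r))) -> a = 0.
  move=> h; apply/eqP; rewrite -normr_le0.
  apply: (le_geometric0 (G := 2 * B / (1 - r)) r01) => n.
  by apply: le_trans (h n) _; rewrite le_eqVlt; apply/orP; left; apply/eqP; ring.
have pos n : 0 <= B * r ^+ n / (1 - r) by rewrite !mulr_ge0 ?exprn_ge0 ?invr_ge0// ltW.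
exists phi; split => //.
- apply: lim0 => n; rewrite -[X in `|X|]subr0.
  have Sm : \int[P]_x S n x = 0.
    rewrite Rint_sum; last by move=> i; exact: Linfty_iter_op.
    by rewrite big1// => i _; exact: mean_iter_op.
  rewrite -Sm distrC -RintB//.
  apply: (@le_trans _ _ (B * r ^+ n / (1 - r))).
    by apply: Rint_norm_le => //; exact: LinftyB.
  by have := pos n; lra_goal.
- move=> x; apply/eqP; rewrite -subr_eq0; apply/eqP; apply: lim0 => n.
  have h1 : `|K (S n) x - K phi x| <= B * r ^+ n / (1 - r).
    by rewrite -KB//; apply: K_norm_le => //; exact: LinftyB.
  have h2 := Sb n.+1 x; rewrite KS in h1.
  have h3 : B * r ^+ n.+1 / (1 - r) <= B * r ^+ n / (1 - r).
    rewrite ler_wpM2r ?invr_ge0 ?(ltW r1)// ler_wpM2l// exprS ler_piMl ?exprn_ge0//.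
    by case/andP: r01 => _ /ltW.
  rewrite (_ : _ - u x = (S n.+1 x - u x - K phi x) - (S n.+1 x - phi x)); last first.
    by generalize (S n.+1 x) (K phi x) => a b; ring.
  rewrite (le_trans (ler_normB _ _))// (le_trans (lerD h1 h2))//.
  by move: h3; lra_goal.
Qed.

Let Lfun2_int (h : T1 -> R) : h \in Lfun P 2%:E -> P.-integrable setT (EFin \o h).
Proof.
by move=> h2; apply/Lfun1_integrable; apply: Lfun_subset12 => //; rewrite fin_num_measure.
Qed.

(** A representative chosen in [L20] need not be bounded, but one application of a bounded kernel
    makes it bounded. *)
Let kernel_op_L1 (h : T1 -> R) : measurable_fun setT h -> P.-integrable setT (EFin \o h) ->
  Linfty (kernel_op kt P h).
Proof.
move=> mh ih; have [mk [G kG]] := hk.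
have G0 : 0 <= G by exact: le_trans (kG (point, point)).
have mkh : measurable_fun setT (fun z : T1 * T2 => k z * h z.1).
  by apply: measurable_funM => //; exact: measurableT_comp.
have ikh y : P.-integrable setT (fun x => (k (x, y) * h x)%:E).
  have mky : measurable_fun setT (fun x => k (x, y)).
    by have [] := Linfty_section2 y hk.
  apply: (@le_integrable _ _ _ P setT _ _ (fun x => G%:E * (EFin \o h) x)%E) => //.
  - by apply/measurable_EFinP; exact: measurable_funM.
  - move=> x _; rewrite /= lee_fin !normrM ler_wpM2r// (le_trans (kG _))//.
    exact: ler_norm.
  - exact: integrableZl.
split.
  apply: (measurableT_comp (f := @fine R)) => //.
  apply: (measurable_fubini_G (m1 := P) (m2 := Q) (f := EFin \o (fun z => k z * h z.1))).
  apply/integrable21ltyP; first exact/measurable_EFinP.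
  apply: (@le_lt_trans _ _ (\int[Q]_y (\int[P]_x (G%:E * `|(h x)%:E|))))%E; last first.
    rewrite integral_cst// [X in (_ * X)%E](_ : _ = 1%E) ?mule1; last exact: probability_setT.
    have /integrableP[_] : P.-integrable setT (fun x => G%:E * (EFin \o h) x)%E.
      exact: integrableZl.
    congr (_ < _)%E; apply: eq_integral => x _ /=.
    by rewrite normrM (ger0_norm G0).
  apply: ge0_le_integral => //.
  - by move=> y _; exact: integral_ge0.
  - apply: (measurable_fun_fubini_tonelli_G (fun z : T1 * T2 => `|(k z * h z.1)%:E|%E)) => //.
    by apply: measurableT_comp => //; exact/measurable_EFinP.
  - move=> y _; apply: ge0_le_integral => //.
    + by apply: measurableT_comp => //; exact: measurable_int (ikh y).
    + by apply/measurable_EFinP; apply: measurable_funM => //; exact: measurableT_comp.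
    + by move=> x _ /=; rewrite lee_fin normrM ler_wpM2r.
exists (G * \int[P]_x `|h x|) => y; rewrite /kernel_op /kt/=.
rewrite (le_trans (le_normr_Rintegral measurableT (ikh y)))//.
have ihn : P.-integrable setT (EFin \o (fun x => `|h x|)).
  exact: (integrable_abse ih).
rewrite -RintegralZl//; apply: le_Rintegral => //.
- exact: (integrable_abse (ikh y)).
- exact: (integrableZl measurableT G ihn).
- by move=> x _; rewrite normrM ler_wpM2r.
Qed.

(** The chosen [h] equals almost everywhere the bounded function [h' = u + K h], and [K h' = K h] at
    every point. So [h' - phi] is a bounded mean-zero fixed point of [K], hence zero. *)
Lemma resolvent_ae (phi : T1 -> R) : Linfty phi -> \int[P]_x phi x = 0 ->
  (forall x, phi x - K phi x = u x) ->
  exists2 h, resolvent P K u = h & L20 P h /\ {ae P, forall x, h x = phi x}.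
Proof.
move=> hphi phi0 phiE; exists (resolvent P K u) => //.
have [[h2 hm] hae] : [set h | L20 P h /\ {ae P, forall x, h x - K h x = u x}] (resolvent P K u).
  apply: xgetPex; exists phi; split; first by split => //; exact: Linfty_Lfun2.
  exact: aeW.
split => //; set h := resolvent P K u in h2 hm hae *.
have mh : measurable_fun setT h by have := sub_Lfun_mfun h2; rewrite inE.
have ih := Lfun2_int h2.
have hw := kernel_op_L1 mh ih.
have hKh : Linfty (K h) by exact: Linfty_kernel_op.
pose h' x := u x + K h x.
have hh' : Linfty h' by exact: LinftyD.
have hh'E : {ae P, forall x, h x = h' x}.
  by apply: filterS hae => x; rewrite /h' => <-; rewrite subrK.
have Kh' x : K h' x = K h x.
  congr (kernel_op k Q _ x); apply/funext => y; congr fine.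
  apply: ae_eq_integral => //.
  - apply/measurable_EFinP; apply: measurable_funM; last by case: hh'.
    by have [] := Linfty_section2 y hk.
  - apply/measurable_EFinP; apply: measurable_funM => //.
    by have [] := Linfty_section2 y hk.
  - by apply: filterS hh'E => z -> _.
have h'0 : \int[P]_x h' x = 0.
  rewrite -[RHS]hm; congr fine; apply: ae_eq_integral => //.
  - by apply/measurable_EFinP; case: hh'.
  - exact/measurable_EFinP.
  - by apply: filterS hh'E => z -> _.
have h'phi x : h' x - phi x = 0.
  move: x; apply: K_fix0; [exact: LinftyB|by rewrite RintB// h'0 phi0 subrr|move=> x].
  rewrite KB// Kh' /h' -phiE; generalize (K h x) (K phi x) (phi x) => a b e; ring.
by apply: filterS hh'E => x ->; apply/eqP; rewrite -subr_eq0 h'phi.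
Qed.

(** Uniform convergence makes [phi] an L2 sum of the series, and by Minkowski's inequality two L2
    sums are at distance zero. *)
Lemma L20_series_ae (phi : T1 -> R) : Linfty phi -> \int[P]_x phi x = 0 ->
  (forall n x, `|S n x - phi x| <= B * r ^+ n / (1 - r)) ->
  exists2 h, L20_series P (fun n => iter n K u) = h & L20 P h /\ {ae P, forall x, h x = phi x}.
Proof.
move=> hphi phi0 Sphi; exists (L20_series P (fun n => iter n K u)) => //.
have Sphi0 : ('N[P]_2%:E [EFin \o (fun x => \sum_(i < n) iter i K u x - phi x)%R])%E
      @[n --> \oo] --> 0%E.
  have hD n : Linfty (fun x => S n x - phi x) by exact: LinftyB.
  under eq_fun do rewrite (Lnorm2E P (hD _)).
  apply: cvg_EFin; first exact: nearW.
  apply: (@cvgn_squeeze0 _ _ (fun n => B * r ^+ n / (1 - r))) => [n|] /=.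
    have pos : 0 <= B * r ^+ n / (1 - r) by exact: le_trans (Sphi n point).
    rewrite ger0_norm ?sqrtr_ge0// -[leRHS]ger0_norm// -sqrtr_sqr.
    rewrite ler_sqrt ?sqr_ge0//; apply: Rint_le_cst; first exact: Linfty_sqr.
    by move=> x; rewrite -real_normK ?num_real// lerXn2r ?nnegrE.
  rewrite (_ : (fun n => _) = fun n => B / (1 - r) * r ^+ n); last first.
    by apply/funext => n; rewrite mulrAC.
  by rewrite -(mulr0 (B / (1 - r))); apply: cvgMr; exact: cvg_expr0.
have [[h2 hm] hs] : [set s | L20 P s /\
    ('N[P]_2%:E [EFin \o (fun x => \sum_(i < n) iter i K u x - s x)%R])%E
      @[n --> \oo] --> 0%E] (L20_series P (fun n => iter n K u)).
  by apply: xgetPex; exists phi; split => //; split => //; exact: Linfty_Lfun2.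
split => //; set h := L20_series _ _ in h2 hm hs *.
have mh : measurable_fun setT h by have := sub_Lfun_mfun h2; rewrite inE.
have mphi : measurable_fun setT phi by case: hphi.
have le0 : ('N[P]_2%:E [EFin \o (fun x => (h x - phi x)%R)] <= 0)%E.
  have add0 : ((0 : \bar R) +? 0)%E by [].
  have := cvgeD add0 Sphi0 hs; rewrite adde0 => hc; apply: (cvge_to_ge (hc _)).
  apply: nearW => n.
  have mSn : measurable_fun setT (S n) by case: (hS n).
  have m1 : measurable_fun setT (fun x => S n x - phi x) by exact: measurable_funB.
  have m2 : measurable_fun setT (fun x => h x - S n x) by exact: measurable_funB.
  have := minkowski_EFin P m1 m2 (ler1n _ 2).
  rewrite (@eq_Lnorm _ _ _ P 2%:E (EFin \o _) (EFin \o (fun x => h x - phi x))); last first.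
    by move=> x /=; congr EFin; rewrite addrC addrA subrK.
  rewrite -(oppe_Lnorm P (EFin \o (fun x => h x - S n x))).
  rewrite (@eq_Lnorm _ _ _ P 2%:E (\- (EFin \o _))%E (EFin \o (fun x => S n x - h x)))//.
  by move=> x; rewrite -[RHS]/((S n x - h x)%:E) -opprB EFinN.
have Leq0 : ('N[P]_2%:E [EFin \o (fun x => (h x - phi x)%R)] = 0)%E.
  by apply/eqP; rewrite eq_le le0 Lnorm_ge0.
have mhp : measurable_fun setT (EFin \o (fun x => h x - phi x)).
  by apply/measurable_EFinP; exact: measurable_funB.
have p2 : (0 < (2 : R)%:E)%E by rewrite lte_fin.
have := Lnorm_eq0_eq0 mhp p2 Leq0; apply: filterS => x /(_ I)/= [] /eqP.
by rewrite subr_eq0 => /eqP.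
Qed.

Let L := B / (1 - r).

(** In the last bound, [phi] and the partial sums are at most [2 * L] in absolute value and differ
    by at most [L * r ^+ n], whence [4 * (2 * L) * (L * r ^+ n)] by [Var_dist_le]. *)
Lemma neumann_Var : exists phi, [/\ Linfty phi,
  forall x, phi x - K phi x = u x,
  Var P (resolvent P K u) = Var P phi,
  Var P (neumann_sum P K u None) = Var P phi &
  forall n, `|Var P (fun x => \sum_(i < n) iter i K u x) - Var P phi| <= 8 * L ^+ 2 * r ^+ n].
Proof.
have [phi [hphi phi0 Sphi phiE]] := neumann_limit; exists phi; split => //.
- have [h <- [[h2 _] hae]] := resolvent_ae hphi phi0 phiE.
  by apply: Var_ae => //; have := sub_Lfun_mfun h2; rewrite inE.
- have [h <- [[h2 _] hae]] := L20_series_ae hphi phi0 Sphi.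
  by apply: Var_ae => //; have := sub_Lfun_mfun h2; rewrite inE.
have r1 : 0 < 1 - r by case/andP: r01 => _; rewrite subr_gt0.
have L0 : 0 <= L by rewrite divr_ge0// ltW.
have [r0 _] := andP r01.
have Sphi' n x : `|S n x - phi x| <= L * r ^+ n by rewrite /L mulrAC; exact: Sphi.
have rn n : r ^+ n <= 1 by rewrite exprn_ile1//; case/andP: r01 => _ /ltW.
have phiL x : `|phi x| <= 2 * L.
  have := Sphi' 0%N x; rewrite /S big_ord0 sub0r normrN expr0 mulr1 => /le_trans; apply.
  by rewrite ler_peMl// ler1n.
have SL n x : `|S n x| <= 2 * L.
  rewrite -[S n x](subrK (phi x)) (le_trans (ler_normD _ _))// mulr2n mulrDl mul1r lerD//.
    by rewrite (le_trans (Sphi' n x))// ler_piMr.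
  by have := Sphi' 0%N x; rewrite /S big_ord0 sub0r normrN expr0 mulr1.
move=> n; have := Var_dist_le P (hS n) hphi (SL n) phiL.
have hI : \int[P]_x ((S n x - phi x) ^+ 2) <= (L * r ^+ n) ^+ 2.
  apply: Rint_le_cst; first by apply: Linfty_sqr; exact: LinftyB.
  move=> x; rewrite -real_normK ?num_real// lerXn2r ?nnegrE//.
  by rewrite mulr_ge0 ?exprn_ge0.
have pos : 0 <= 8 * L ^+ 2 * r ^+ n.
  by apply: mulr_ge0; [apply: mulr_ge0 => //; exact: sqr_ge0|exact: exprn_ge0].
move=> h; rewrite -(ler_pXn2r (ltn0Sn 1)) ?nnegrE//; apply: le_trans h _.
apply: le_trans (ler_wpM2l (sqr_ge0 _) hI) _.
by rewrite -exprMn (_ : 4 * (2 * L) * (L * r ^+ n) = 8 * L ^+ 2 * r ^+ n)//; ring.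
Qed.

End neumann.
#[local] Opaque Rintegral.


(** * Stability of the density under a change of marginals *)

Section expR_bounds.
Context (R : realType).
Implicit Types D W : R.

(** Strong monotonicity of the exponential on [[-W, W]], where its derivative is at least
    [exp (- W)]. *)
Lemma expR_sub1_ge D W : `|D| <= W -> expR (- W) * D ^+ 2 <= (expR D - 1) * D.
Proof.
rewrite ler_norml => /andP[WD DW]; have e0 : 0 < expR (- W) by exact: expR_gt0.
have [D0|D0] := leP 0 D.
  have h1 : D <= expR D - 1 by have := expR_ge1Dx D; lra.
  have h2 : expR (- W) <= 1 by rewrite -[leRHS]expR0 ler_expR; lra.
  have h3 : expR (- W) * D ^+ 2 <= D ^+ 2 by rewrite ler_piMl// sqr_ge0.
  by rewrite (le_trans h3)// expr2 ler_wpM2r.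
have h1 : - D <= expR (- D) - 1 by have := expR_ge1Dx (- D); lra.
have h2 : expR (- W) <= expR D by rewrite ler_expR.
have h3 : 1 - expR D = expR D * (expR (- D) - 1).
  by rewrite mulrBr expRxMexpNx_1 mulr1.
have h4 : expR (- W) * - D <= 1 - expR D.
  by rewrite h3 ler_pM// ?oppr_ge0 ltW.
have -> : expR (- W) * D ^+ 2 = expR (- W) * (- D) * - D by ring.
have -> : (expR D - 1) * D = (1 - expR D) * - D by ring.
by rewrite ler_wpM2r// oppr_ge0 ltW.
Qed.

Lemma expR_taylor2 D : `|expR D - 1 - D| <= D ^+ 2 * expR `|D|.
Proof.
have h1 : 0 <= expR D - 1 - D by have := expR_ge1Dx D; lra.
rewrite ger0_norm//.
have h2 : 1 - D <= expR (- D) by exact: expR_ge1Dx.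
have e0 : 0 < expR D by exact: expR_gt0.
have h3 : expR D - 1 <= D * expR D.
  by have := ler_wpM2l (ltW e0) h2; rewrite expRxMexpNx_1; lra.
have h4 : expR D - 1 - D <= D * (expR D - 1) by lra.
have [D0|D0] := leP 0 D.
  rewrite ger0_norm// expr2 -mulrA (le_trans h4)// ler_wpM2l//.
have h5 : D <= expR D - 1 by have := expR_ge1Dx D; lra.
have h6 : D * (expR D - 1) <= D ^+ 2 by rewrite expr2 ler_wnM2l// ltW.
rewrite (le_trans h4)// (le_trans h6)// ler_peMr ?sqr_ge0//.
by rewrite -[leLHS]expR0 ler_expR.
Qed.

Lemma expR_sub1_le D : `|expR D - 1| <= `|D| * expR `|D|.
Proof.
have h2 : 1 - D <= expR (- D) by exact: expR_ge1Dx.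
have e0 : 0 < expR D by exact: expR_gt0.
have h3 : expR D - 1 <= D * expR D.
  by have := ler_wpM2l (ltW e0) h2; rewrite expRxMexpNx_1; lra.
have h5 : D <= expR D - 1 by have := expR_ge1Dx D; lra.
have [D0|D0] := leP 0 D.
  by rewrite (ger0_norm D0) ger0_norm//; lra.
rewrite (ltr0_norm D0) ler0_norm; last first.
  by apply: le_trans h3 _; rewrite nmulr_rle0// ltW.
apply: (@le_trans _ _ (- D)); first by lra.
by rewrite ler_peMr ?oppr_ge0 ?ltW// -[X in X < _]expR0 ltr_expR oppr_gt0.
Qed.

Lemma expR_sub1_sqr_le x A D W : 0 <= x <= A -> `|D| <= W ->
  (x * (expR D - 1)) ^+ 2 <= (A * expR W) ^+ 2 * D ^+ 2.
Proof.
move=> /andP[x0 xA] DW; rewrite -exprMn.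
rewrite -[leLHS]real_normK ?num_real// -[leRHS]real_normK ?num_real//.
rewrite lerXn2r ?nnegrE// !normrM (ger0_norm x0) (ger0_norm (expR_ge0 W)).
rewrite (ger0_norm (le_trans x0 xA)) -mulrA ler_pM//.
by rewrite (le_trans (expR_sub1_le _))// mulrC ler_wpM2r// ler_expR.
Qed.

Lemma mulr_le_young (w a b : R) : 0 < w -> `|a * b| <= (w * a ^+ 2 + w^-1 * b ^+ 2) / 2.
Proof.
move=> w0; have w1 : w * w^-1 = 1 by rewrite divff// gt_eqF.
have iw : 0 < w^-1 by rewrite invr_gt0.
(* For [s = 1] and [s = -1] the coefficient [1 - s ^+ 2] vanishes and a nonnegative square is left;
   the two signs give the absolute value. *)
have e s : (w * a ^+ 2 + w^-1 * b ^+ 2) / 2 - s * (a * b) =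
    (w^-1 * (w * a - s * b) ^+ 2 + (1 - s ^+ 2) * (w^-1 * b ^+ 2)) / 2.
  by field; rewrite gt_eqF.
have := e 1; have := e (-1).
have h1 : 0 <= w^-1 * (w * a - 1 * b) ^+ 2 by rewrite mulr_ge0 ?sqr_ge0 ?ltW.
have h2 : 0 <= w^-1 * (w * a - (-1) * b) ^+ 2 by rewrite mulr_ge0 ?sqr_ge0 ?ltW.
rewrite ler_norml => e1 e2; apply/andP; split; lra.
Qed.

End expR_bounds.

(** For [h = xi - 1] this is the squared L2 size of the defect of the marginal condition of the
    population density when it is integrated against another measure. *)
Definition section_var d1 d2 (T1 : measurableType d1) (T2 : measurableType d2)
    (R : realType) (p : probability T1 R) (q : probability T2 R) (h : T1 * T2 -> R) : R :=
  \int[p]_x ((\int[q]_y h (x, y)) ^+ 2).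

Section section_var.
Context d1 d2 (T1 : measurableType d1) (T2 : measurableType d2) (R : realType).
Variables (p : probability T1 R) (q : probability T2 R).
Implicit Types (h : T1 * T2 -> R).

Lemma section_var_le h : Linfty h -> section_var p q h <= \int[(p \x q)%E]_z (h z ^+ 2).
Proof.
move=> hh; rewrite Rint_prod1; last exact: Linfty_sqr.
apply: le_Rint.
- by apply: Linfty_sqr; exact: Linfty_int2.
- by apply: (@Linfty_int2 _ _ _ _ _ q (fun z => h z ^+ 2)); exact: Linfty_sqr.
- by move=> x; apply: sqr_Rint_le; exact: Linfty_section1.
Qed.

(** A factor depending on [x] alone sees [h] only through its sections' integrals, which for a
    sampled [q] are far smaller than [h]. The free weight [w] is used to absorb the first term later
    on. *)
Lemma Rint_prod_fst (w : R) (a : T1 -> R) h : 0 < w -> Linfty a -> Linfty h ->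
  `|\int[(p \x q)%E]_z (a z.1 * h z)| <=
  (w * \int[p]_x (a x ^+ 2) + w^-1 * section_var p q h) / 2.
Proof.
move=> w0 ha hh; have hah : Linfty (fun z : T1 * T2 => a z.1 * h z) by linf.
rewrite Rint_prod1//; have hI := Linfty_int2 q hh.
rewrite (@eq_Rint _ _ _ p _ (fun x => a x * \int[q]_y h (x, y))); last first.
  by move=> x; rewrite /= RintZl//; exact: Linfty_section1.
have ha2 := Linfty_sqr ha; have hI2 := Linfty_sqr hI; have hs := LinftyM ha hI.
have hc := Linfty_cst T1 (2^-1 : R).
have hw1 : Linfty (fun x => w * a x ^+ 2) by exact: LinftyM.
have hw2 : Linfty (fun x => w^-1 * (\int[q]_y h (x, y)) ^+ 2) by exact: LinftyM.
rewrite /section_var -RintZl// -RintZl// -RintD// -RintZr; last exact: LinftyD.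
apply: le_trans (le_norm_Rint _ hs) _; apply: le_Rint.
- exact: Linfty_norm.
- by apply: LinftyM => //; exact: LinftyD.
- by move=> x; exact: mulr_le_young.
Qed.

End section_var.

Lemma Rint_prod_snd d1 d2 (T1 : measurableType d1) (T2 : measurableType d2) (R : realType)
    (p : probability T1 R) (q : probability T2 R) (w : R) (b : T2 -> R)
    (h : T1 * T2 -> R) : 0 < w -> Linfty b -> Linfty h ->
  `|\int[(p \x q)%E]_z (b z.2 * h z)| <=
  (w * \int[q]_y (b y ^+ 2) + w^-1 * section_var q p (fun z => h (z.2, z.1))) / 2.
Proof.
move=> w0 hb hh; have hbh : Linfty (fun z : T1 * T2 => b z.2 * h z) by linf.
have hbt : Linfty (fun z : T2 * T1 => b z.1 * h (z.2, z.1)).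
  by apply: LinftyM; [exact: Linfty_fst|exact: Linfty_swap].
rewrite Rint_prod2// -(@Rint_prod1 _ _ _ _ _ q p _ hbt).
by apply: Rint_prod_fst => //; exact: Linfty_swap.
Qed.

Section perturbation.
Context d (T : measurableType d) (R : realType) (c : T * T -> R) (M : R).
Hypotheses (hc : Linfty c) (cM : forall z, `|c z| <= M).
Variables (P Q p q : probability T R).

Let f := (potentials c P Q).1.
Let g := (potentials c P Q).2.
Let f' := (potentials c p q).1.
Let g' := (potentials c p q).2.
Let h := xi c P Q.
Let h' := xi c p q.

Let hh : Linfty h. Proof. exact: Linfty_xi hc cM P Q. Qed.
Let hh' : Linfty h'. Proof. exact: Linfty_xi hc cM p q. Qed.

(** [D = a + b] is the difference of log-densities. The potentials [g'] and [g] are centred for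
    different measures, so the constant [t] is moved from one summand to the other to give [b] mean
    zero under [q]; the summands are then orthogonal and the squared norm of [D] splits. *)
Let b0 y := g' y - g y.
Let t := \int[q]_y b0 y.
Let a x := f' x - f x + t.
Let b y := b0 y - t.
Let D (z : T * T) := a z.1 + b z.2.

Let hb0 : Linfty b0.
Proof. by apply: LinftyB; [exact: Linfty_potential2 hc cM _ _|exact: Linfty_potential2 hc cM _ _]. Qed.
Let hb : Linfty b. Proof. by apply: LinftyB. Qed.
Let ha : Linfty a.
Proof.
apply: LinftyD => //; apply: LinftyB; exact: Linfty_potential1 hc cM _ _.
Qed.
Let hD : Linfty D. Proof. by apply: LinftyD; [exact: Linfty_fst|exact: Linfty_snd]. Qed.
Let b_mean0 : \int[q]_y b y = 0.
Proof. by rewrite /b RintB// Rintegral_cstT subrr. Qed.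

(** Two first potentials at [3 * M] each and two second ones at [2 * M] each; the cost cancels in
    [D]. *)
Let W := 10 * M.

Let DW z : `|D z| <= W.
Proof.
have := potential1_norm hc cM P Q z.1; have := potential2_norm hc cM P Q z.2.
have := potential1_norm hc cM p q z.1; have := potential2_norm hc cM p q z.2.
rewrite /D /a /b /b0 /W -/f -/g -/f' -/g' !ler_norml.
move=> /andP[? ?] /andP[? ?] /andP[? ?] /andP[? ?].
rewrite (_ : _ + _ = f' z.1 - f z.1 + (g' z.2 - g z.2)); last by ring.
by apply/andP; split; lra.
Qed.

Let h'E z : h' z = h z * expR (D z).
Proof.
rewrite /h' /h /xi -mulrA -expRD; congr (_ * expR _).
by rewrite /D /a /b /b0 /f /f' /g /g'; ring.
Qed.

Let h_le z : 0 <= h z <= expR (6 * M).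
Proof.
by have /andP[h1 ->] := xi_bounds hc cM P Q z; rewrite andbT (le_trans _ h1)// expR_ge0.
Qed.

Let hm : T * T -> R := fun z => h z - 1.
Let hhm : Linfty hm. Proof. by apply: LinftyB. Qed.

Let E2 := \int[(p \x q)%E]_z (D z ^+ 2).

Let E2E : E2 = \int[p]_x (a x ^+ 2) + \int[q]_y (b y ^+ 2).
Proof.
have ha2 : Linfty (fun x => a x ^+ 2) by exact: Linfty_sqr.
have hb2 : Linfty (fun x => b x ^+ 2) by exact: Linfty_sqr.
rewrite /E2 Rint_prod1; last exact: Linfty_sqr.
rewrite (@eq_Rint _ _ _ p _ (fun x => a x ^+ 2 + \int[q]_y (b y ^+ 2))).
  by rewrite RintD// Rintegral_cstT.
move=> x; rewrite (@eq_Rint _ _ _ q _ (fun y => (a x ^+ 2 + 2 * a x * b y) + b y ^+ 2)); last first.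
  by move=> y; rewrite /D/=; ring.
have h1 : Linfty (fun y => 2 * a x * b y) by exact: LinftyM.
by rewrite RintD ?RintD ?RintZl ?b_mean0 ?mulr0 ?addr0 ?Rintegral_cstT//; exact: LinftyD.
Qed.

Let V := section_var p q hm + section_var q p (fun z => hm (z.2, z.1)).

(** The lower bound of the density times the strong monotonicity constant of [expR] on [[-W, W]]. *)
Let m := expR (- (6 * M)) * expR (- W).

Let m0 : 0 < m. Proof. by rewrite mulr_gt0 ?expR_gt0. Qed.

(* [xi' - xi] is monotone in [D] and the marginals of [xi'] are exact. *)
Let E2_le : m * E2 <= (m * E2 + m^-1 * V) / 2.
Proof.
have hd : Linfty (fun z => (h' z - h z) * D z) by apply: LinftyM => //; exact: LinftyB.
apply: (@le_trans _ _ (\int[(p \x q)%E]_z ((h' z - h z) * D z))).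
  have hD2 : Linfty (fun z => D z ^+ 2) by exact: Linfty_sqr.
  rewrite /E2 -RintZl//; apply: le_Rint => //; first exact: LinftyM.
  move=> z; rewrite h'E (_ : h z * expR (D z) - h z = h z * (expR (D z) - 1)); last by ring.
  rewrite /m -(mulrA (expR (- (6 * M)))) -(mulrA (h z)) ler_pM ?expR_ge0//.
  - by rewrite mulr_ge0 ?expR_ge0 ?sqr_ge0.
  - by have /andP[] := xi_bounds hc cM P Q z.
  - exact: expR_sub1_ge.
have m1 : \int[(p \x q)%E]_z ((h' z - 1) * D z) = 0.
  have hh1 : Linfty (fun z => h' z - 1) by exact: LinftyB.
  have e1 : \int[(p \x q)%E]_z (a z.1 * (h' z - 1)) = 0.
    rewrite Rint_prod1; last by apply: LinftyM => //; exact: Linfty_fst.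
    rewrite -[RHS](Rintegral_cstT p); apply: eq_Rint => x /=.
    rewrite RintZl; last exact: (Linfty_section1 x hh1).
    rewrite RintB ?Rintegral_cstT; [|exact: (Linfty_section1 x hh')|by []].
    by rewrite (xi_marginal1 hc cM) subrr mulr0.
  have e2 : \int[(p \x q)%E]_z (b z.2 * (h' z - 1)) = 0.
    rewrite Rint_prod2; last by apply: LinftyM => //; exact: Linfty_snd.
    rewrite -[RHS](Rintegral_cstT q); apply: eq_Rint => y /=.
    rewrite RintZl; last exact: (Linfty_section2 y hh1).
    rewrite RintB ?Rintegral_cstT; [|exact: (Linfty_section2 y hh')|by []].
    by rewrite (xi_marginal2 hc cM) subrr mulr0.
  rewrite (@eq_Rint _ _ _ _ _ (fun z => a z.1 * (h' z - 1) + b z.2 * (h' z - 1))).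
    rewrite RintD ?e1 ?e2 ?addr0//.
      by apply: LinftyM => //; exact: Linfty_fst.
    by apply: LinftyM => //; exact: Linfty_snd.
  by move=> z; rewrite /D mulrC mulrDl.
have -> : \int[(p \x q)%E]_z ((h' z - h z) * D z) =
   - (\int[(p \x q)%E]_z (a z.1 * hm z) + \int[(p \x q)%E]_z (b z.2 * hm z)).
  have h1 : Linfty (fun z : T * T => a z.1 * hm z) by apply: LinftyM => //; exact: Linfty_fst.
  have h2 : Linfty (fun z : T * T => b z.2 * hm z) by apply: LinftyM => //; exact: Linfty_snd.
  rewrite -RintD// -[RHS]add0r -m1 -RintB.
  - by apply: eq_Rint => z; rewrite /D /hm; ring.
  - by apply: LinftyM => //; exact: LinftyB.
  - exact: LinftyD.
apply: le_trans (ler_norm _) _; rewrite normrN; apply: le_trans (ler_normD _ _) _.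
apply: le_trans (lerD (Rint_prod_fst p q m0 ha hhm) (Rint_prod_snd p q m0 hb hhm)) _.
by rewrite E2E /V -mulrDl addrACA -!mulrDr.
Qed.
(** The weight in Young's inequality was taken equal to [m], so half of [m * E2] is absorbed by the
    left side. *)
Let E2_bound : E2 <= m ^- 2 * V.
Proof.
have im0 : 0 < m^-1 by rewrite invr_gt0.
have h1 : m * E2 <= m^-1 * V.
  by have := E2_le; generalize (m * E2) (m^-1 * V) => u v ?; lra.
have := ler_wpM2l (ltW im0) h1.
by rewrite (mulrA m^-1 m) mulVf ?gt_eqF// mul1r (mulrA m^-1 m^-1) -expr2 exprVn.
Qed.

Let Chh := m ^- 2 * (expR (6 * M) * expR W) ^+ 2.

Lemma xi_stability : \int[(p \x q)%E]_z ((h' z - h z) ^+ 2) <= Chh * V.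
Proof.
pose e := expR (6 * M) * expR W; have hD2 := Linfty_sqr hD.
have he : Linfty (fun z => e ^+ 2 * D z ^+ 2) by exact: LinftyM.
apply: (@le_trans _ _ (e ^+ 2 * E2)).
  rewrite /E2 -RintZl//; apply: le_Rint => //.
    by apply: Linfty_sqr; exact: LinftyB.
  move=> z; rewrite h'E (_ : h z * expR (D z) - h z = h z * (expR (D z) - 1)); last by ring.
  exact: expR_sub1_sqr_le.
rewrite /Chh [leRHS]mulrAC mulrC ler_wpM2r ?sqr_ge0//.
Qed.

Variables (H : T * T -> R) (B : R).
Hypotheses (hH : Linfty H) (HB : forall z, `|H z| <= B).

Let hHh : Linfty (fun z => H z * h z). Proof. exact: LinftyM. Qed.

(** Write [h' - h = h * D + h * (exp D - 1 - D)]. The second part is quadratic in [D]. In the first,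
    [D] is a sum of functions of one variable, so only the section integrals of [H * h] enter; these
    are small when [H] has zero conditional means under the population plan. Everything is then of
    the order of a square. *)
Lemma linearization :
  `|\int[(p \x q)%E]_z (H z * h' z) - \int[(p \x q)%E]_z (H z * h z)| <=
  (2^-1 + B * expR (6 * M) * expR W) * (m ^- 2 * V) +
  (section_var p q (fun z => H z * h z) +
   section_var q p (fun z => H (z.2, z.1) * h (z.2, z.1))) / 2.
Proof.
have B0 : 0 <= B by exact: le_trans (HB (point, point)).
have hHD : Linfty (fun z => D z * (H z * h z)) by exact: LinftyM.
have hrho : Linfty (fun z => H z * h z * (expR (D z) - 1 - D z)).
  by apply: LinftyM => //; apply: LinftyB => //; apply: LinftyB => //; exact: Linfty_expR.
have hHh' : Linfty (fun z => H z * h' z) by exact: LinftyM.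
rewrite -RintB// (@eq_Rint _ _ _ _ _ (fun z =>
   D z * (H z * h z) + H z * h z * (expR (D z) - 1 - D z))); last first.
  by move=> z; rewrite h'E; ring.
rewrite RintD//.
have b1 : `|\int[(p \x q)%E]_z (D z * (H z * h z))| <= (E2 +
    (section_var p q (fun z => H z * h z) +
     section_var q p (fun z => H (z.2, z.1) * h (z.2, z.1)))) / 2.
  have l1 : Linfty (fun z : T * T => a z.1 * (H z * h z)).
    by apply: LinftyM => //; exact: Linfty_fst.
  have l2 : Linfty (fun z : T * T => b z.2 * (H z * h z)).
    by apply: LinftyM => //; exact: Linfty_snd.
  rewrite (@eq_Rint _ _ _ _ _ (fun z => a z.1 * (H z * h z) + b z.2 * (H z * h z))); last first.
    by move=> z; rewrite /D mulrDl.
  rewrite RintD// (le_trans (ler_normD _ _))//.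
  set V1 := section_var p q _; set V2 := section_var q p _.
  have s1 : `|\int[(p \x q)%E]_z (a z.1 * (H z * h z))| <= (\int[p]_x (a x ^+ 2) + V1) / 2.
    by have := Rint_prod_fst p q ltr01 ha hHh; rewrite mul1r invr1 mul1r.
  have s2 : `|\int[(p \x q)%E]_z (b z.2 * (H z * h z))| <= (\int[q]_y (b y ^+ 2) + V2) / 2.
    by have := Rint_prod_snd p q ltr01 hb hHh; rewrite mul1r invr1 mul1r.
  apply: le_trans (lerD s1 s2) _.
  by rewrite E2E; generalize V1 V2; lra_goal.
have b2 : `|\int[(p \x q)%E]_z (H z * h z * (expR (D z) - 1 - D z))| <=
    B * expR (6 * M) * expR W * E2.
  have hc2 : Linfty (fun z => B * expR (6 * M) * expR W * D z ^+ 2).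
    by apply: LinftyM => //; exact: Linfty_sqr.
  apply: le_trans (le_norm_Rint _ hrho) _.
  rewrite /E2 -RintZl; last exact: Linfty_sqr.
  apply: le_Rint => //; first exact: Linfty_norm.
  move=> z; have /andP[hz0 hz] := h_le z.
  rewrite [`|H z * h z * _|]normrM [`|H z * h z|]normrM (ger0_norm hz0).
  rewrite -[leRHS]mulrA; apply: ler_pM; [by rewrite mulr_ge0|by []|by apply: ler_pM|].
  rewrite (le_trans (expR_taylor2 _))// mulrC ler_wpM2r ?sqr_ge0//.
  by rewrite ler_expR; exact: DW.
apply: le_trans (ler_normD _ _) _; apply: le_trans (lerD b1 b2) _.
have k0 : 0 <= 2^-1 + B * expR (6 * M) * expR W.
  by rewrite addr_ge0// !mulr_ge0 ?expR_ge0.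
have := ler_wpM2l k0 E2_bound.
generalize (m ^- 2 * V) (B * expR (6 * M) * expR W) E2.
by lra_goal.
Qed.

End perturbation.


(** * Second moments of independent samples *)

#[local] Transparent Rintegral.

Section independence.
Context d (W : measurableType d) (R : realType) (Pr : probability W R).
Context d' (T : measurableType d') (I : choiceType) (Z : I -> W -> T)
  (P_ : I -> probability T R).
Hypotheses (mZ : forall i, measurable_fun setT (Z i))
  (indep : mutual_independence Pr Z)
  (law : forall i A, measurable A -> Pr (Z i @^-1` A) = P_ i A).

Let mZA i A : measurable A -> measurable (Z i @^-1` A).
Proof. by move=> mA; rewrite -[X in measurable X]setTI; exact: mZ. Qed.

(** A family stable under intersection that generates the events determined by the samples other
    than [i]. *)
Definition cylinders_off (i : I) : set (set W) :=
  [set E | exists (J : seq I) (A : I -> set T),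
    [/\ uniq J, i \notin J, forall j, measurable (A j) &
        E = \bigcap_(j in [set` J]) (Z j @^-1` A j)]].

Let cylindersI i : setI_closed (cylinders_off i).
Proof.
move=> _ _ [J [A [uJ iJ mA ->]]] [J' [A' [uJ' iJ' mA' ->]]].
exists (undup (J ++ J')), (fun j => (if j \in J then A j else setT) `&`
  (if j \in J' then A' j else setT)); split.
- exact: undup_uniq.
- by rewrite mem_undup mem_cat negb_or iJ.
- by move=> j; apply: measurableI; case: ifP.
- apply/seteqP; split => [w [h h'] j|w h].
    by rewrite /= mem_undup => _; split; case: ifP => // jJ; [exact: h|exact: h'].
  split=> j /= jJ.
    by have := h j; rewrite /= mem_undup mem_cat jJ => /(_ isT)[].
  by have := h j; rewrite /= mem_undup mem_cat jJ orbT => /(_ isT)[].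
Qed.

Let cylinders_measurable i E : cylinders_off i E -> measurable E.
Proof.
move=> [J [A [uJ iJ mA ->]]]; apply: fin_bigcap_measurable => [|j _]; last exact: mZA.
exact: finite_seq.
Qed.

Let prob_cap i E A : cylinders_off i E -> measurable A ->
  Pr (E `&` Z i @^-1` A) = (Pr E * Pr (Z i @^-1` A))%E.
Proof.
move=> [J [B [uJ iJ mB ->]]] mA; rewrite indep//.
pose C j := if j == i then A else B j.
have -> : \bigcap_(j in [set` J]) (Z j @^-1` B j) `&` Z i @^-1` A =
    \bigcap_(j in [set` (i :: J)]) (Z j @^-1` C j).
  apply/seteqP; split => [w [h hi] j|w h].
    rewrite /= inE /C => /predU1P[->|jJ]; first by rewrite eqxx.
    by case: eqP => [->|_] //; exact: h.
  split=> [j jJ|].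
    have := h j; rewrite /= inE jJ orbT => /(_ isT); rewrite /C.
    by case: eqP => // ji; move: iJ; rewrite -ji jJ.
  by have := h i; rewrite /= mem_head /C eqxx => /(_ isT).
rewrite indep ?big_cons/= ?iJ//; last by move=> j; rewrite /C; case: ifP.
rewrite /C eqxx muleC; congr (_ * _)%E; apply: eq_big_seq => j jJ.
by case: eqP => // ji; move: iJ; rewrite -ji jJ.
Qed.

Let dynkin_indep (B : set W) : measurable B ->
  dynkin [set E | measurable E /\ Pr (E `&` B) = (Pr E * Pr B)%E].
Proof.
move=> mB; split.
- by split => //; rewrite setTI probability_setT mul1e.
- move=> E [mE hE]; split; first exact: measurableC.
  have -> : ~` E `&` B = B `\` E by rewrite setIC -setDE.
  have fE : Pr E \is a fin_num by rewrite fin_num_measure.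
  have fB : Pr B \is a fin_num by rewrite fin_num_measure.
  rewrite measureD//; last by rewrite -ge0_fin_numE.
  rewrite [X in (_ - X)%E](_ : _ = (Pr E * Pr B)%E); last by rewrite setIC.
  rewrite [X in _ = (X * _)%E](_ : _ = (1 - Pr E)%E); last exact: probability_setC.
  have key (x y : \bar R) : x \is a fin_num -> y \is a fin_num ->
      (y - x * y = (1 - x) * y)%E.
    case: x y => [x||] [y||] // _ _.
    by rewrite -EFinM -!EFinB -EFinM; congr EFin; ring.
  exact: key.
- move=> F tF hF; have mF k : measurable (F k) by case: (hF k).
  split; first exact: bigcup_measurable.
  rewrite setI_bigcupl measure_bigcup//; last 2 first.
  - by move=> k _; exact: measurableI.
  - exact: trivIset_setIr.
  have [x xB] : exists x, Pr B = x%:E.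
    by exists (fine (Pr B)); rewrite fineK// fin_num_measure.
  rewrite measure_bigcup// xB muleC -nneseriesZl//.
  by apply: eq_eseriesr => k _; have [_ hk] := hF k; rewrite muleC -xB; exact: hk.
Qed.

(** Independence is assumed for finite families of events; the Dynkin class theorem extends it to
    the whole sigma-algebra generated by the other samples, whose events are also seen to be
    measurable in [W]. *)
Lemma indep_past i E A : <<s cylinders_off i >> E -> measurable A ->
  measurable E /\ Pr (E `&` Z i @^-1` A) = (Pr E * P_ i A)%E.
Proof.
move=> + mA; rewrite -setI_closed_g_dynkin_g_sigma_algebra// => hE.
rewrite -law//.
have := @smallest_sub _ _ _ _ (dynkin_indep (mZA i mA)) _ E hE; apply.
move=> B cB; split; first exact: cylinders_measurable cB.
exact: prob_cap.
Qed.

Notation past i := (g_sigma_algebraType (cylinders_off i)).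

Lemma measurable_past i j : j != i -> measurable_fun [set: past i] (Z j : past i -> T).
Proof.
move=> ji _ A mA; rewrite setTI; apply: sub_sigma_algebra.
exists [:: j], (fun=> A); split => //; first by rewrite inE eq_sym.
apply/seteqP; split => [w h k|w /(_ j)]; first by rewrite /= inE => /eqP ->.
by rewrite /= inE eqxx => /(_ isT).
Qed.

Lemma past_measurable_fun i dS (S : measurableType dS) (V : W -> S) :
  measurable_fun [set: past i] (V : past i -> S) -> measurable_fun setT V.
Proof.
move=> mV _ B mB; rewrite setTI.
have := mV measurableT B mB; rewrite setTI => h.
by have [] := indep_past h (@measurableT _ T).
Qed.

Section freeze.
Variables (i : I) (dS : measure_display) (S : measurableType dS) (V : W -> S).
Hypothesis mV : measurable_fun [set: past i] (V : past i -> S).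

Let mV' : measurable_fun setT V. Proof. exact: past_measurable_fun mV. Qed.

Let VZ w := (V w, Z i w).
Let mVZ : measurable_fun setT VZ. Proof. exact: measurable_fun_pair. Qed.

HB.instance Definition _ := isMeasurableFun.Build _ _ _ _ V mV'.
HB.instance Definition _ := isMeasurableFun.Build _ _ _ _ VZ mVZ.

(** As [V] is determined by samples other than [i], the pair [(V, Z i)] has a product law, and
    Fubini's theorem integrates [Z i] out with [V] held fixed. It replaces conditional expectations
    throughout. *)
Lemma freeze (F : S * T -> R) : Linfty F ->
  \int[Pr]_w F (V w, Z i w) = \int[Pr]_w \int[P_ i]_y F (V w, y).
Proof.
move=> hF; have [mF _] := hF.
transitivity (\int[distribution Pr VZ]_z F z).
  congr fine; rewrite integral_distribution//; first exact/measurable_EFinP.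
  exact: (Linfty_integrable Pr (Linfty_comp mVZ hF)).
transitivity (\int[(distribution Pr V \x P_ i)%E]_z F z).
  congr fine; apply: eq_measure_integral => A mA _; apply/esym.
  apply: product_measure_unique => // B C mB mC.
  have := mV measurableT mB; rewrite setTI => h.
  by have [_] := indep_past h mC.
rewrite Rint_prod1//.
have hI := Linfty_int2 (P_ i) hF; have [mI _] := hI.
congr fine; rewrite integral_distribution//; first exact/measurable_EFinP.
exact: (Linfty_integrable Pr (Linfty_comp mV' hI)).
Qed.

Lemma freeze0 (F : S * T -> R) : Linfty F -> (forall s, \int[P_ i]_y F (s, y) = 0) ->
  \int[Pr]_w F (V w, Z i w) = 0.
Proof.
move=> hF F0; rewrite freeze// -[RHS](Rintegral_cstT Pr).
by apply: eq_Rint => w; exact: F0.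
Qed.

End freeze.

Lemma Rint_law i (f : T -> R) : Linfty f -> \int[Pr]_w f (Z i w) = \int[P_ i]_y f y.
Proof.
move=> hf; rewrite (@freeze i _ unit (fun=> tt) _ (fun z => f z.2)).
- by rewrite Rintegral_cstT.
- exact: measurable_cst.
- exact: Linfty_snd.
Qed.

Section second_moments.
Notation E X := (\int[Pr]_w X w).

Lemma Linfty_Z i (f : T -> R) : Linfty f -> Linfty (fun w => f (Z i w)).
Proof. exact: Linfty_comp. Qed.

Lemma Linfty_ZZ i j (h : T * T -> R) : Linfty h -> Linfty (fun w => h (Z i w, Z j w)).
Proof. by apply: Linfty_comp; exact: measurable_fun_pair. Qed.

Lemma sqr_sum_diag (n : nat) (F : 'I_n -> W -> R) (B : R) :
  (forall i, Linfty (F i)) -> (forall i w, `|F i w| <= B) ->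
  (forall i j, i != j -> \int[Pr]_w (F i w * F j w) = 0) ->
  \int[Pr]_w ((\sum_i F i w) ^+ 2) <= n%:R * B ^+ 2.
Proof.
move=> hF FB F0.
have hFF i j : Linfty (fun w => F i w * F j w) by exact: LinftyM.
rewrite (@eq_Rint _ _ _ _ _ (fun w => \sum_i \sum_j (F i w * F j w))); last first.
  by move=> w; rewrite expr2 mulr_suml; apply: eq_bigr => i _; rewrite mulr_sumr.
rewrite Rint_sum; last by move=> i; exact: Linfty_sum.
rewrite mulr_natl -[X in _ *+ X](card_ord n) -sumr_const; apply: ler_sum => i _.
rewrite Rint_sum// (bigD1 i)//= big1 ?addr0; last by move=> j ji; rewrite F0// eq_sym.
apply: Rint_le_cst => // w; rewrite -expr2 -real_normK ?num_real// lerXn2r ?nnegrE//.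
exact: le_trans (FB i w).
Qed.

(** Cross terms vanish when [Z (s k)] is integrated out with the pair [(Z i, Z (s j))] frozen, so
    only [n] diagonal terms remain. *)
Lemma sqr_mean_le (n : nat) (s : 'I_n -> I) i (h : T * T -> R) (B : R) :
  injective s -> (forall j, s j != i) ->
  Linfty h -> (forall z, `|h z| <= B) ->
  (forall j x, \int[P_ (s j)]_y h (x, y) = 0) -> (0 < n)%N ->
  \int[Pr]_w ((n%:R^-1 * \sum_j h (Z i w, Z (s j) w)) ^+ 2) <= B ^+ 2 / n%:R.
Proof.
move=> sinj si hh hB h0 n0.
have n0' : n%:R != 0 :> R by rewrite pnatr_eq0 -lt0n.
have hZ j : Linfty (fun w => h (Z i w, Z (s j) w)) by exact: Linfty_ZZ.
rewrite (@eq_Rint _ _ _ _ _ (fun w => n%:R ^- 2 * (\sum_j h (Z i w, Z (s j) w)) ^+ 2)); last first.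
  by move=> w; rewrite exprMn exprVn.
rewrite RintZl; last by apply: Linfty_sqr; exact: Linfty_sum.
apply: (@le_trans _ _ (n%:R ^- 2 * (n%:R * B ^+ 2))); last first.
  by rewrite expr2 le_eqVlt; apply/orP; left; apply/eqP; field.
rewrite ler_wpM2l ?invr_ge0 ?exprn_ge0//.
apply: sqr_sum_diag => //j k jk.
apply: (@freeze0 (s k) _ _ (fun w => (Z i w, Z (s j) w)) _
   (fun z => h z.1 * h (z.1.1, z.2))).
- by apply: measurable_fun_pair; apply: measurable_past => //; [rewrite eq_sym|rewrite (inj_eq sinj)].
- apply: LinftyM; first exact: Linfty_fst.
  apply: Linfty_comp => //; apply: measurable_fun_pair => //.
  exact: measurableT_comp.
- move=> [x y]; rewrite /= RintZl ?h0 ?mulr0//; exact: Linfty_section1.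
Qed.

Lemma sqr_mean1_le (n : nat) (s : 'I_n -> I) (f : T -> R) (B : R) :
  injective s -> Linfty f -> (forall x, `|f x| <= B) ->
  (forall j, \int[P_ (s j)]_y f y = 0) -> (0 < n)%N ->
  \int[Pr]_w ((n%:R^-1 * \sum_j f (Z (s j) w)) ^+ 2) <= B ^+ 2 / n%:R.
Proof.
move=> sinj hf fB f0 n0.
have n0' : n%:R != 0 :> R by rewrite pnatr_eq0 -lt0n.
have hZ j : Linfty (fun w => f (Z (s j) w)) by exact: Linfty_Z.
rewrite (@eq_Rint _ _ _ _ _ (fun w => n%:R ^- 2 * (\sum_j f (Z (s j) w)) ^+ 2)); last first.
  by move=> w; rewrite exprMn exprVn.
rewrite RintZl; last by apply: Linfty_sqr; exact: Linfty_sum.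
apply: (@le_trans _ _ (n%:R ^- 2 * (n%:R * B ^+ 2))); last first.
  by rewrite expr2 le_eqVlt; apply/orP; left; apply/eqP; field.
rewrite ler_wpM2l ?invr_ge0 ?exprn_ge0//.
apply: sqr_sum_diag => //j k jk.
apply: (@freeze0 (s k) _ _ (fun w => Z (s j) w) _ (fun z => f z.1 * f z.2)).
- by apply: measurable_past; rewrite (inj_eq sinj).
- by apply: LinftyM; [exact: Linfty_fst|exact: Linfty_snd].
- by move=> x; rewrite /= RintZl ?f0 ?mulr0.
Qed.

(** Degeneracy in each variable gains one factor: the inner means have second moment at most
    [B ^+ 2 / m] by centring in [y], and they are mutually orthogonal by centring in [x]. *)
Lemma sqr_degenerate_le (n m : nat) (s : 'I_n -> I) (t : 'I_m -> I) (h : T * T -> R) (B : R) :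
  injective s -> injective t -> (forall i j, s i != t j) ->
  Linfty h -> (forall z, `|h z| <= B) ->
  (forall j x, \int[P_ (t j)]_y h (x, y) = 0) ->
  (forall i y, \int[P_ (s i)]_x h (x, y) = 0) -> (0 < n)%N -> (0 < m)%N ->
  \int[Pr]_w ((n%:R^-1 * \sum_i (m%:R^-1 * \sum_j h (Z (s i) w, Z (t j) w))) ^+ 2) <=
  B ^+ 2 / (n%:R * m%:R).
Proof.
move=> sinj tinj st hh hB h0 h0' n0 m0.
have n0' : n%:R != 0 :> R by rewrite pnatr_eq0 -lt0n.
have m0' : m%:R != 0 :> R by rewrite pnatr_eq0 -lt0n.
have hZ i j : Linfty (fun w => h (Z (s i) w, Z (t j) w)) by exact: Linfty_ZZ.
pose F i w := m%:R^-1 * \sum_j h (Z (s i) w, Z (t j) w).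
have hF i : Linfty (F i) by apply: LinftyM => //; exact: Linfty_sum.
have F2 i : \int[Pr]_w (F i w * F i w) <= B ^+ 2 / m%:R.
  by apply: sqr_mean_le => // j; rewrite eq_sym.
have F0 i k : i != k -> \int[Pr]_w (F i w * F k w) = 0.
  move=> ik.
  pose G w (x : T) := m%:R^-1 * \sum_j h (x, Z (t j) w).
  rewrite (@eq_Rint _ _ _ _ _ (fun w => \sum_j (F i w * m%:R^-1 * h (Z (s k) w, Z (t j) w)))); last first.
    by move=> w; rewrite {2}/F -mulr_sumr mulrA.
  rewrite Rint_sum; last by move=> j; apply: LinftyM => //; exact: LinftyM.
  apply: big1 => j _.
  have [G' hG] := hF i; have [K FK] := hG.
  have K0 : 0 <= K by exact: le_trans (FK point).
  (* [freeze0] asks for a function bounded on the whole product space, while [F i] is bounded only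
     along [W]; truncating at its bound changes no value that is attained. *)
  pose cl (x : R) := Num.max (- K) (Num.min x K).
  have clK x : `|cl x| <= K.
    by rewrite /cl ler_norml le_max lexx/= ge_max ge_min lexx orbT andbT; lra.
  have clE x : `|x| <= K -> cl x = x.
    by rewrite ler_norml => /andP[h1 h2]; rewrite /cl min_l// max_r.
  have mcl : measurable_fun setT cl.
    by apply: measurable_maxr => //; exact: measurable_minr.
  rewrite (@eq_Rint _ _ _ _ _ (fun w => cl (F i w) * m%:R^-1 * h (Z (s k) w, Z (t j) w))); last first.
    by move=> w; rewrite clE.
  apply: (@freeze0 (s k) _ _ (fun w => (F i w, Z (t j) w)) _
     (fun z => cl z.1.1 * m%:R^-1 * h (z.2, z.1.2))).
  - apply: measurable_fun_pair; last by apply: measurable_past; rewrite eq_sym.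
    apply: measurable_funM => //; apply: measurable_sum => l.
    apply: measurableT_comp; first by case: hh.
    apply: measurable_fun_pair; apply: measurable_past; first by rewrite (inj_eq sinj).
    by rewrite eq_sym.
  - apply: LinftyM; first apply: LinftyM => //.
      split; first by apply: measurableT_comp => //; exact: measurableT_comp.
      by exists K => z; exact: clK.
    apply: Linfty_comp => //; apply: measurable_fun_pair => //.
    exact: measurableT_comp.
  - by move=> [x y]; rewrite /= RintZl ?h0' ?mulr0//; exact: Linfty_section2.
rewrite (@eq_Rint _ _ _ _ _ (fun w => n%:R ^- 2 * (\sum_i F i w) ^+ 2)); last first.
  by move=> w; rewrite exprMn exprVn.
rewrite RintZl; last by apply: Linfty_sqr; exact: Linfty_sum.
apply: (@le_trans _ _ (n%:R ^- 2 * (n%:R * (B ^+ 2 / m%:R)))); last first.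
  by rewrite expr2 le_eqVlt; apply/orP; left; apply/eqP; field; apply/andP.
rewrite ler_wpM2l ?invr_ge0 ?exprn_ge0//.
have hFF i j : Linfty (fun w => F i w * F j w) by exact: LinftyM.
rewrite (@eq_Rint _ _ _ _ _ (fun w => \sum_i \sum_j (F i w * F j w))); last first.
  by move=> w; rewrite expr2 mulr_suml; apply: eq_bigr => i _; rewrite mulr_sumr.
rewrite Rint_sum; last by move=> i; exact: Linfty_sum.
rewrite mulr_natl -[X in _ *+ X](card_ord n) -sumr_const; apply: ler_sum => i _.
rewrite Rint_sum// (bigD1 i)//= big1 ?addr0; first exact: F2.
by move=> j ji; rewrite F0// eq_sym.
Qed.

End second_moments.

End independence.
#[local] Opaque Rintegral.


(** * Empirical measures and measurability in the sample *)

#[local] Transparent Rintegral.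

Section empirical_integral.
Context d (T : measurableType d) (R : realType).

Lemma Rint_empirical (n : nat) (x : nat -> T) (f : T -> R) : (0 < n)%N -> Linfty f ->
  \int[empirical R n x]_z f z = n%:R^-1 * \sum_(i < n) f (x i).
Proof.
move=> n0; have n0' : 0 < n%:R :> R by rewrite ltr0n.
have pos (g : T -> R) : Linfty g -> (forall z, 0 <= g z) ->
    \int[empirical R n x]_z g z = n%:R^-1 * \sum_(i < n) g (x i).
  move=> hg g0; have [mg _] := hg.
  have mg' : measurable_fun setT (EFin \o g) by exact/measurable_EFinP.
  have g0' z : setT z -> (0 <= (EFin \o g) z)%E by rewrite lee_fin.
  have k0 : 0 <= n%:R^-1 :> R by rewrite invr_ge0.
  rewrite /Rintegral (@eq_measure_integral _ _ _ _
    (mscale (NngNum k0) (msum (fun i => \d_(x i) : {measure set T -> \bar R}) n))); last first.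
    by move=> A mA _; exact: empiricalE.
  rewrite ge0_integral_mscale// ge0_integral_measure_sum//.
  rewrite (eq_bigr (fun i : 'I_n => (g (x i))%:E)); last first.
    by move=> i _; rewrite integral_dirac// diracT mul1e.
  by rewrite sumEFin.
move=> hf; have [_ [M fM]] := hf.
have hfM : Linfty (fun z => f z + M) by apply: LinftyD => //; exact: Linfty_cst.
have fM0 z : 0 <= f z + M by have := fM z; rewrite ler_norml => /andP[? _]; lra.
have := pos _ hfM fM0; rewrite (RintD _ hf (Linfty_cst T M)) Rintegral_cstT => h.
apply: (addIr M); rewrite h big_split/= mulrDr; congr (_ + _).
by rewrite sumr_const card_ord -[M *+ n]mulr_natl mulKf// gt_eqF.
Qed.

End empirical_integral.

Section random_measures.
Context d (W : measurableType d) d' (T : measurableType d') (R : realType).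

Definition random_Linfty d'' (S : measurableType d'') (g : W -> S -> R) :=
  measurable_fun setT (fun z : W * S => g z.1 z.2) /\ forall w, Linfty (g w).

(** Measurability of a random probability, expressed through integrals. The extra variable of [F] is
    kept so that the result is jointly measurable and the operation can be iterated. *)
Definition random_measure (p : W -> probability T R) := forall F : W -> T -> T -> R,
  measurable_fun setT (fun z : (W * T) * T => F z.1.1 z.1.2 z.2) ->
  (forall w x, Linfty (F w x)) ->
  measurable_fun setT (fun z : W * T => \int[p z.1]_y F z.1 z.2 y).

Lemma empirical_random_measure (n : nat) (X : nat -> W -> T) : (0 < n)%N ->
  (forall i, measurable_fun setT (X i)) ->
  random_measure (fun w => empirical R n (fun i => X i w)).
Proof.
move=> n0 mX F mF hF.
rewrite (_ : (fun z : W * T => _) =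
    fun z => n%:R^-1 * \sum_(i < n) F z.1 z.2 (X i z.1)); last first.
  by apply/funext => z; rewrite Rint_empirical.
apply: measurable_funM; first exact: measurable_cst.
apply: measurable_sum => i.
apply: (measurableT_comp (f := fun z : (W * T) * T => F z.1.1 z.1.2 z.2)
  (g := fun z : W * T => (z, X i z.1))) => //.
by apply: measurable_fun_pair => //; exact: measurableT_comp.
Qed.

Variables (p q : W -> probability T R).
Hypotheses (rp : random_measure p) (rq : random_measure q).
Implicit Types g : W -> T -> R.

Lemma measurable_random_int g : random_Linfty g ->
  measurable_fun setT (fun w => \int[p w]_y g w y).
Proof.
move=> [mg hg].
have := rp (F := fun w _ y => g w y) => /(_ _ (fun w _ => hg w)) h.
apply: (measurableT_comp (f := fun z : W * T => \int[p z.1]_y g z.1 y)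
  (g := fun w : W => (w, point : T))).
  apply: h; apply: (measurableT_comp mg (g := fun z : W * T * T => (z.1.1, z.2))).
  by apply: measurable_fun_pair => //; exact: measurableT_comp.
exact: measurable_fun_pair.
Qed.

Lemma random_Linfty_cst (f : T -> R) : Linfty f -> random_Linfty (fun _ : W => f).
Proof. by move=> hf; split => //; have [mf _] := hf; exact: measurableT_comp. Qed.

Lemma random_LinftyB g g' : random_Linfty g -> random_Linfty g' ->
  random_Linfty (fun w y => g w y - g' w y).
Proof.
by move=> [mg hg] [mg' hg']; split => [|w]; [exact: measurable_funB|exact: LinftyB].
Qed.

Lemma random_Linfty_sum (n : nat) (g : nat -> W -> T -> R) :
  (forall i, random_Linfty (g i)) -> random_Linfty (fun w y => \sum_(i < n) g i w y).
Proof.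
move=> h; split => [|w]; first by apply: measurable_sum => i; case: (h i).
by apply: Linfty_sum => i; case: (h i).
Qed.

Lemma measurable_random_Var g : random_Linfty g ->
  measurable_fun setT (fun w => Var (p w) (g w)).
Proof.
move=> rg; have [mg hg] := rg.
rewrite (_ : (fun w => _) = fun w => \int[p w]_y (g w y ^+ 2) - (\int[p w]_y g w y) ^+ 2); last first.
  by apply/funext => w; exact: VarE.
have r2 : random_Linfty (fun w y => g w y ^+ 2).
  by split=> [|w]; [exact: measurable_funX|exact: Linfty_sqr].
apply: measurable_funB; first exact: measurable_random_int.
by apply: measurable_funX; exact: measurable_random_int.
Qed.

Lemma random_Linfty_int (F : W -> T -> T -> R) :
  measurable_fun setT (fun z : W * (T * T) => F z.1 z.2.1 z.2.2) ->
  (forall w, Linfty (fun z : T * T => F w z.1 z.2)) ->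
  random_Linfty (fun w x => \int[q w]_y F w x y).
Proof.
move=> mF hF; split=> [|w]; last exact: (Linfty_int2 (q w) (hF w)).
apply: rq => [|w x]; last exact: (Linfty_section1 x (hF w)).
apply: (measurableT_comp mF (g := fun z : W * T * T => (z.1.1, (z.1.2, z.2)))).
apply: measurable_fun_pair; first exact: measurableT_comp.
by apply: measurable_fun_pair => //; exact: measurableT_comp.
Qed.

Lemma random_kernel_op (k : W -> T * T -> R) g : random_Linfty k -> random_Linfty g ->
  random_Linfty (fun w => kernel_op (k w) (q w) (g w)).
Proof.
move=> [mk hk] [mg hg]; apply: random_Linfty_int => [|w].
  apply: measurable_funM.
    rewrite (_ : (fun z => _) = fun z : W * (T * T) => k z.1 z.2)//.
    by apply/funext => -[w [x y]].
  apply: (measurableT_comp mg (g := fun z : W * (T * T) => (z.1, z.2.2))).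
  by apply: measurable_fun_pair => //; exact: measurableT_comp.
apply: LinftyM; last exact: (Linfty_comp (@measurable_snd _ _ T T) (hg w)).
rewrite (_ : (fun z => _) = k w)//.
by apply/funext => -[x y].
Qed.

End random_measures.

Section random_potentials.
Context d (W : measurableType d) d' (T : measurableType d') (R : realType).
Variables (c : T * T -> R) (M : R).
Hypotheses (hc : Linfty c) (cM : forall z, `|c z| <= M).
Implicit Types p q : W -> probability T R.

Lemma random_softmin (c' : T * T -> R) q (g : W -> T -> R) : Linfty c' ->
  (forall z, `|c' z| <= M) -> random_measure q -> random_Linfty g ->
  random_Linfty (fun w => softmin c' (q w) (g w)).
Proof.
move=> hc' c'M rq [mg hg]; split=> [|w]; last exact: (Linfty_softmin hc' c'M (q w) (hg w)).
have [mc' _] := hc'.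
rewrite /softmin; apply: measurableT_comp => //; apply: measurableT_comp => //.
apply: (rq (fun w x y => expR (- c' (x, y)) * expR (g w y))) => [|w x]; last first.
  apply: LinftyM; apply: Linfty_expR => //; apply: LinftyN; exact: Linfty_section1.
apply: measurable_funM; apply: measurableT_comp => //.
  apply: measurableT_comp => //.
  apply: (measurableT_comp mc' (g := fun z : W * T * T => (z.1.2, z.2))).
  by apply: measurable_fun_pair => //; exact: measurableT_comp.
apply: (measurableT_comp mg (g := fun z : W * T * T => (z.1.1, z.2))).
by apply: measurable_fun_pair => //; exact: measurableT_comp.
Qed.

Let hct : Linfty (transpose c). Proof. exact: Linfty_swap. Qed.
Let ctM z : `|transpose c z| <= M. Proof. exact: cM. Qed.

Variables p q : W -> probability T R.
Hypotheses (rp : random_measure p) (rq : random_measure q).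

Lemma random_sinkhorn_iter n : random_Linfty (fun w => sinkhorn_iter c (p w) (q w) n).
Proof.
elim: n => [|n ih]; first by apply: random_Linfty_cst; exact: Linfty_cst.
have rs : random_Linfty (fun w => sinkhorn c (p w) (q w) (sinkhorn_iter c (p w) (q w) n)).
  apply: random_softmin => //; exact: random_softmin.
apply: random_LinftyB => //; split=> [|w]; last exact: Linfty_cst.
exact: (measurableT_comp (measurable_random_int rq rs)).
Qed.

(** The selection by [xget] says nothing about the dependence on [w]; the potential is measurable as
    the pointwise limit of Sinkhorn iterates, which are explicit integrals. *)
Lemma random_potential2 : random_Linfty (fun w => (potentials c (p w) (q w)).2).
Proof.
split=> [|w]; last exact: (Linfty_potential2 hc cM).
apply: (@measurable_fun_cvg _ _ _ _ (fun n (z : W * T) => sinkhorn_iter c (p z.1) (q z.1) n z.2)) => //.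
  by move=> n; case: (random_sinkhorn_iter n).
by move=> z _; exact: (sinkhorn_iter_cvg hc cM).
Qed.

Lemma random_xi : random_Linfty (fun w => xi c (p w) (q w)).
Proof.
split=> [|w]; last exact: (Linfty_xi hc cM).
have [mf _] : random_Linfty (fun w => (potentials c (p w) (q w)).1).
  have := random_softmin hc cM rq random_potential2; congr random_Linfty.
  by apply/funext => w; apply/funext => x; rewrite (potential1E hc cM).
have [mg _] := random_potential2; have [mc _] := hc.
apply: measurable_funM.
  do 2 (apply: measurableT_comp => //).
  exact: measurableT_comp.
apply: measurableT_comp => //; apply: measurable_funD.
  apply: (measurableT_comp mf (g := fun z : W * (T * T) => (z.1, z.2.1))).
  by apply: measurable_fun_pair => //; exact: measurableT_comp.
apply: (measurableT_comp mg (g := fun z : W * (T * T) => (z.1, z.2.2))).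
by apply: measurable_fun_pair => //; exact: measurableT_comp.
Qed.

Lemma measurable_entropic_int (eta : T * T -> R) : Linfty eta ->
  measurable_fun setT (fun w => \int[entropic_plan c (p w) (q w)]_z eta z).
Proof.
move=> he; rewrite (_ : (fun w => _) =
    fun w => \int[p w]_x kernel_op (fun z => eta z * xi c (p w) (q w) z) (q w) (fun=> 1) x); last first.
  apply/funext => w; rewrite (Rint_entropic_plan hc cM)//; apply: eq_Rint => x.
  by apply: eq_Rint => y; rewrite mulr1.
apply: (measurable_random_int rp).
apply: (random_kernel_op rq (k := fun w z => eta z * xi c (p w) (q w) z) (g := fun _ _ => 1)).
  have [mx hx] := random_xi; have [me _] := he.
  split=> [|w]; last exact: LinftyM.
  by apply: measurable_funM => //; exact: measurableT_comp.
by apply: random_Linfty_cst; exact: Linfty_cst.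
Qed.

End random_potentials.

(** * One of the two variances: truncation of its Neumann series *)

Section one_sided_variance.
Context d (T : measurableType d) (R : realType).
Implicit Types (k e : T * T -> R) (P Q : probability T R) (N : option nat).

Definition round_trip k P Q (g : T -> R) : T -> R :=
  kernel_op k Q (kernel_op (fun z => k (z.2, z.1)) P g).

Definition side_source k e P Q (x : T) : R := \int[Q]_y (e (x, y) * k (x, y)) -
  kernel_op k Q (fun y => \int[P]_x (e (x, y) * k (x, y))) x.

Definition side_iter k e P Q n := iter n (round_trip k P Q) (side_source k e P Q).

Definition side_var k e P Q N :=
  Var P (neumann_sum P (round_trip k P Q) (side_source k e P Q) N).

Definition side_limit k e P Q :=
  Var P (resolvent P (round_trip k P Q) (side_source k e P Q)).

Definition is_kernel (dl : R) k P Q := [/\ Linfty k, forall z, dl <= k z,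
  forall x, \int[Q]_y k (x, y) = 1 & forall y, \int[P]_x k (x, y) = 1].

(** The second variance is the first one for the transposed kernel and function with the measures
    exchanged, so each estimate is made once and used twice. *)
Lemma side_sigma2 c eta lambda P Q : sigma2 c eta lambda P Q =
  lambda * side_limit (xi c P Q) eta P Q +
  (1 - lambda) * side_limit (transpose (xi c P Q)) (transpose eta) Q P.
Proof. by []. Qed.

Lemma is_kernel_transpose dl k P Q : is_kernel dl k P Q -> is_kernel dl (transpose k) Q P.
Proof. by move=> [hk kdl k1 k2]; split => // [|z]; [exact: Linfty_swap|exact: kdl]. Qed.

Section with_kernel.
Variables (k e : T * T -> R) (P Q : probability T R) (dl B : R).
Hypotheses (dl0 : 0 < dl) (kk : is_kernel dl k P Q) (he : Linfty e) (eB : forall z, `|e z| <= B).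

Let hk : Linfty k. Proof. by case: kk. Qed.
Let kdl z : dl <= k z. Proof. by case: kk. Qed.
Let k1 x : \int[Q]_y k (x, y) = 1. Proof. by case: kk. Qed.
Let k2 y : \int[P]_x k (x, y) = 1. Proof. by case: kk. Qed.
Let hek : Linfty (fun z => e z * k z). Proof. exact: LinftyM. Qed.
Let k0 z : 0 <= k z. Proof. exact: le_trans (ltW dl0) (kdl z). Qed.

Let weighted_norm (p : probability T R) (w h : T -> R) : Linfty w -> Linfty h ->
  (forall y, 0 <= w y) -> \int[p]_y w y = 1 -> (forall y, `|h y| <= B) ->
  `|\int[p]_y (h y * w y)| <= B.
Proof.
move=> hw hh w0 w1 hB; rewrite -[leRHS]mulr1 -w1 -RintZl//.
have hhw := LinftyM hh hw; apply: le_trans (le_norm_Rint _ hhw) _.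
apply: le_Rint; [exact: Linfty_norm|by apply: LinftyM => //; exact: Linfty_cst|].
by move=> y; rewrite normrM (ger0_norm (w0 y)) ler_wpM2r.
Qed.

Let ex_norm x : `|\int[Q]_y (e (x, y) * k (x, y))| <= B.
Proof. by apply: weighted_norm => //; exact: Linfty_section1. Qed.

Let ey_norm y : `|\int[P]_x (e (x, y) * k (x, y))| <= B.
Proof. by apply: weighted_norm => //; exact: Linfty_section2. Qed.

Let hex : Linfty (fun x => \int[Q]_y (e (x, y) * k (x, y))).
Proof. exact: (Linfty_int2 Q hek). Qed.
Let hey : Linfty (fun y => \int[P]_x (e (x, y) * k (x, y))).
Proof. exact: (Linfty_int1 P hek). Qed.

Lemma Linfty_side_source : Linfty (side_source k e P Q).
Proof. by apply: LinftyB => //; exact: Linfty_kernel_op. Qed.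

Lemma side_source_mean : \int[P]_x side_source k e P Q x = 0.
Proof.
rewrite (RintB _ hex (Linfty_kernel_op Q hk hey)) (kernel_op_mean Q hk k2 hey).
by rewrite (Rint_swap P Q hek) subrr.
Qed.

Lemma side_source_norm x : `|side_source k e P Q x| <= 2 * B.
Proof.
rewrite (le_trans (ler_normB _ _))// mulr2n mulrDl mul1r lerD//.
exact: (kernel_op_norm_le hk dl0 kdl k1).
Qed.

Lemma Linfty_round_trip g : Linfty g -> Linfty (round_trip k P Q g).
Proof.
move=> hg; apply: Linfty_kernel_op => //; apply: Linfty_kernel_op => //.
exact: Linfty_swap.
Qed.

Lemma Linfty_side_iter n : Linfty (side_iter k e P Q n).
Proof. by elim: n => [|n ih]; [exact: Linfty_side_source|exact: Linfty_round_trip]. Qed.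

Lemma side_iter_norm n x : `|side_iter k e P Q n x| <= 2 * B.
Proof.
have r1 : (1 - dl) ^+ n <= 1.
  have := dl_le1 hk kdl k1 => dl1; apply: exprn_ile1; first by rewrite subr_ge0.
  by rewrite gerBl ltW.
have B0 : 0 <= 2 * B by exact: le_trans (side_source_norm point).
have := iter_op_norm_le hk dl0 kdl k1 k2 Linfty_side_source side_source_mean
  side_source_norm n x => /le_trans; apply.
by rewrite ler_piMr.
Qed.

Let L := 2 * B / dl.

Lemma side_phi : exists phi, [/\ Linfty phi,
  forall x, phi x - round_trip k P Q phi x = side_source k e P Q x,
  side_limit k e P Q = Var P phi,
  side_var k e P Q None = Var P phi &
  forall n, `|Var P (fun x => \sum_(i < n) side_iter k e P Q i x) - Var P phi| <=
    8 * L ^+ 2 * (1 - dl) ^+ n].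
Proof.
have [phi [h1 h2 h3 h4 h5]] := neumann_Var hk dl0 kdl k1 k2 Linfty_side_source
  side_source_mean side_source_norm.
exists phi; split => // n; have := h5 n.
by rewrite (_ : 1 - (1 - dl) = dl)//; rewrite opprB addrC subrK.
Qed.

(** Both sums are compared with the full solution [phi], whence [16 = 8 + 8]. The shift [j.+1]
    appears because [neumann_sum] at [Some j] has [j + 1] terms. *)
Lemma side_var_tail n N : (if N is Some j then n <= j.+1 else true)%N ->
  `|side_var k e P Q N - Var P (fun x => \sum_(i < n) side_iter k e P Q i x)| <=
  16 * L ^+ 2 * (1 - dl) ^+ n.
Proof.
have [phi [_ _ _ hN hS]] := side_phi.
have r0 : 0 <= 1 - dl by rewrite subr_ge0; exact: dl_le1 hk kdl k1.
have r1 : 1 - dl <= 1 by rewrite gerBl ltW.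
have L0 : 0 <= 8 * L ^+ 2 by rewrite mulr_ge0// sqr_ge0.
have tail j : (n <= j)%N -> 8 * L ^+ 2 * (1 - dl) ^+ j <= 8 * L ^+ 2 * (1 - dl) ^+ n.
  by move=> nj; rewrite ler_wpM2l// ler_wiXn2l.
have -> : 16 * L ^+ 2 * (1 - dl) ^+ n =
    8 * L ^+ 2 * (1 - dl) ^+ n + 8 * L ^+ 2 * (1 - dl) ^+ n by ring.
case: N => [j nj|_].
  apply: le_trans (ler_distD (Var P phi) _ _) _; apply: lerD.
    exact: le_trans (hS j.+1) (tail _ nj).
  by rewrite distrC; exact: hS.
rewrite hN distrC (le_trans (hS n))// lerDl.
by rewrite mulr_ge0 ?exprn_ge0.
Qed.

Lemma side_limit_tail n :
  `|Var P (fun x => \sum_(i < n) side_iter k e P Q i x) - side_limit k e P Q| <=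
  8 * L ^+ 2 * (1 - dl) ^+ n.
Proof. by have [phi [_ _ -> _]] := side_phi; exact. Qed.

End with_kernel.

End one_sided_variance.

Lemma random_Linfty_transpose d (W : measurableType d) d' (T : measurableType d')
    (R : realType) (k : W -> T * T -> R) : random_Linfty k ->
  random_Linfty (fun w => transpose (k w)).
Proof.
move=> [mk hk]; split=> [|w]; last exact: Linfty_swap.
apply: (measurableT_comp mk (g := fun z : W * (T * T) => (z.1, (z.2.2, z.2.1)))).
apply: measurable_fun_pair => //; apply: measurable_fun_pair; exact: measurableT_comp.
Qed.

Section random_side_variance.
Context d (W : measurableType d) d' (T : measurableType d') (R : realType).
Variables (p q : W -> probability T R) (k : W -> T * T -> R) (e : T * T -> R) (dl : R).
Hypotheses (rp : random_measure p) (rq : random_measure q) (rk : random_Linfty k)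
  (dl0 : 0 < dl) (kk : forall w, is_kernel dl (k w) (p w) (q w)) (he : Linfty e).

Let rkt := random_Linfty_transpose rk.

Let rek : random_Linfty (fun w z => e z * k w z).
Proof.
have [mk hk] := rk; have [me _] := he; split=> [|w]; last exact: LinftyM.
by apply: measurable_funM => //; exact: measurableT_comp.
Qed.

Let rekt : random_Linfty (fun w (z : T * T) => e (z.2, z.1) * k w (z.2, z.1)).
Proof.
have [mk hk] := rkt; have [me _] := Linfty_swap he.
split=> [|w]; last by apply: LinftyM; [exact: (Linfty_swap he)|exact: hk].
by apply: measurable_funM => //; exact: (measurableT_comp me).
Qed.

Lemma random_side_iter n : random_Linfty (fun w => side_iter (k w) e (p w) (q w) n).
Proof.
elim: n => [|n ih]; last by apply: (random_kernel_op rq rk); exact: (random_kernel_op rp rkt ih).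
have r1 : random_Linfty (fun _ : W => (fun=> 1) : T -> R).
  by apply: random_Linfty_cst; exact: Linfty_cst.
have hx := random_kernel_op rq rek r1; have hy := random_kernel_op rp rekt r1.
apply: random_LinftyB.
  move: hx; congr random_Linfty; apply/funext => w; apply/funext => x.
  by apply: eq_Rint => y; rewrite mulr1.
apply: (random_kernel_op rq rk).
move: hy; congr random_Linfty; apply/funext => w; apply/funext => y.
by apply: eq_Rint => x; rewrite mulr1.
Qed.

Lemma measurable_side_partial n : measurable_fun setT (fun w =>
  Var (p w) (fun x => \sum_(i < n) side_iter (k w) e (p w) (q w) i x)).
Proof.
apply: (measurable_random_Var rp).
by apply: (random_Linfty_sum n (g := fun i w => side_iter (k w) e (p w) (q w) i)) => i; exact: random_side_iter.
Qed.

(** For the infinite series, defined through [xget], the variance is a pointwise limit in [w] of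
    variances of partial sums. *)
Lemma measurable_side_var N :
  measurable_fun setT (fun w => side_var (k w) e (p w) (q w) N).
Proof.
case: N => [N|]; first exact: measurable_side_partial N.+1.
have [_ [B eB]] := he.
apply: (@measurable_fun_cvg _ _ _ _ (fun n w =>
    Var (p w) (fun x => \sum_(i < n) side_iter (k w) e (p w) (q w) i x))) => //.
  by move=> n; exact: measurable_side_partial.
move=> w _; apply/subr_cvg0.
have r01 : 0 <= 1 - dl < 1.
  have [h1 h2 h3 h4] := kk w.
  by rewrite subr_ge0 (dl_le1 h1 h2 h3)/= gtrBl.
apply: (@cvgn_squeeze0 _ _ (fun n => 16 * (2 * B / dl) ^+ 2 * (1 - dl) ^+ n)) => [n|].
  by rewrite distrC; exact: (side_var_tail dl0 (kk w) he eB (N := None)).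
by rewrite -[X in _ --> X](mulr0 (16 * (2 * B / dl) ^+ 2)); apply: cvgMr; exact: cvg_expr0.
Qed.

End random_side_variance.
#[local] Opaque Rintegral.


(** * Consistency of the variance estimator *)

Section vanishing.
Context d (W : measurableType d) (R : realType) (Pr : probability W R) (rho : nat -> R).
Implicit Types Z : nat -> W -> R.

(* The bound [F] need not be [Z] itself, so that [Z] need not be measurable. *)
Definition vanishing Z := exists C (F : nat -> W -> R), [/\ forall j, Linfty (F j),
  forall j w, 0 <= F j w, forall j w, Z j w <= F j w & forall j, \int[Pr]_w F j w <= C * rho j].

Lemma vanishing_le Z Z' : (forall j w, Z j w <= Z' j w) -> vanishing Z' -> vanishing Z.
Proof.
move=> ZZ' [C [F [h1 h2 h3 h4]]]; exists C, F; split => // j w.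
exact: le_trans (ZZ' j w) (h3 j w).
Qed.

Lemma vanishingD Z Z' : vanishing Z -> vanishing Z' -> vanishing (fun j w => Z j w + Z' j w).
Proof.
move=> [C [F [h1 h2 h3 h4]]] [C' [F' [h1' h2' h3' h4']]].
exists (C + C'), (fun j w => F j w + F' j w); split => j; first exact: LinftyD.
- by move=> w; rewrite addr_ge0.
- by move=> w; rewrite lerD.
- by rewrite RintD// mulrDl lerD.
Qed.

Lemma vanishingZ a Z : 0 <= a -> vanishing Z -> vanishing (fun j w => a * Z j w).
Proof.
move=> a0 [C [F [h1 h2 h3 h4]]].
exists (a * C), (fun j w => a * F j w); split => j.
- by apply: LinftyM => //; exact: Linfty_cst.
- by move=> w; rewrite mulr_ge0.
- by move=> w; rewrite ler_wpM2l.
- by rewrite RintZl// -mulrA ler_wpM2l.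
Qed.

Hypotheses (rho0 : rho j @[j --> \oo] --> (0 : R)).

Lemma prob_cvg0 (A : nat -> set W) : (forall j, measurable (A j)) ->
  (forall e : R, 0 < e -> exists N, forall j, (N <= j)%N -> fine (Pr (A j)) <= e) <->
  Pr (A j) @[j --> \oo] --> 0%E.
Proof.
move=> mA; have E : (fun j => Pr (A j)) = EFin \o (fun j => fine (Pr (A j))).
  by apply/funext => j /=; rewrite fineK// fin_num_measure.
rewrite E; split=> [h|h].
  apply: cvg_EFin; first exact: nearW.
  apply/cvgn_epsP => e /h[N hN]; exists N => j /hN.
  by rewrite /= subr0 ger0_norm ?fine_ge0.
have /cvgn_epsP h' : fine (Pr (A j)) @[j --> \oo] --> (0 : R) by exact: fine_cvg h.
move=> e /h'[N hN]; exists N => j /hN.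
by rewrite subr0 => /(le_trans (ler_norm _)).
Qed.

Lemma prob_fine_le (A B : set W) : measurable A -> measurable B -> A `<=` B ->
  fine (Pr A) <= fine (Pr B).
Proof. by move=> mA mB AB; apply: fine_le; rewrite ?fin_num_measure// le_measure ?inE. Qed.

#[local] Transparent Rintegral.
Lemma Rint_indic (A : set W) : measurable A -> \int[Pr]_w (\1_A w) = fine (Pr A).
Proof. by move=> mA; rewrite /Rintegral integral_indic// setIT. Qed.
#[local] Opaque Rintegral.

Lemma prob_le_Rint (A : set W) (F : W -> R) (e : R) : measurable A -> Linfty F ->
  (forall w, 0 <= F w) -> (forall w, A w -> e <= F w) -> e * fine (Pr A) <= \int[Pr]_w F w.
Proof.
move=> mA hF F0 AF.
have h1 : Linfty (\1_A : W -> R).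
  split; first exact: measurable_indic.
  by exists 1 => w; rewrite indicE; case: (_ \in _); rewrite ?normr1 ?normr0.
rewrite -(Rint_indic mA) -RintZl//; apply: le_Rint => //.
  by apply: LinftyM => //; exact: Linfty_cst.
by move=> w; rewrite indicE; have [/set_mem|_] := boolP (w \in A); rewrite ?mulr1 ?mulr0//; exact: AF.
Qed.

(** Markov's inequality for the dominating variable. The threshold [N] is uniform over the events
    [A], so that the set where [Z j] is large need not itself be an event. *)
Lemma vanishing_prob Z (e : R) : vanishing Z -> 0 < e -> forall ep : R, 0 < ep ->
  exists N, forall j, (N <= j)%N -> forall A : set W, measurable A ->
    (forall w, A w -> e <= Z j w) -> fine (Pr A) <= ep.
Proof.
move=> [C [F [h1 h2 h3 h4]]] e0 ep ep0.
have hC : C * rho j @[j --> \oo] --> (0 : R) by rewrite -(mulr0 C); exact: cvgMr.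
have /cvgn_epsP/(_ _ (mulr_gt0 e0 ep0))[N hN] := hC.
exists N => j /hN Nj A mA AZ; rewrite -(ler_pM2l e0).
apply: le_trans (prob_le_Rint mA (h1 j) (h2 j) _) _.
  by move=> w /AZ /le_trans; exact.
apply: le_trans (h4 j) _; apply: le_trans (ler_norm _) _.
by rewrite subr0 in Nj.
Qed.

Lemma measurable_dist_ge (Z : W -> R) (l e : R) : measurable_fun setT Z ->
  measurable [set w | e <= `|Z w - l|].
Proof.
move=> mZ; have m : measurable_fun setT (fun w => `|Z w - l|).
  by apply: measurableT_comp => //; exact: measurable_funB.
have := m measurableT `[e, +oo[%classic (measurable_itv _).
rewrite setTI; congr (measurable _); apply/seteqP.
by split=> w /=; rewrite in_itv/= andbT.
Qed.

(** The dominating [Y] may depend on the tolerance [e]: a truncation level can be fixed before the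
    sample sizes grow. *)
Lemma cvg_in_probability_vanishing Z (l : R) : (forall j, measurable_fun setT (Z j)) ->
  (forall e : R, 0 < e -> exists Y (c : R) K, [/\ vanishing Y, 0 < c &
    forall j, (K <= j)%N -> forall w, e <= `|Z j w - l| -> c <= Y j w]) ->
  cvg_in_probability Pr Z l.
Proof.
move=> mZ hZ; split => // e e0.
have mA j : measurable [set w | e <= `|Z j w - l|] by exact: measurable_dist_ge.
apply/(prob_cvg0 mA) => ep ep0; have [Y [c [K [hY c0 hK]]]] := hZ e e0.
have [N hN] := vanishing_prob hY c0 ep0.
exists (maxn K N) => j; rewrite geq_max => /andP[Kj Nj].
by apply: (hN _ Nj _ (mA j)) => w; exact: hK.
Qed.

Lemma cvg_in_probability_lin Z Z' (l l' : R) (a b : nat -> R) (a' b' : R) :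
  cvg_in_probability Pr Z l -> cvg_in_probability Pr Z' l' ->
  (forall j, `|a j| <= 1) -> (forall j, `|b j| <= 1) ->
  a j @[j --> \oo] --> a' -> b j @[j --> \oo] --> b' ->
  cvg_in_probability Pr (fun j w => a j * Z j w + b j * Z' j w) (a' * l + b' * l').
Proof.
move=> [mZ hZ] [mZ' hZ'] a1 b1 ha hb.
have m j : measurable_fun setT (fun w => a j * Z j w + b j * Z' j w).
  by apply: measurable_funD; apply: measurable_funM.
split => // e e0; have mA j := measurable_dist_ge (a' * l + b' * l') e (m j).
apply/(prob_cvg0 mA) => ep ep0.
have e3 : 0 < e / 3 by exact: divr_gt0.
have m1 j := measurable_dist_ge l (e / 3) (mZ j).
have m2 j := measurable_dist_ge l' (e / 3) (mZ' j).
have ep2 : 0 < ep / 2 by exact: divr_gt0.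
have [N1 hN1] := (prob_cvg0 m1).2 (hZ _ e3) _ ep2.
have [N2 hN2] := (prob_cvg0 m2).2 (hZ' _ e3) _ ep2.
have hd : a j * l + b j * l' @[j --> \oo] --> a' * l + b' * l'.
  by apply: cvgD; exact: cvgMl.
have e4 : 0 < e / 4 by exact: divr_gt0.
have /cvgn_epsP/(_ _ e4)[N3 hN3] := hd.
exists (maxn N1 (maxn N2 N3)) => j; rewrite !geq_max => /and3P[/hN1 h1 /hN2 h2 /hN3 h3].
rewrite [ep]splitr; apply: le_trans (lerD h1 h2).
have mU := measurableU _ _ (m1 j) (m2 j).
apply: (@le_trans _ _ (fine (Pr ([set w | e / 3 <= `|Z j w - l|] `|` [set w | e / 3 <= `|Z' j w - l'|])))).
  apply: prob_fine_le => // w /= hw.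
  have [|k1] := leP (e / 3) `|Z j w - l|; first by left.
  have [|k2] := leP (e / 3) `|Z' j w - l'|; first by right.
  have key : `|a j * Z j w + b j * Z' j w - (a' * l + b' * l')| <=
      `|Z j w - l| + `|Z' j w - l'| + e / 4.
    have -> : a j * Z j w + b j * Z' j w - (a' * l + b' * l') =
      a j * (Z j w - l) + b j * (Z' j w - l') + (a j * l + b j * l' - (a' * l + b' * l')) by ring.
    rewrite (le_trans (ler_normD _ _))// lerD// (le_trans (ler_normD _ _))// lerD//;
      by rewrite normrM ler_piMl.
  by move: (le_trans hw key) k1 k2 e0; move: (`|_|) (`|_|) => u v; lra.
rewrite -fineD ?fin_num_measure//; apply: fine_le.
- by rewrite fin_num_measure.
- by rewrite fin_numD !fin_num_measure.
- exact: measureU2.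
Qed.

End vanishing.

(** * Mean-square perturbation of kernel operators *)

Section kernel_perturbation.
Context d (T : measurableType d) (R : realType).
Variables (k k' : T * T -> R) (P Q p q : probability T R) (dl : R).
Hypotheses (dl0 : 0 < dl) (kk : is_kernel dl k P Q) (kk' : is_kernel dl k' p q).

Let hk : Linfty k. Proof. by case: kk. Qed.
Let hk' : Linfty k'. Proof. by case: kk'. Qed.
Let X := \int[(p \x q)%E]_z ((k' z - k z) ^+ 2).

Let hkk : Linfty (fun z => k' z - k z). Proof. exact: LinftyB. Qed.

Let weighted_sqr (w f : T -> R) : Linfty w -> Linfty f -> (forall y, 0 <= w y) ->
  \int[q]_y w y = 1 -> (\int[q]_y (w y * f y)) ^+ 2 <= \int[q]_y (w y * f y ^+ 2).
Proof.
move=> hw hf w0 w1; set m := \int[q]_y (w y * f y).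
have hwf := LinftyM hw hf; have hwf2 := LinftyM hw (Linfty_sqr hf).
have : 0 <= \int[q]_y (w y * (f y - m) ^+ 2).
  by apply: Rintegral_ge0 => y _; rewrite mulr_ge0 ?sqr_ge0.
have h2 : Linfty (fun y => 2 * m * (w y * f y)) by apply: LinftyM => //; exact: Linfty_cst.
have h3 : Linfty (fun y => m ^+ 2 * w y) by apply: LinftyM => //; exact: Linfty_cst.
rewrite (@eq_Rint _ _ _ _ _ (fun y => w y * f y ^+ 2 - 2 * m * (w y * f y) + m ^+ 2 * w y)); last first.
  by move=> y; ring.
rewrite (RintD _ (LinftyB hwf2 h2) h3) (RintB _ hwf2 h2) (RintZl _ _ hwf) (RintZl _ _ hw) w1 -/m.
by generalize (\int[q]_y (w y * f y ^+ 2)) m => a b; nra.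
Qed.

Let sqr3 (a b c : R) : (a + b + c) ^+ 2 <= 3 * (a ^+ 2 + b ^+ 2 + c ^+ 2).
Proof.
have := sqr_ge0 (a - b); have := sqr_ge0 (a - c); have := sqr_ge0 (b - c).
by rewrite !expr2; lra.
Qed.

Lemma perturb_int (F : T * T -> R) (G : R) : Linfty F -> (forall z, `|F z| <= G) ->
  \int[p]_x ((\int[q]_y (F (x, y) * (k' (x, y) - k (x, y)))) ^+ 2) <= G ^+ 2 * X.
Proof.
move=> hF FG; have hFk := LinftyM hF hkk.
have hk2 := Linfty_sqr hkk.
have hg : Linfty (fun z => G ^+ 2 * (k' z - k z) ^+ 2) by apply: LinftyM => //; exact: Linfty_cst.
apply: (@le_trans _ _ (\int[(p \x q)%E]_z (F z * (k' z - k z)) ^+ 2)).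
  exact: section_var_le.
rewrite /X -RintZl//; apply: le_Rint => //; first exact: Linfty_sqr.
move=> z; rewrite exprMn ler_wpM2r ?sqr_ge0// -real_normK ?num_real//.
by rewrite lerXn2r ?nnegrE// (le_trans _ (FG z)).
Qed.

(** Three errors are separated: the new operator applied to [g' - g], the change of kernel at fixed
    [g], and the replacement of [Q] by [q] for the old kernel. Jensen's inequality and the exact
    second marginal of [k'] bound the first without loss. *)
Lemma perturb_kernel_op (g g' : T -> R) (G : R) : Linfty g -> Linfty g' ->
  (forall y, `|g y| <= G) ->
  \int[p]_x ((kernel_op k' q g' x - kernel_op k Q g x) ^+ 2) <=
  3 * (\int[q]_y ((g' y - g y) ^+ 2) + G ^+ 2 * X +
       section_var p q (fun z => k z * g z.2 - kernel_op k Q g z.1)).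
Proof.
move=> hg hg' gG; have [_ k'dl k'1 k'2] := kk'.
have k'0 z : 0 <= k' z by exact: le_trans (ltW dl0) (k'dl z).
have hgg := LinftyB hg' hg; have hgg2 := Linfty_sqr hgg.
have hA := Linfty_kernel_op Q hk hg.
have hF : Linfty (fun z : T * T => g z.2) by exact: Linfty_snd.
have hS : Linfty (fun z : T * T => k z * g z.2 - kernel_op k Q g z.1).
  by apply: LinftyB; [exact: LinftyM|exact: (Linfty_comp (@measurable_fst _ _ T T) hA)].
have hFk : Linfty (fun z : T * T => g z.2 * (k' z - k z)) by exact: LinftyM.
pose a x := kernel_op k' q (fun y => g' y - g y) x.
pose b x := \int[q]_y (g y * (k' (x, y) - k (x, y))).
pose c x := \int[q]_y (k (x, y) * g y - kernel_op k Q g x).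
have ha : Linfty a by exact: Linfty_kernel_op.
have hb : Linfty b by exact: (Linfty_int2 q hFk).
have hc : Linfty c by exact: (Linfty_int2 q hS).
have E x : kernel_op k' q g' x - kernel_op k Q g x = a x + b x + c x.
  rewrite /a kernel_opB//.
  have h1 := LinftyM (Linfty_section1 x hk) hg; have h2 := LinftyM (Linfty_section1 x hk') hg.
  have -> : b x = kernel_op k' q g x - \int[q]_y (k (x, y) * g y).
    rewrite /kernel_op -RintB//; apply: eq_Rint => y; by ring.
  have -> : c x = \int[q]_y (k (x, y) * g y) - kernel_op k Q g x.
    by rewrite /c (RintB _ h1 (Linfty_cst _ _)) Rintegral_cstT.
  by generalize (kernel_op k' q g' x) (kernel_op k' q g x) (kernel_op k Q g x) (\int[q]_y (k (x, y) * g y)) => ? ? ? ?; ring.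
have h3 : Linfty (fun x => 3 * (a x ^+ 2 + b x ^+ 2 + c x ^+ 2)).
  apply: LinftyM; first exact: Linfty_cst.
  by apply: LinftyD; [apply: LinftyD|]; exact: Linfty_sqr.
have hL : Linfty (fun x => (kernel_op k' q g' x - kernel_op k Q g x) ^+ 2).
  by apply: Linfty_sqr; apply: LinftyB => //; exact: Linfty_kernel_op.
apply: (@le_trans _ _ (\int[p]_x (3 * (a x ^+ 2 + b x ^+ 2 + c x ^+ 2)))).
  by apply: le_Rint => // x; rewrite E; exact: sqr3.
have ha2 := Linfty_sqr ha; have hb2 := Linfty_sqr hb; have hc2 := Linfty_sqr hc.
rewrite (RintZl _ _ (LinftyD (LinftyD ha2 hb2) hc2)) ler_wpM2l//.
rewrite (RintD _ (LinftyD ha2 hb2) hc2) (RintD _ ha2 hb2); apply: lerD => //.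
apply: lerD; last by apply: (perturb_int hF) => z; exact: gG.
rewrite -(kernel_op_mean q hk' k'2 hgg2); apply: le_Rint => //.
  exact: Linfty_kernel_op.
by move=> x; apply: weighted_sqr => //; exact: Linfty_section1.
Qed.

Lemma perturb_section (F : T * T -> R) (G : R) : Linfty F -> (forall z, `|F z| <= G) ->
  \int[p]_x ((\int[q]_y (F (x, y) * k' (x, y)) - \int[Q]_y (F (x, y) * k (x, y))) ^+ 2) <=
  3 * (G ^+ 2 * X +
       section_var p q (fun z => F z * k z - \int[Q]_y (F (z.1, y) * k (z.1, y)))).
Proof.
move=> hF FG; have hFk := LinftyM hF hk; have hFk' := LinftyM hF hk'.
have hA := Linfty_int2 Q hFk.
have hS : Linfty (fun z : T * T => F z * k z - \int[Q]_y (F (z.1, y) * k (z.1, y))).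
  by apply: LinftyB => //; exact: (Linfty_comp (@measurable_fst _ _ T T) hA).
pose b x := \int[q]_y (F (x, y) * (k' (x, y) - k (x, y))).
pose c x := \int[q]_y (F (x, y) * k (x, y) - \int[Q]_y (F (x, y) * k (x, y))).
have hb : Linfty b by exact: (Linfty_int2 q (LinftyM hF hkk)).
have hc : Linfty c by exact: (Linfty_int2 q hS).
have E x : \int[q]_y (F (x, y) * k' (x, y)) - \int[Q]_y (F (x, y) * k (x, y)) = 0 + b x + c x.
  have h1 := Linfty_section1 x hFk; have h2 := Linfty_section1 x hFk'.
  have -> : b x = \int[q]_y (F (x, y) * k' (x, y)) - \int[q]_y (F (x, y) * k (x, y)).
    rewrite -RintB//; apply: eq_Rint => y; by ring.
  have -> : c x = \int[q]_y (F (x, y) * k (x, y)) - \int[Q]_y (F (x, y) * k (x, y)).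
    by rewrite /c (RintB _ h1 (Linfty_cst _ _)) Rintegral_cstT.
  by generalize (\int[q]_y (F (x, y) * k' (x, y))) (\int[q]_y (F (x, y) * k (x, y))) (\int[Q]_y (F (x, y) * k (x, y))) => ? ? ?; ring.
have hb2 := Linfty_sqr hb; have hc2 := Linfty_sqr hc.
have h3 : Linfty (fun x => 3 * (b x ^+ 2 + c x ^+ 2)).
  by apply: LinftyM; [exact: Linfty_cst|exact: LinftyD].
have hL : Linfty (fun x => (\int[q]_y (F (x, y) * k' (x, y)) - \int[Q]_y (F (x, y) * k (x, y))) ^+ 2).
  by apply: Linfty_sqr; apply: LinftyB => //; exact: (Linfty_int2 q hFk').
apply: (@le_trans _ _ (\int[p]_x (3 * (b x ^+ 2 + c x ^+ 2)))).
  by apply: le_Rint => // x; rewrite E (le_trans (sqr3 _ _ _))// expr0n/= add0r.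
rewrite (RintZl _ _ (LinftyD hb2 hc2)) ler_wpM2l// (RintD _ hb2 hc2) lerD//.
exact: perturb_int.
Qed.

End kernel_perturbation.

Lemma Rint_transpose d (T : measurableType d) (R : realType) (p q : probability T R)
    (h : T * T -> R) : Linfty h ->
  \int[(q \x p)%E]_z transpose h z = \int[(p \x q)%E]_z h z.
Proof. by move=> hh; rewrite (Rint_prod2 _ _ hh) (Rint_prod1 _ _ (Linfty_swap hh)). Qed.

Section consistency.
Context d (W : measurableType d) (R : realType) (Pr : probability W R) (rho : nat -> R).
Context d' (T : measurableType d').
Variables (P Q : probability T R) (k e : T * T -> R) (dl B : R).
Variables (p q : nat -> W -> probability T R) (k' : nat -> W -> T * T -> R).
Hypotheses (dl0 : 0 < dl) (kk : is_kernel dl k P Q)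
  (kk' : forall j w, is_kernel dl (k' j w) (p j w) (q j w))
  (he : Linfty e) (eB : forall z, `|e z| <= B).
Notation vanishing := (vanishing Pr rho).
(** The probabilistic inputs. Under transposition [vk] keeps its form and [v1], [v2] are exchanged,
    so the section can be applied to both variances. *)
Hypotheses
  (vk : vanishing (fun j w => \int[(p j w \x q j w)%E]_z ((k' j w z - k z) ^+ 2)))
  (v1 : forall h, Linfty h -> (forall x, \int[Q]_y h (x, y) = 0) ->
    vanishing (fun j w => section_var (p j w) (q j w) h))
  (v2 : forall h, Linfty h -> (forall x, \int[P]_y h (x, y) = 0) ->
    vanishing (fun j w => section_var (q j w) (p j w) h))
  (vm : forall g, Linfty g -> \int[P]_x g x = 0 ->
    vanishing (fun j w => (\int[p j w]_x g x) ^+ 2)).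

Let hk : Linfty k. Proof. by case: kk. Qed.
Let hk' j w : Linfty (k' j w). Proof. by case: (kk' j w). Qed.
Let hkt : Linfty (transpose k). Proof. exact: Linfty_swap. Qed.
Let hek : Linfty (fun z => e z * k z). Proof. exact: LinftyM. Qed.
Let het : Linfty (transpose e). Proof. exact: Linfty_swap. Qed.
Let ktk := is_kernel_transpose kk.
Let ktk' j w := is_kernel_transpose (kk' j w).

Let vkt : vanishing (fun j w =>
  \int[(q j w \x p j w)%E]_z ((transpose (k' j w) z - transpose k z) ^+ 2)).
Proof.
apply: vanishing_le vk => j w.
rewrite -(Rint_transpose (p j w) (q j w) (h := fun z => (k' j w z - k z) ^+ 2))//.
by apply: Linfty_sqr; exact: LinftyB.
Qed.

Let vanishing_centred1 (h : T * T -> R) : Linfty h -> vanishing (fun j w =>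
  section_var (p j w) (q j w) (fun z => h z - \int[Q]_y h (z.1, y))).
Proof.
move=> hh; apply: v1 => [|x].
  apply: LinftyB => //; exact: (Linfty_comp (@measurable_fst _ _ T T) (Linfty_int2 Q hh)).
by rewrite /= (RintB _ (Linfty_section1 x hh) (Linfty_cst _ _)) Rintegral_cstT subrr.
Qed.

Let vanishing_centred2 (h : T * T -> R) : Linfty h -> vanishing (fun j w =>
  section_var (q j w) (p j w) (fun z => h z - \int[P]_y h (z.1, y))).
Proof.
move=> hh; apply: v2 => [|x].
  apply: LinftyB => //; exact: (Linfty_comp (@measurable_fst _ _ T T) (Linfty_int2 P hh)).
by rewrite /= (RintB _ (Linfty_section1 x hh) (Linfty_cst _ _)) Rintegral_cstT subrr.
Qed.

Let vanishing_op (g : T -> R) (g' : nat -> W -> T -> R) : Linfty g ->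
  (forall j w, Linfty (g' j w)) ->
  vanishing (fun j w => \int[q j w]_y ((g' j w y - g y) ^+ 2)) ->
  vanishing (fun j w => \int[p j w]_x
    ((kernel_op (k' j w) (q j w) (g' j w) x - kernel_op k Q g x) ^+ 2)).
Proof.
move=> hg hg' vg; have [_ [G gG]] := hg.
have hgs : Linfty (fun z : T * T => k z * g z.2).
  by apply: LinftyM => //; exact: (Linfty_comp (@measurable_snd _ _ T T) hg).
apply: vanishing_le (fun j w => perturb_kernel_op dl0 kk (kk' j w) hg (hg' j w) gG) _.
apply: vanishingZ => //; apply: vanishingD; last exact: (vanishing_centred1 hgs).
by apply: vanishingD => //; apply: vanishingZ => //; exact: sqr_ge0.
Qed.

Let vanishing_opt (g : T -> R) (g' : nat -> W -> T -> R) : Linfty g ->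
  (forall j w, Linfty (g' j w)) ->
  vanishing (fun j w => \int[p j w]_y ((g' j w y - g y) ^+ 2)) ->
  vanishing (fun j w => \int[q j w]_x
    ((kernel_op (transpose (k' j w)) (p j w) (g' j w) x - kernel_op (transpose k) P g x) ^+ 2)).
Proof.
move=> hg hg' vg; have [_ [G gG]] := hg.
have hgs : Linfty (fun z : T * T => transpose k z * g z.2).
  by apply: LinftyM => //; exact: (Linfty_comp (@measurable_snd _ _ T T) hg).
apply: vanishing_le (fun j w => perturb_kernel_op dl0 ktk (ktk' j w) hg (hg' j w) gG) _.
apply: vanishingZ => //; apply: vanishingD; last exact: (vanishing_centred2 hgs).
by apply: vanishingD => //; apply: vanishingZ => //; exact: sqr_ge0.
Qed.

Let sqr2 (a b : R) : (a - b) ^+ 2 <= 2 * (a ^+ 2 + b ^+ 2).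
Proof. by have := sqr_ge0 (a + b); rewrite !expr2; lra. Qed.

Let vanishing_sub (p0 : nat -> W -> probability T R) (a a' b b' : nat -> W -> T -> R) :
  (forall j w, Linfty (a j w)) -> (forall j w, Linfty (a' j w)) ->
  (forall j w, Linfty (b j w)) -> (forall j w, Linfty (b' j w)) ->
  vanishing (fun j w => \int[p0 j w]_x ((a' j w x - a j w x) ^+ 2)) ->
  vanishing (fun j w => \int[p0 j w]_x ((b' j w x - b j w x) ^+ 2)) ->
  vanishing (fun j w => \int[p0 j w]_x
    ((a' j w x - b' j w x - (a j w x - b j w x)) ^+ 2)).
Proof.
move=> ha ha' hb hb' va vb; apply: vanishing_le (vanishingZ (ler0n _ 2) (vanishingD va vb)) => j w.
have h1 := Linfty_sqr (LinftyB (ha' j w) (ha j w)).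
have h2 := Linfty_sqr (LinftyB (hb' j w) (hb j w)).
rewrite -(RintD _ h1 h2) -(RintZl _ _ (LinftyD h1 h2)); apply: le_Rint.
- by apply: Linfty_sqr; apply: LinftyB; exact: LinftyB.
- by apply: LinftyM; [exact: Linfty_cst|exact: LinftyD].
by move=> x; apply: le_trans (sqr2 _ _); rewrite le_eqVlt; apply/orP; left; apply/eqP; ring.
Qed.

Let vanishing_source : vanishing (fun j w => \int[p j w]_x
  ((side_source (k' j w) e (p j w) (q j w) x - side_source k e P Q x) ^+ 2)).
Proof.
have hek' j w : Linfty (fun z => e z * k' j w z) by exact: LinftyM.
have hyt j w := Linfty_int1 (p j w) (hek' j w).
have hy := Linfty_int1 P hek; have hx := Linfty_int2 Q hek.
have vy : vanishing (fun j w => \int[q j w]_y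
    ((\int[p j w]_x (e (x, y) * k' j w (x, y)) - \int[P]_x (e (x, y) * k (x, y))) ^+ 2)).
  have etB z : `|transpose e z| <= B by exact: eB.
  apply: vanishing_le (fun j w => perturb_section ktk (ktk' j w) het etB) _.
  apply: vanishingZ => //; apply: vanishingD; first by apply: vanishingZ => //; exact: sqr_ge0.
  exact: (vanishing_centred2 (Linfty_swap hek)).
apply: (@vanishing_sub p
  (fun j w x => \int[Q]_y (e (x, y) * k (x, y)))
  (fun j w x => \int[q j w]_y (e (x, y) * k' j w (x, y)))
  (fun j w => kernel_op k Q (fun y => \int[P]_x (e (x, y) * k (x, y))))
  (fun j w => kernel_op (k' j w) (q j w) (fun y => \int[p j w]_x (e (x, y) * k' j w (x, y))))).
- by [].
- by move=> j w; exact: (Linfty_int2 (q j w) (hek' j w)).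
- by move=> j w; exact: Linfty_kernel_op.
- by move=> j w; exact: Linfty_kernel_op.
- apply: vanishing_le (fun j w => perturb_section kk (kk' j w) he eB) _.
  apply: vanishingZ => //; apply: vanishingD; first by apply: vanishingZ => //; exact: sqr_ge0.
  exact: (vanishing_centred1 hek).
- exact: (vanishing_op hy hyt vy).
Qed.

Let vanishing_iter n : vanishing (fun j w => \int[p j w]_x
  ((side_iter (k' j w) e (p j w) (q j w) n x - side_iter k e P Q n x) ^+ 2)).
Proof.
elim: n => [|n ih]; first exact: vanishing_source.
have hi := Linfty_side_iter kk he n.
have hi' j w := Linfty_side_iter (kk' j w) he n.
apply: (@vanishing_op (kernel_op (transpose k) P (side_iter k e P Q n))
  (fun j w => kernel_op (transpose (k' j w)) (p j w) (side_iter (k' j w) e (p j w) (q j w) n))).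
- exact: Linfty_kernel_op.
- by move=> j w; apply: Linfty_kernel_op => //; exact: Linfty_swap.
- exact: vanishing_opt.
Qed.

Let partial n x := \sum_(i < n) side_iter k e P Q i x.
Let partial' j w n x := \sum_(i < n) side_iter (k' j w) e (p j w) (q j w) i x.

Let Linfty_partial n : Linfty (partial n).
Proof. by apply: Linfty_sum => i; exact: (Linfty_side_iter kk he). Qed.

Let Linfty_partial' j w n : Linfty (partial' j w n).
Proof. by apply: Linfty_sum => i; exact: (Linfty_side_iter (kk' j w) he). Qed.

Let vanishing_partial n : vanishing (fun j w => \int[p j w]_x
  ((partial' j w n x - partial n x) ^+ 2)).
Proof.
elim: n => [|n ih].
  exists 0, (fun _ _ => 0); split => // [j w|j].
    rewrite (@eq_Rint _ _ _ _ _ (fun=> 0)) ?Rintegral_cstT// => x.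
    by rewrite /partial /partial' !big_ord0 subrr expr0n.
  by rewrite Rintegral_cstT mul0r.
have := @vanishing_sub p (fun _ _ => partial n) (fun j w => partial' j w n)
  (fun j w x => - side_iter k e P Q n x)
  (fun j w x => - side_iter (k' j w) e (p j w) (q j w) n x) => h.
have hi := Linfty_side_iter kk he n.
have hi' j w := Linfty_side_iter (kk' j w) he n.
apply: vanishing_le (h _ _ _ _ ih _).
- move=> j w; rewrite le_eqVlt; apply/orP; left; apply/eqP; apply: eq_Rint => x.
  by rewrite /partial /partial' !big_ord_recr/= !opprK.
- by move=> *.
- by move=> *.
- by move=> *; exact: LinftyN.
- by move=> *; exact: LinftyN.
- apply: vanishing_le (vanishing_iter n) => j w.
  rewrite le_eqVlt; apply/orP; left; apply/eqP; apply: eq_Rint => x.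
  by rewrite -sqrrN; congr (_ ^+ 2); ring.
Qed.

Let vanishing_Var (g : T -> R) : Linfty g ->
  vanishing (fun j w => (Var (p j w) g - Var P g) ^+ 2).
Proof.
move=> hg; have hg2 := Linfty_sqr hg; have [_ [G gG]] := hg.
pose a := \int[P]_x (g x ^+ 2); pose m := \int[P]_x g x.
have ha : Linfty (fun x => g x ^+ 2 - a) by apply: LinftyB => //; exact: Linfty_cst.
have hm : Linfty (fun x => g x - m) by apply: LinftyB => //; exact: Linfty_cst.
have va := vm ha; have vm' := vm hm.
have {}va : vanishing (fun j w => (\int[p j w]_x (g x ^+ 2 - a)) ^+ 2).
  by apply: va; rewrite (RintB _ hg2 (Linfty_cst _ _)) Rintegral_cstT subrr.
have {}vm' : vanishing (fun j w => (\int[p j w]_x (g x - m)) ^+ 2).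
  by apply: vm'; rewrite (RintB _ hg (Linfty_cst _ _)) Rintegral_cstT subrr.
have c0 : 0 <= (2 * G) ^+ 2 by exact: sqr_ge0.
apply: vanishing_le (vanishingZ (ler0n _ 2) (vanishingD va (vanishingZ c0 vm'))) => j w.
rewrite (VarE (p j w) hg) (VarE P hg) -/a -/m.
rewrite (RintB _ hg2 (Linfty_cst _ _)) (RintB _ hg (Linfty_cst _ _)) !Rintegral_cstT.
have b1 : `|m| <= G by exact: Rint_norm_le.
have b2 : `|\int[p j w]_x g x| <= G by exact: Rint_norm_le.
move: b1 b2; generalize (\int[p j w]_x g x) (\int[p j w]_x (g x ^+ 2)) m a => u v m' a' b1 b2.
have -> : v - u ^+ 2 - (a' - m' ^+ 2) = (v - a') - (u + m') * (u - m') by ring.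
apply: le_trans (sqr2 _ _) _; rewrite ler_wpM2l// lerD2l exprMn ler_wpM2r ?sqr_ge0//.
rewrite -real_normK ?num_real// lerXn2r ?nnegrE//.
  by rewrite mulr_ge0// (le_trans _ b1).
by rewrite (le_trans (ler_normD _ _))// mulr2n mulrDl mul1r lerD.
Qed.

(** The tolerance fixes a number [n] of terms beyond which the geometric tails are negligible for
    all samples at once. Only sums of [n] terms are then compared, with constants that may depend on
    [n]; the growth of [N] matters only through eventually exceeding [n]. *)
Lemma cvg_side_var (N : nat -> option nat) : rho j @[j --> \oo] --> (0 : R) ->
  cvg_to_infinity N ->
  (forall j, measurable_fun setT (fun w => side_var (k' j w) e (p j w) (q j w) (N j))) ->
  cvg_in_probability Pr (fun j w => side_var (k' j w) e (p j w) (q j w) (N j))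
    (side_limit k e P Q).
Proof.
move=> rho0 hN mV; apply: (cvg_in_probability_vanishing rho0) => // ee ee0.
pose L := 2 * B / dl; pose r := 1 - dl.
have [h1 h2 h3 h4] := kk.
have r01 : 0 <= r < 1 by rewrite subr_ge0 (dl_le1 h1 h2 h3)/= gtrBl.
have hr : 24 * L ^+ 2 * r ^+ n @[n --> \oo] --> (0 : R).
  by rewrite -(mulr0 (24 * L ^+ 2)); apply: cvgMr; exact: cvg_expr0.
have ee2 : 0 < ee / 2 by exact: divr_gt0.
(* The constant [24] adds the empirical tail [16] and the population tail [8]. *)
have /cvgn_epsP/(_ _ ee2)[n /(_ n (leqnn n))] := hr; rewrite subr0 => hn.
have {}hn := le_trans (ler_norm _) hn.
have [K _ hK] := hN n.
pose S1 j w := (Var (p j w) (partial n) - Var P (partial n)) ^+ 2.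
pose S2 j w := \int[p j w]_x ((partial' j w n x - partial n x) ^+ 2).
pose B' := n%:R * (2 * B).
have pB x : `|partial n x| <= B'.
  rewrite (le_trans (ler_norm_sum _ _ _))// /B' -[n in n%:R]card_ord mulr_natl -sumr_const.
  by apply: ler_sum => i _; exact: (side_iter_norm dl0 kk he eB).
have pB' j w x : `|partial' j w n x| <= B'.
  rewrite (le_trans (ler_norm_sum _ _ _))// /B' -[n in n%:R]card_ord mulr_natl -sumr_const.
  by apply: ler_sum => i _; exact: (side_iter_norm dl0 (kk' j w) he eB).
exists (fun j w => 2 * ((4 * B') ^+ 2 * S2 j w + S1 j w)), ((ee / 2) ^+ 2), K; split.
- apply: vanishingZ => //; apply: vanishingD; last exact: vanishing_Var.
  by apply: vanishingZ; [exact: sqr_ge0|exact: vanishing_partial].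
- exact: exprn_gt0.
move=> j Kj w; set V' := side_var _ _ _ _ _; set V := side_limit _ _ _ _ => eV.
have t1 : `|V' - Var (p j w) (partial' j w n)| <= 16 * L ^+ 2 * r ^+ n.
  apply: (side_var_tail dl0 (kk' j w) he eB).
  by have := hK j Kj; rewrite /=; case: (N j) => // i /leqW.
have t2 : `|Var P (partial n) - V| <= 8 * L ^+ 2 * r ^+ n by exact: (side_limit_tail dl0 kk he eB).
have D2 : `|Var (p j w) (partial' j w n) - Var (p j w) (partial n)| ^+ 2 <= (4 * B') ^+ 2 * S2 j w.
  exact: (Var_dist_le (p j w) (Linfty_partial' j w n) (Linfty_partial n) (pB' j w) pB).
rewrite /S1; move: t1 t2 D2 eV hn; rewrite real_normK ?num_real//.
generalize (S2 j w) V' V (Var (p j w) (partial' j w n)) (Var (p j w) (partial n)) (Var P (partial n)).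
generalize ((4 * B') ^+ 2) => b s x1 x5 x2 x3 x4.
have -> : 24 * L ^+ 2 * r ^+ n = 16 * L ^+ 2 * r ^+ n + 8 * L ^+ 2 * r ^+ n by ring.
generalize (16 * L ^+ 2 * r ^+ n) (8 * L ^+ 2 * r ^+ n) => y1 y2 t1 t2 D2 eV hn.
have h : ee / 2 <= `|x2 - x4|.
  have : `|x1 - x5| <= y1 + `|x2 - x4| + y2.
    rewrite (_ : x1 - x5 = (x1 - x2) + (x2 - x4) + (x4 - x5)); last by ring.
    by rewrite (le_trans (ler_normD _ _))// lerD// (le_trans (ler_normD _ _))// lerD.
  by move=> /(le_trans eV); move: hn; lra.
have h' : (ee / 2) ^+ 2 <= (x2 - x4) ^+ 2.
  by rewrite -[leRHS]real_normK ?num_real// lerXn2r ?nnegrE// ltW.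
apply: le_trans h' _; rewrite (_ : x2 - x4 = (x2 - x3) - (x4 - x3)); last by ring.
apply: le_trans (sqr2 _ _) _; rewrite ler_wpM2l// lerD//.
by rewrite -sqrrN opprB.
Qed.

End consistency.


(** * Lindeberg's theorem by heat smoothing *)

#[local] Transparent Rintegral.
Section expR_remainders.
Context (R : realType).
Implicit Types x D t : R.

Lemma expR_partial_sum_le x n : 0 <= x -> \sum_(k < n) x ^+ k / k`!%:R <= expR x.
Proof.
move=> x0; have := is_cvg_series_exp_coeff x; rewrite -/(expR x) => hc.
have hl : series (exp_coeff x) n @[n --> \oo] --> expR x by exact: hc.
have nd : nondecreasing_seq (series (exp_coeff x)).
  apply/nondecreasing_seqP => k; rewrite /series/= big_nat_recr//= lerDl.
  exact: exp_coeff_ge0.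
have := nondecreasing_cvgn_le nd hc n.
rewrite /series/= big_mkord => /le_trans; apply.
by rewrite le_eqVlt; apply/orP; left; apply/eqP.
Qed.

(** Term [i + 3] of the series is at most [|D| ^+ 3] times term [i] of the series of [exp |D|],
    because [(i + 3)! >= i!]. *)
Lemma expR_taylor3 D : `|expR D - (1 + D + D ^+ 2 / 2)| <= `|D| ^+ 3 * expR `|D|.
Proof.
have hl : series (exp_coeff D) n @[n --> \oo] --> expR D by exact: is_cvg_series_exp_coeff.
have hs : series (exp_coeff D) (n + 3)%N @[n --> \oo] --> expR D.
  by rewrite (cvg_shiftn 3 (series (exp_coeff D))).
apply: (cvgn_dist_le hs) => n /=.
rewrite /series/= big_mkord addnC big_split_ord/= !big_ord_recl big_ord0/= /exp_coeff/=.
set p := (X in X + \sum_(i < n) _ - _).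
have -> : p = 1 + D + D ^+ 2 / 2.
  by rewrite (_ : p = 1 / 1 + (D ^+ 1 / 1 + (D ^+ 2 / 2 + 0)))// !divr1 expr1 addr0 addrA.
rewrite [X in `|X - _|]addrC addrK (le_trans (ler_norm_sum _ _ _))//.
apply: le_trans (ler_wpM2l (exprn_ge0 3 (normr_ge0 D)) (expR_partial_sum_le n (normr_ge0 D))).
rewrite mulr_sumr; apply: ler_sum => i _.
rewrite exprD -mulrA normrM normrX normrM normrX ler_wpM2l ?exprn_ge0//.
rewrite ler_wpM2l ?exprn_ge0// normfV normr_nat lef_pV2 ?posrE ?ltr0n ?fact_gt0// ler_nat.
by rewrite leq_fact// leq_addl.
Qed.

(** Up to the factor 2, the first exponential is the density ratio of a Gaussian shifted by [e]
    standard deviations to one of four times the variance, whence [t ^+ 2 / 8]. The factor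
    [exp (- 3 t^2 / 8)] that splits off dominates the polynomials and exponentials in [t] of the
    remainder, and [7 = 6 + 1] collects its two parts. *)
Lemma gauss_shift_remainder t (e : R) : `|e| <= 1 ->
  `|expR (- (t - e) ^+ 2 / 2 + t ^+ 2 / 8) -
    expR (- (3 / 8 * t ^+ 2)) * (1 + t * e + (t ^+ 2 - 1) * e ^+ 2 / 2)| <=
  7 * expR 4 * `|e| ^+ 3.
Proof.
move=> e1; set D := t * e - e ^+ 2 / 2; set a := `|t| + 2^-1.
have -> : - (t - e) ^+ 2 / 2 + t ^+ 2 / 8 = - (3 / 8 * t ^+ 2) + D by rewrite /D; field.
rewrite expRD -mulrBr normrM (ger0_norm (expR_ge0 _)).
have e0 := normr_ge0 e; have t0 := normr_ge0 t.
have a0 : 0 <= a by rewrite addr_ge0// invr_ge0.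
have ee : `|e| ^+ 2 <= `|e| by rewrite expr2 ler_piMr.
have De : `|D| <= `|e| * a.
  rewrite (le_trans (ler_normB _ _))// normrM normrM normrX (@ger0_norm _ 2^-1) ?invr_ge0//.
  by rewrite /a mulrDr mulrC lerD2l ler_wpM2r ?invr_ge0.
have Da : `|D| <= a by rewrite (le_trans De)// ler_piMl.
have tri : `|expR D - (1 + t * e + (t ^+ 2 - 1) * e ^+ 2 / 2)| <=
    `|e| ^+ 3 * (a ^+ 3 * expR a) + `|e| ^+ 3 * a.
  rewrite -[X in `|X|](subrK (expR D - (1 + D + D ^+ 2 / 2))) addrC.
  rewrite (le_trans (ler_normD _ _))// lerD//.
    rewrite (le_trans (expR_taylor3 D))// mulrA -exprMn ler_pM ?expR_ge0 ?exprn_ge0//.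
      by rewrite lerXn2r ?nnegrE// mulr_ge0.
    by rewrite ler_expR.
  have -> : expR D - (1 + t * e + (t ^+ 2 - 1) * e ^+ 2 / 2) - (expR D - (1 + D + D ^+ 2 / 2)) =
      e ^+ 3 * (e / 8 - t / 2) by rewrite /D; field.
  rewrite normrM normrX ler_wpM2l ?exprn_ge0// (le_trans (ler_normB _ _))//.
  rewrite !normrM (@ger0_norm _ 2^-1) ?invr_ge0// (@ger0_norm _ 8^-1) ?invr_ge0//.
  by rewrite /a; move: (`|e|) (`|t|) e0 t0 e1 => u w *; lra.
have a3 : a ^+ 3 <= 6 * expR a.
  have := expR_ge1Dxn 2 a0; rewrite -(ler_pM2l (ltr0Sn R 5)).
  have -> : 6 * (1 + a ^+ 3 / 3`!%:R) = 6 + a ^+ 3.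
    by rewrite (_ : (3`!)%N = 6)//; field.
  by move: (a ^+ 3) (6 * expR a) => u w; lra.
have a1 : a <= expR a * expR a.
  have h1 := expR_ge1Dx a; have h2 : 1 <= expR a by rewrite -expR0 ler_expR.
  have : expR a <= expR a * expR a by rewrite ler_peMr ?expR_ge0.
  by move: (expR a) (expR a * expR a) h1 => u w; lra.
apply: (@le_trans _ _ (expR (- (3 / 8 * t ^+ 2)) * (`|e| ^+ 3 * (7 * (expR a * expR a))))).
  rewrite ler_wpM2l ?expR_ge0// (le_trans tri)// -mulrDr ler_wpM2l ?exprn_ge0//.
  have : a ^+ 3 * expR a <= 6 * (expR a * expR a) by rewrite mulrA ler_wpM2r ?expR_ge0.
  by move: a1; move: (a ^+ 3 * expR a) (expR a * expR a) => u w; lra.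
rewrite mulrCA mulrC ler_wpM2r ?exprn_ge0// mulrCA ler_wpM2l// -!expRD ler_expR.
have tt : t ^+ 2 = `|t| ^+ 2 by rewrite real_normK ?num_real.
rewrite tt /a; have := sqr_ge0 (3 / 8 * `|t| - 1); move: (`|t|) => u; lra.
Qed.

(** The analogue for multiplying the variance by [1 + s], with normalization [ln (1 + s) / 2]. The
    bound on [s] keeps the growth [exp (s * a)], quadratic in [t] in the exponent, below the
    Gaussian factor; [72 = 64 + 8]. *)
Lemma gauss_dilation_remainder t (s : R) : 0 <= s <= 8^-1 ->
  `|expR (- t ^+ 2 / (2 * (1 + s)) + t ^+ 2 / 8 - ln (1 + s) / 2) -
    expR (- (3 / 8 * t ^+ 2)) * (1 + (t ^+ 2 - 1) * s / 2)| <= 72 * expR 1 * s ^+ 2.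
Proof.
move=> /andP[s0 s8]; have s1 : 0 < 1 + s by lra.
pose l := ln (1 + s); pose q := s / (1 + s); pose a := (t ^+ 2 + 1) / 2.
have t2 : 0 <= t ^+ 2 by exact: sqr_ge0.
have a0 : 0 <= a by rewrite /a; lra.
have qE : 1 - (1 + s)^-1 = q by rewrite /q; field; rewrite gt_eqF.
have q0 : 0 <= q by rewrite divr_ge0// ltW.
have ls : l <= s by rewrite /l; apply: le_ln1Dx; lra.
have ql : q <= l.
  rewrite -qE; have : ln ((1 + s)^-1) <= (1 + s)^-1 - 1.
    rewrite -{1}[(1 + s)^-1](subrK 1) addrC; apply: le_ln1Dx.
    by have is0 : 0 < (1 + s)^-1; [rewrite invr_gt0|lra].
  by rewrite lnV ?posrE// -/l; lra.
have qs : s - q <= s ^+ 2.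
  have -> : s - q = s ^+ 2 / (1 + s) by rewrite /q; field; rewrite gt_eqF.
  by rewrite ler_pdivrMr// ler_peMr ?sqr_ge0//; lra.
set D := t ^+ 2 * q / 2 - l / 2.
have -> : - t ^+ 2 / (2 * (1 + s)) + t ^+ 2 / 8 - ln (1 + s) / 2 = - (3 / 8 * t ^+ 2) + D.
  by rewrite /D -/l -qE; field; rewrite gt_eqF.
rewrite expRD -mulrBr normrM (ger0_norm (expR_ge0 _)).
have tq0 : 0 <= t ^+ 2 * q by rewrite mulr_ge0.
have tq : t ^+ 2 * q <= t ^+ 2 * s by rewrite ler_wpM2l//; lra.
have tqs : t ^+ 2 * s - t ^+ 2 * q <= t ^+ 2 * s ^+ 2 by rewrite -mulrBr ler_wpM2l.
have Da : `|D| <= s * a.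
  rewrite /D /a (_ : s * ((t ^+ 2 + 1) / 2) = (t ^+ 2 * s + s) / 2); last by field.
  by rewrite ler_norml; apply/andP; split; lra.
have sa : s * a <= a / 8 by rewrite mulrC ler_wpM2l.
have tri : `|expR D - (1 + (t ^+ 2 - 1) * s / 2)| <=
    s ^+ 2 * (a ^+ 2 * expR (a / 8)) + s ^+ 2 * a.
  rewrite -[X in `|X|](subrK (expR D - 1 - D)) addrC (le_trans (ler_normD _ _))// lerD//.
    rewrite (le_trans (expR_taylor2 D))// mulrA -exprMn -(real_normK (num_real D)).
    rewrite ler_pM ?expR_ge0 ?exprn_ge0//.
      by rewrite lerXn2r ?nnegrE// mulr_ge0.
    by rewrite ler_expR (le_trans Da).
  have -> : expR D - (1 + (t ^+ 2 - 1) * s / 2) - (expR D - 1 - D) =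
      (s - l) / 2 - (t ^+ 2 * s - t ^+ 2 * q) / 2 by rewrite /D; field.
  rewrite /a.
  have -> : s ^+ 2 * ((t ^+ 2 + 1) / 2) = (t ^+ 2 * s ^+ 2 + s ^+ 2) / 2 by field.
  by rewrite ler_norml; apply/andP; split; lra.
have a1 : a <= 8 * expR (a / 8) by have := expR_ge1Dx (a / 8); lra.
have ea : 0 <= expR (a / 8) by exact: expR_ge0.
have a2 : a ^+ 2 <= 64 * (expR (a / 8) * expR (a / 8)).
  by rewrite (_ : 64 * _ = (8 * expR (a / 8)) ^+ 2); [rewrite lerXn2r ?nnegrE// mulr_ge0|ring].
have e1 : 1 <= expR (a / 8) by rewrite -expR0 ler_expR divr_ge0.
apply: (@le_trans _ _ (expR (- (3 / 8 * t ^+ 2)) * (s ^+ 2 * (72 * expR (3 / 8 * a))))).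
  rewrite ler_wpM2l ?expR_ge0// (le_trans tri)// -mulrDr ler_wpM2l ?sqr_ge0//.
  have -> : 3 / 8 * a = a / 8 + a / 8 + a / 8 by field.
  rewrite !expRD; move: (expR (a / 8)) a1 ea a2 e1 => y h1 h2 h3 h4.
  have h5 : a ^+ 2 * y <= 64 * (y * y) * y by rewrite ler_wpM2r.
  have h6 : y <= y * y by rewrite ler_peMr.
  have h7 : y * y <= y * y * y by rewrite ler_peMr// mulr_ge0.
  by move: h5 h6 h7; move: (a ^+ 2 * y) (y * y) => u w; rewrite -mulrA; move: (w * y) => r; lra.
rewrite mulrCA mulrC ler_wpM2r ?sqr_ge0// mulrCA ler_wpM2l// -expRD ler_expR /a.
by move: t2; move: (t ^+ 2) => u; lra.
Qed.

End expR_remainders.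

(** * Gaussian smoothing written against one reference Gaussian *)

Section heat.
Context (R : realType).
Implicit Types (h : R -> R) (v w x y : R).
Notation mu := lebesgue_measure.
Local Notation BR := (measurableTypeR R).

Definition heat h v x := \int[normal_prob x (Num.sqrt v)]_y h y.

Lemma Rint_normal_prob (m s : R) (h : BR -> R) : s != 0 -> Linfty h ->
  \int[normal_prob m s]_y h y = \int[mu]_y (h y * normal_pdf m s y).
Proof.
move=> s0 hh; have [mh _] := hh.
have dom := normal_prob_dominates m s.
have ip : mu.-integrable setT (EFin \o normal_pdf m s) by exact: integrable_normal_pdf.
have ae : ae_eq mu setT
    (Radon_Nikodym (charge_of_finite_measure (normal_prob m s)) mu) (EFin \o normal_pdf m s).
  apply: integral_ae_eq => //.
  - by apply: Radon_Nikodym_integrable.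
  - exact: measurable_int ip.
  - by move=> E _ mE; rewrite -Radon_Nikodym_integral.
rewrite /Rintegral -(Radon_Nikodym_change_of_variables dom)//; last first.
  exact: (Linfty_integrable (normal_prob m s)).
congr fine; apply: ae_eq_integral => //.
- apply: emeasurable_funM; first exact/measurable_EFinP.
  by apply: measurable_int; apply: Radon_Nikodym_integrable.
- apply/measurable_EFinP; apply: measurable_funM => //; exact: measurable_normal_pdf.
- by apply: filterS ae => x /= + _ => /(_ I) ->; rewrite EFinM.
Qed.

Lemma Rint_normal_ratio (m s m' s' : R) (h rho : BR -> R) : s != 0 -> s' != 0 ->
  Linfty h -> Linfty rho -> (forall y, normal_pdf m s y = rho y * normal_pdf m' s' y) ->
  \int[normal_prob m s]_y h y = \int[normal_prob m' s']_y (h y * rho y).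
Proof.
move=> s0 s'0 hh hr E; rewrite (Rint_normal_prob m s0 hh) (Rint_normal_prob m' s'0 (LinftyM hh hr)).
by congr fine; apply: eq_integral => y _; rewrite E mulrA.
Qed.

Lemma normal_peak_sqrt v w : 0 < v -> 0 < w ->
  normal_peak (Num.sqrt w) = Num.sqrt v / Num.sqrt w * normal_peak (Num.sqrt v).
Proof.
move=> v0 w0; rewrite /normal_peak !sqr_sqrtr ?ltW//.
have p0 : 0 < pi *+ 2 :> R by rewrite mulrn_wgt0// pi_gt0.
rewrite -!mulrnAr !sqrtrM ?ltW//.
have := p0; rewrite -sqrtr_gt0; have := v0; rewrite -sqrtr_gt0; have := w0; rewrite -sqrtr_gt0.
move=> h1 h2 h3; field.
by rewrite !gt_eqF.
Qed.

Definition std x v y := (y - x) / Num.sqrt v.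
(** The density of the Gaussian of variance [v] with respect to the one of variance [4 * v], both
    centred at [x]. *)
Definition gauss_weight x v y := 2 * expR (- (3 / 8 * (std x v y) ^+ 2)).

Lemma measurable_std x v : measurable_fun [set: BR] (std x v : BR -> R).
Proof. by apply: measurable_funM => //; exact: measurable_funB. Qed.

Lemma Linfty_std_fun x v (f : R -> R) (K : R) : measurable_fun [set: BR] (f : BR -> R) ->
  (forall t, `|f t| <= K) -> Linfty (fun y : BR => f (std x v y)).
Proof.
move=> mf fK; split; last by exists K.
exact: (measurableT_comp (f := f : BR -> R) mf (measurable_std x v)).
Qed.

Lemma Linfty_shift_weight x v (e : R) : Linfty (fun y : BR =>
  2 * expR (- (std x v y - e) ^+ 2 / 2 + (std x v y) ^+ 2 / 8)).
Proof.
apply: (@LinftyM _ _ _ (fun=> 2)); first exact: Linfty_cst.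
apply: (@Linfty_std_fun x v (fun t => expR (- (t - e) ^+ 2 / 2 + t ^+ 2 / 8)) (expR (e ^+ 2))).
  apply: measurableT_comp => //; apply: measurable_funD; last exact: measurable_funM.
  apply: measurable_funM => //; apply: measurableT_comp => //.
  by apply: measurable_funX; exact: measurable_funB.
move=> t; rewrite ger0_norm ?expR_ge0// ler_expR.
have -> : - (t - e) ^+ 2 / 2 + t ^+ 2 / 8 = e ^+ 2 - (3 * t - 4 * e) ^+ 2 / 24 - 5 / 6 * e ^+ 2.
  by field.
have := sqr_ge0 (3 * t - 4 * e); have := sqr_ge0 e; move: (_ ^+ 2) (_ ^+ 2) => a b; lra.
Qed.

Lemma Linfty_dilation_weight x v (s : R) : 0 <= s <= 8^-1 -> Linfty (fun y : BR =>
  2 * expR (- (std x v y) ^+ 2 / (2 * (1 + s)) + (std x v y) ^+ 2 / 8 - ln (1 + s) / 2)).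
Proof.
move=> /andP[s0 s8]; have s1 : 0 < 1 + s by lra.
apply: (@LinftyM _ _ _ (fun=> 2)); first exact: Linfty_cst.
apply: (@Linfty_std_fun x v (fun t => expR (- t ^+ 2 / (2 * (1 + s)) + t ^+ 2 / 8 - ln (1 + s) / 2)) 1).
  apply: measurableT_comp => //; apply: measurable_funB => //.
  apply: measurable_funD; last exact: measurable_funM.
  by apply: measurable_funM => //; exact: measurableT_comp.
move=> t; rewrite ger0_norm ?expR_ge0// -[leRHS]expR0 ler_expR.
have l0 : 0 <= ln (1 + s) by rewrite ln_ge0// lerDl.
have : t ^+ 2 / 8 <= t ^+ 2 / (2 * (1 + s)).
  by rewrite ler_wpM2l ?sqr_ge0// lef_pV2 ?posrE//; [lra|rewrite mulr_gt0].
by rewrite mulNr; move: (_ / (2 * _)) (_ / 8) => u r; lra.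
Qed.

Lemma shift_weight_le x v y (e : R) : `|e| <= 1 ->
  `|2 * expR (- (std x v y - e) ^+ 2 / 2 + (std x v y) ^+ 2 / 8) -
    2 * (expR (- (3 / 8 * (std x v y) ^+ 2)) *
      (1 + std x v y * e + ((std x v y) ^+ 2 - 1) * e ^+ 2 / 2))| <= 14 * expR 4 * `|e| ^+ 3.
Proof.
move=> e1; rewrite -mulrBr normrM (@ger0_norm _ 2)//.
have := gauss_shift_remainder (std x v y) e1.
by move: (`|_ - _|) (expR 4) => r q; move: (`|e| ^+ 3) => b; rewrite -!mulrA; move: (q * b) => b'; lra.
Qed.

Lemma dilation_weight_le x v y (s : R) : 0 <= s <= 8^-1 ->
  `|2 * expR (- (std x v y) ^+ 2 / (2 * (1 + s)) + (std x v y) ^+ 2 / 8 - ln (1 + s) / 2) -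
    2 * (expR (- (3 / 8 * (std x v y) ^+ 2)) *
      (1 + std x v y * 0 + ((std x v y) ^+ 2 - 1) * s / 2))| <= 144 * expR 1 * s ^+ 2.
Proof.
move=> s08; rewrite -mulrBr normrM (@ger0_norm _ 2)// mulr0 addr0.
have := gauss_dilation_remainder (std x v y) s08.
by move: (`|_ - _|) (expR 1) => r q; move: (s ^+ 2) => b; rewrite -!mulrA; move: (q * b) => b'; lra.
Qed.

(** The reference has variance [4 * v] rather than [v] so that the density ratios are bounded: with
    equal variances a shift gives the unbounded factor [exp (t * e)]. All integrands thus stay in
    [Linfty]. *)
Lemma heat_shift h v x (e : R) : 0 < v -> Linfty (h : BR -> R) ->
  heat h v (x + e * Num.sqrt v) = \int[normal_prob x (Num.sqrt (4 * v))]_y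
    (h y * (2 * expR (- (std x v y - e) ^+ 2 / 2 + (std x v y) ^+ 2 / 8))).
Proof.
move=> v0 hh; have sv : 0 < Num.sqrt v by rewrite sqrtr_gt0.
have v4 : 0 < 4 * v by exact: mulr_gt0.
have s4 : Num.sqrt (4 * v) = 2 * Num.sqrt v.
  by rewrite sqrtrM// (_ : 4 = 2 ^+ 2) ?sqrtr_sqr ?ger0_norm//; ring.
have sv4 : 0 < Num.sqrt (4 * v) by rewrite sqrtr_gt0.
rewrite /heat; apply: Rint_normal_ratio => //; rewrite ?gt_eqF//.
  exact: Linfty_shift_weight.
move=> y; rewrite !normal_pdfE ?gt_eqF//.
rewrite (@normal_peak_sqrt (4 * v) v)// /normal_fun s4 mulrACA -expRD.
have -> : 2 * Num.sqrt v / Num.sqrt v = 2 by field; rewrite gt_eqF.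
congr (_ * expR _); rewrite /std.
by field; rewrite gt_eqF.
Qed.

Lemma heat_dilation h v x (s : R) : 0 < v -> 0 <= s <= 8^-1 -> Linfty (h : BR -> R) ->
  heat h (v * (1 + s)) x = \int[normal_prob x (Num.sqrt (4 * v))]_y
    (h y * (2 * expR (- (std x v y) ^+ 2 / (2 * (1 + s)) + (std x v y) ^+ 2 / 8 - ln (1 + s) / 2))).
Proof.
move=> v0 /andP[s0 s8] hh; have sv : 0 < Num.sqrt v by rewrite sqrtr_gt0.
have s1 : 0 < 1 + s by lra.
have v4 : 0 < 4 * v by exact: mulr_gt0.
have w0 : 0 < v * (1 + s) by exact: mulr_gt0.
have s4 : Num.sqrt (4 * v) = 2 * Num.sqrt v.
  by rewrite sqrtrM// (_ : 4 = 2 ^+ 2) ?sqrtr_sqr ?ger0_norm//; ring.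
have sv4 : 0 < Num.sqrt (4 * v) by rewrite sqrtr_gt0.
have sw : 0 < Num.sqrt (v * (1 + s)) by rewrite sqrtr_gt0.
have ss : Num.sqrt (1 + s) = expR (ln (1 + s) / 2).
  apply/eqP; rewrite -(eqrXn2 (n := 2)) ?expR_ge0 ?sqrtr_ge0// sqr_sqrtr ?ltW//.
  by rewrite expr2 -expRD -splitr lnK ?posrE.
rewrite /heat; apply: Rint_normal_ratio => //; rewrite ?gt_eqF//.
  by apply: Linfty_dilation_weight; rewrite s0.
move=> y; rewrite !normal_pdfE ?gt_eqF//.
rewrite (@normal_peak_sqrt (4 * v) (v * (1 + s)))// /normal_fun s4 mulrACA -expRD.
rewrite (@sqrtrM _ v) ?ltW// ss exprMn -expRM_natl.
rewrite (_ : expR (2%:R * _) = 1 + s); last by rewrite mulrC divfK// lnK ?posrE.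
have -> : 2 * Num.sqrt v / (Num.sqrt v * expR (ln (1 + s) / 2)) = 2 * expR (- (ln (1 + s) / 2)).
  by rewrite expRN; field; rewrite !gt_eqF// expR_gt0.
transitivity (2 * normal_peak (2 * Num.sqrt v) * (expR (- (ln (1 + s) / 2)) *
    expR (- (y - x) ^+ 2 / (Num.sqrt v ^+ 2 * (1 + s) *+ 2)))); first by rewrite mulrA [2 * normal_peak _ * _]mulrAC.
rewrite -expRD; congr (_ * expR _).
rewrite /std; field.
by rewrite !gt_eqF.
Qed.

End heat.

Section heat_expansion.
Context (R : realType) (h : R -> R) (H : R).
Local Notation BR := (measurableTypeR R).
Hypotheses (hh : Linfty (h : BR -> R)) (hH : forall y, `|h y| <= H).
Variables (v : R).
Hypothesis v0 : 0 < v.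

Let sv : 0 < Num.sqrt v. Proof. by rewrite sqrtr_gt0. Qed.
Let H0 : 0 <= H. Proof. exact: le_trans (hH 0). Qed.

(** The space derivative of [heat h v], with the derivative placed on the Gaussian density; [h] is
    only bounded and measurable. *)
Definition heat_d1 x : R := (Num.sqrt v)^-1 *
  \int[normal_prob x (Num.sqrt (4 * v))]_y (h y * (gauss_weight x v y * std x v y)).

Definition heat_d2 x : R := v^-1 *
  \int[normal_prob x (Num.sqrt (4 * v))]_y (h y * (gauss_weight x v y * ((std x v y) ^+ 2 - 1))).

Lemma heat_norm x w : `|heat h w x| <= H.
Proof. exact: (Rint_norm_le (normal_prob x (Num.sqrt w)) hh). Qed.

Let weight_sq (t : R) : expR (- (3 / 8 * t ^+ 2)) * t ^+ 2 <= 3.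
Proof.
have := expR_ge1Dx (3 / 8 * t ^+ 2); rewrite expRN => h1.
rewrite mulrC ler_pdivrMr ?expR_gt0//.
have key (a b : R) : 0 <= b -> 1 + 3 / 8 * b <= a -> b <= 3 * a by move=> *; lra.
exact: key (sqr_ge0 t) h1.
Qed.

Let wt (t : R) := 2 * expR (- (3 / 8 * t ^+ 2)).

Let wt_bounds t : [/\ `|wt t| <= 2, `|wt t * t| <= 8 & `|wt t * t ^+ 2| <= 6].
Proof.
have e0 := expR_ge0 (- (3 / 8 * t ^+ 2)).
have e1 : expR (- (3 / 8 * t ^+ 2)) <= 1.
  by rewrite -expR0 ler_expR oppr_le0 mulr_ge0// ?sqr_ge0// divr_ge0.
have key (e u : R) : 0 <= e -> e <= 1 -> e * u ^+ 2 <= 3 ->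
    [/\ `|2 * e| <= 2, `|2 * e * u| <= 8 & `|2 * e * u ^+ 2| <= 6].
  move=> h0 h1 h2; have h3 : 0 <= e * (u - 1) ^+ 2 by rewrite mulr_ge0 ?sqr_ge0.
  have h4 : 0 <= e * (u + 1) ^+ 2 by rewrite mulr_ge0 ?sqr_ge0.
  have h5 : 0 <= e * u ^+ 2 by rewrite mulr_ge0 ?sqr_ge0.
  rewrite (_ : e * (u - 1) ^+ 2 = e * u ^+ 2 - 2 * (e * u) + e) in h3; last by ring.
  rewrite (_ : e * (u + 1) ^+ 2 = e * u ^+ 2 + 2 * (e * u) + e) in h4; last by ring.
  rewrite -!mulrA !ler_norml; move: h2 h3 h4 h5; move: (e * u ^+ 2) (e * u) => x1 x2 *.
  by split; apply/andP; split; lra.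
exact: key e0 e1 (weight_sq t).
Qed.

Let mwt : measurable_fun [set: BR] (wt : BR -> R).
Proof.
apply: measurable_funM => //; apply: measurableT_comp => //.
by apply: measurableT_comp => //; exact: measurable_funM.
Qed.

Let hw0 x : Linfty (gauss_weight x v : BR -> R).
Proof. by apply: (@Linfty_std_fun _ x v wt 2) => // t; case: (wt_bounds t). Qed.

Let hw2 x : Linfty (fun y : BR => gauss_weight x v y * (std x v y) ^+ 2).
Proof.
apply: (@Linfty_std_fun _ x v (fun t => wt t * t ^+ 2) 6); last first.
  by move=> t; case: (wt_bounds t).
by apply: measurable_funM => //; exact: measurable_funX.
Qed.

Let hw1 x : Linfty (fun y : BR => gauss_weight x v y * std x v y).
Proof.
apply: (@Linfty_std_fun _ x v (fun t => wt t * t) 8); last first.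
  by move=> t; case: (wt_bounds t).
exact: measurable_funM.
Qed.

Let hw3 x : Linfty (fun y : BR => gauss_weight x v y * ((std x v y) ^+ 2 - 1)).
Proof.
have := LinftyB (hw2 x) (hw0 x); congr Linfty; apply/funext => y.
by rewrite mulrBr mulr1.
Qed.

Lemma gauss_weight_bounded x : [/\ Linfty (gauss_weight x v : BR -> R),
  forall y, `|gauss_weight x v y| <= 2 &
  forall y, `|gauss_weight x v y * std x v y ^+ 2| <= 6].
Proof. by split=> // y; case: (wt_bounds (std x v y)). Qed.

Lemma heat_d1_norm x : `|heat_d1 x| <= (Num.sqrt v)^-1 * (H * 8).
Proof.
rewrite /heat_d1 normrM normfV (ger0_norm (ltW sv)) ler_wpM2l ?invr_ge0 ?(ltW sv)//.
apply: Rint_norm_le => [|y]; first exact: LinftyM.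
rewrite normrM; apply: ler_pM => //.
by case: (wt_bounds (std x v y)).
Qed.

Lemma heat_d2_norm x : `|heat_d2 x| <= v^-1 * (H * 8).
Proof.
rewrite /heat_d2 normrM normfV (ger0_norm (ltW v0)) ler_wpM2l ?invr_ge0 ?(ltW v0)//.
apply: Rint_norm_le => [|y]; first exact: LinftyM.
rewrite normrM; apply: ler_pM => //; rewrite mulrBr mulr1 (le_trans (ler_normB _ _))//.
have [h1 _ h2] := wt_bounds (std x v y).
by rewrite (_ : 8 = 6 + 2)//; [exact: lerD|rewrite -natrD].
Qed.

(* The factor [std ^+ 2 - 1] in [heat_d2] serves both the second space derivative and the time derivative. *)
Let expand x (a b : R) :
  \int[normal_prob x (Num.sqrt (4 * v))]_y (h y *
    (2 * (expR (- (3 / 8 * (std x v y) ^+ 2)) * (1 + std x v y * a + ((std x v y) ^+ 2 - 1) * b / 2)))) =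
  heat h v x + a * Num.sqrt v * heat_d1 x + b * v / 2 * heat_d2 x.
Proof.
have E0 : heat h v x = \int[normal_prob x (Num.sqrt (4 * v))]_y (h y * gauss_weight x v y).
  have := heat_shift x 0 v0 hh; rewrite mul0r addr0 => ->; apply: eq_Rint => y.
  by rewrite subr0 /gauss_weight; congr (_ * (_ * expR _)); field.
have h0 := LinftyM hh (hw0 x); have h1 := LinftyM hh (hw1 x); have h2 := LinftyM hh (hw3 x).
rewrite E0 /heat_d1 /heat_d2.
have c1 (I : R) : a * Num.sqrt v * ((Num.sqrt v)^-1 * I) = a * I by field; rewrite gt_eqF.
have c2 (I : R) : b * v / 2 * (v^-1 * I) = b / 2 * I by field; rewrite gt_eqF.
rewrite c1 c2 -(RintZl _ a h1) -(RintZl _ (b / 2) h2).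
have h1a : Linfty (fun y : BR => a * (h y * (gauss_weight x v y * std x v y))).
  by apply: (@LinftyM _ _ _ (fun=> a)) => //; exact: Linfty_cst.
have h2a : Linfty (fun y : BR => b / 2 * (h y * (gauss_weight x v y * ((std x v y) ^+ 2 - 1)))).
  by apply: (@LinftyM _ _ _ (fun=> b / 2)) => //; exact: Linfty_cst.
rewrite -(RintD _ h0 h1a) -(RintD _ (LinftyD h0 h1a) h2a); apply: eq_Rint => y.
by rewrite /gauss_weight; field.
Qed.

Let Rint_dist_le (m : probability BR R) (k1 k2 : BR -> R) (K : R) :
  Linfty k1 -> Linfty k2 -> (forall y, `|k1 y - k2 y| <= K) ->
  `|\int[m]_y (h y * k1 y) - \int[m]_y (h y * k2 y)| <= H * K.
Proof.
move=> l1 l2 kK; rewrite -RintB; [|exact: LinftyM..].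
apply: Rint_norm_le; first by apply: LinftyB; exact: LinftyM.
by move=> y; rewrite -mulrBr normrM ler_pM.
Qed.

Let hexp x (a b : R) : Linfty (fun y : BR => 2 * (expR (- (3 / 8 * (std x v y) ^+ 2)) *
  (1 + std x v y * a + ((std x v y) ^+ 2 - 1) * b / 2))).
Proof.
have := LinftyD (LinftyD (hw0 x) (LinftyM (hw1 x) (Linfty_cst BR a)))
  (LinftyM (LinftyB (hw2 x) (hw0 x)) (Linfty_cst BR (b / 2))).
by congr Linfty; apply/funext => y; rewrite /gauss_weight; field.
Qed.

(** The hypothesis says that the shift is at most one standard deviation, the range of
    [gauss_shift_remainder]. Using nothing of [h] but its bound costs the power of [v] in the
    constant. *)
Lemma heat_taylor (x e : R) : e ^+ 2 <= v ->
  `|heat h v (x + e) - heat h v x - e * heat_d1 x - e ^+ 2 / 2 * heat_d2 x| <=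
  H * (14 * expR 4 / Num.sqrt v ^+ 3) * `|e| ^+ 3.
Proof.
move=> ev; pose a := e / Num.sqrt v.
have ea : e = a * Num.sqrt v by rewrite /a divfK ?gt_eqF.
have a1 : `|a| <= 1.
  rewrite /a normrM normfV (ger0_norm (ltW sv)) ler_pdivrMr// mul1r.
  by rewrite -sqrtr_sqr ler_sqrt// ltW.
have e2 : e ^+ 2 = a ^+ 2 * v by rewrite ea exprMn sqr_sqrtr ?ltW.
have key (A B C D : R) : A - B - e * C - e ^+ 2 / 2 * D = A - (B + e * C + e ^+ 2 / 2 * D) by ring.
have E := expand x a (a ^+ 2); rewrite -ea -e2 in E.
have Es := heat_shift x a v0 hh; rewrite -ea in Es.
rewrite key -E Es.
have -> : H * (14 * expR 4 / Num.sqrt v ^+ 3) * `|e| ^+ 3 = H * (14 * expR 4 * `|a| ^+ 3).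
  have -> : `|a| = `|e| / Num.sqrt v by rewrite /a normrM normfV (ger0_norm (ltW sv)).
  move: sv; generalize (expR 4 : R) `|e| (Num.sqrt v) => x1 x2 x3 x30.
  by field; rewrite gt_eqF.
apply: Rint_dist_le; [exact: Linfty_shift_weight|exact: hexp|].
by move=> y; exact: shift_weight_le a1.
Qed.

Lemma heat_time (x s : R) : 0 <= s <= v / 8 ->
  `|heat h (v + s) x - heat h v x - s / 2 * heat_d2 x| <= H * (144 * expR 1 / v ^+ 2) * s ^+ 2.
Proof.
move=> /andP[s0 s8]; pose a := s / v.
have sa : s = a * v by rewrite /a divfK ?gt_eqF.
have a0 : 0 <= a by rewrite divr_ge0// ltW.
have a8 : a <= 8^-1 by rewrite /a ler_pdivrMr// mulrC.
have va : v + s = v * (1 + a) by rewrite sa; ring.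
have key (A B C D : R) : A - B - s / 2 * D = A - (B + 0 * Num.sqrt v * C + s / 2 * D) by ring.
have a08 : 0 <= a <= 8^-1 by rewrite a0.
have E := expand x 0 a; rewrite -sa in E.
rewrite (key _ _ (heat_d1 x)) -E va (heat_dilation x v0 a08 hh).
have -> : H * (144 * expR 1 / v ^+ 2) * s ^+ 2 = H * (144 * expR 1 * a ^+ 2).
  by rewrite /a; generalize (expR 1 : R) => x1; field; rewrite gt_eqF.
apply: Rint_dist_le; [exact: Linfty_dilation_weight|exact: hexp|].
by move=> y; exact: dilation_weight_le a08.
Qed.

End heat_expansion.

Section heat_regularity.
Context (R : realType) (h : R -> R) (H : R).
Local Notation BR := (measurableTypeR R).
Hypotheses (hh : Linfty (h : BR -> R)) (hH : forall y, `|h y| <= H).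

Let H0 : 0 <= H. Proof. exact: le_trans (hH 0). Qed.

Lemma heat_lipschitz v : 0 < v -> exists2 K, 0 <= K & forall x e : R, e ^+ 2 <= v -> `|e| <= 1 ->
  `|heat h v (x + e) - heat h v x| <= `|e| * K.
Proof.
move=> v0; have sv : 0 < Num.sqrt v by rewrite sqrtr_gt0.
pose c := H * (14 * expR 4 / Num.sqrt v ^+ 3).
pose a1 := (Num.sqrt v)^-1 * (H * 8); pose a2 := v^-1 * (H * 8).
have c0 : 0 <= c by rewrite !mulr_ge0 ?invr_ge0 ?exprn_ge0 ?expR_ge0 ?(ltW sv).
have a10 : 0 <= a1 by rewrite !mulr_ge0 ?invr_ge0 ?(ltW sv).
have a20 : 0 <= a2 by rewrite !mulr_ge0 ?invr_ge0 ?(ltW v0).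
exists (a1 + a2 + c) => [|x e ev e1]; first by rewrite !addr_ge0.
have := heat_taylor hh hH v0 x ev; rewrite -/c.
have := heat_d1_norm hh hH v0 x; rewrite -/a1; have := heat_d2_norm hh hH v0 x; rewrite -/a2.
move: (heat_d1 _ _ _) (heat_d2 _ _ _) (heat _ _ _) (heat _ _ _) => d1 d2 u u'.
move=> h2 h1 h3; have e0 := normr_ge0 e.
have e2 : `|e| ^+ 2 <= `|e| by rewrite expr2 ler_piMr.
have e3 : c * `|e| ^+ 3 <= `|e| * c.
  by rewrite mulrC ler_wpM2r// exprS ler_piMr// exprn_ile1.
have h1' : `|e * d1| <= `|e| * a1 by rewrite normrM ler_wpM2l.
have h2' : `|e ^+ 2 / 2 * d2| <= `|e| * a2.
  rewrite normrM ler_pM// normrM normrX (@ger0_norm _ 2^-1) ?invr_ge0//.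
  by rewrite (le_trans _ e2)// ler_piMr ?exprn_ge0// invf_le1// ler1n.
rewrite !mulrDr; move: h1' h2' (le_trans h3 e3); rewrite !ler_norml.
move: (e * d1) (e ^+ 2 / 2 * d2) (`|e| * a1) (`|e| * a2) (`|e| * c) => x1 x2 x3 x4 x5.
by move=> /andP[? ?] /andP[? ?] /andP[? ?]; apply/andP; split; lra.
Qed.

Lemma Linfty_heat (v : R) : 0 < v -> Linfty (heat h v : BR -> R).
Proof.
move=> v0; split; last by exists H => x; exact: (heat_norm hh hH x v).
apply: continuous_measurable_fun => x; have [K K0 hK] := heat_lipschitz v0.
apply/cvgrPdist_le => e e0.
have K1 : 0 < K + 1 by rewrite ltr_wpDl.
apply/nbhs_ballP; exists (Num.min (e / (K + 1)) (Num.min 1 v)) => /=.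
  by rewrite !lt_min divr_gt0//= ltr01.
move=> y; rewrite /ball/= distrC !lt_min => /and3P[/ltW yd /ltW y1 /ltW yv].
have y2 : (y - x) ^+ 2 <= v.
  by rewrite -real_normK ?num_real// expr2 (le_trans _ yv)// ler_piMr.
have xy : x + (y - x) = y :> R by rewrite addrC subrK.
have hxy := hK x (y - x) y2 y1; rewrite xy in hxy; rewrite distrC; apply: le_trans hxy _.
apply: (@le_trans _ _ (`|y - x| * (K + 1))); first by rewrite ler_wpM2l// lerDl.
by rewrite -ler_pdivlMr.
Qed.

(** Measurability comes from the heat equation: [heat_d2] is the limit of twice the time difference
    quotients of [heat], which is continuous in space. *)
Lemma Linfty_heat_d2 (v : R) : 0 < v -> Linfty (heat_d2 h v : BR -> R).
Proof.
move=> v0; split; last by exists (v^-1 * (H * 8)) => x; exact: heat_d2_norm.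
pose s n : R := v / 8 / n.+1%:R.
have s0 n : 0 < s n by rewrite !divr_gt0.
have sv n : s n <= v / 8 by rewrite /s ler_pdivrMr// ler_peMr ?ler1n// divr_ge0// ltW.
pose u n x := 2 / s n * (heat h (v + s n) x - heat h v x).
apply: (@measurable_fun_cvg _ _ _ _ u) => //.
  move=> n; apply: measurable_funM => //; apply: measurable_funB.
    by case: (Linfty_heat (addr_gt0 v0 (s0 n))).
  by case: (Linfty_heat v0).
move=> x _; pose c := H * (144 * expR 1 / v ^+ 2) * 2.
have c0 : 0 <= c by rewrite !mulr_ge0 ?invr_ge0 ?exprn_ge0 ?expR_ge0 ?(ltW v0).
have bd n : `|u n x - heat_d2 h v x| <= c * s n.
  have s01 : 0 <= s n <= v / 8 by rewrite sv ltW.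
  have := heat_time hh hH v0 x s01; rewrite /u.
  move: (heat_d2 _ _ _) (heat _ _ _) (heat _ _ _) => d2 u1 u2.
  have -> : 2 / s n * (u2 - u1) - d2 = 2 / s n * (u2 - u1 - s n / 2 * d2).
    by field; rewrite gt_eqF.
  have p2 : 0 <= 2 / s n by rewrite divr_ge0// ltW.
  rewrite normrM (@ger0_norm _ (2 / s n) p2) => hb.
  apply: le_trans (ler_wpM2l p2 hb) _.
  rewrite /c le_eqVlt; apply/orP; left; apply/eqP.
  by generalize (H * (144 * expR 1 / v ^+ 2)) => q; field; rewrite gt_eqF.
have sn0 : c * s n @[n --> \oo] --> (0 : R).
  have -> : 0 = c * (v / 8 * 0) by rewrite !mulr0.
  by apply: cvgMr; apply: cvgMr; exact: cvg_harmonic.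
by apply/subr_cvg0; exact: cvgn_squeeze0 bd sn0.
Qed.

Lemma Linfty_heat_d1 (v : R) : 0 < v -> Linfty (heat_d1 h v : BR -> R).
Proof.
move=> v0; split; last by exists ((Num.sqrt v)^-1 * (H * 8)) => x; exact: heat_d1_norm.
pose s n : R := Num.min 1 v / n.+1%:R.
have m0 : 0 < Num.min 1 v by rewrite lt_min ltr01.
have s0 n : 0 < s n by rewrite divr_gt0.
have sm n : s n <= Num.min 1 v by rewrite /s ler_pdivrMr// ler_peMr ?ler1n// ltW.
have s1 n : s n <= 1 by rewrite (le_trans (sm n))// ge_min lexx.
have sv n : s n ^+ 2 <= v.
  rewrite expr2 (@le_trans _ _ (s n))//; first by rewrite ler_piMr// ltW.
  by rewrite (le_trans (sm n))// ge_min lexx orbT.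
pose u n x := (s n)^-1 * (heat h v (x + s n) - heat h v x) - s n / 2 * heat_d2 h v x.
have mh : measurable_fun [set: BR] (heat h v : BR -> R) by case: (Linfty_heat v0).
apply: (@measurable_fun_cvg _ _ _ _ u) => //.
  have md2 : measurable_fun [set: BR] (heat_d2 h v : BR -> R) by case: (Linfty_heat_d2 v0).
  have mc (r : R) : measurable_fun [set: BR] (fun=> r) by exact: measurable_cst.
  have msh (r : R) : measurable_fun [set: BR] (fun x : BR => x + r).
    by apply: measurable_funD; [exact: measurable_id|exact: mc].
  move=> n; apply: measurable_funB; last exact: (measurable_funM (mc _) md2).
  exact: (measurable_funM (mc _) (measurable_funB (measurableT_comp mh (msh (s n))) mh)).
move=> x _; pose c := H * (14 * expR 4 / Num.sqrt v ^+ 3).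
have c0 : 0 <= c by rewrite !mulr_ge0 ?invr_ge0 ?exprn_ge0 ?expR_ge0 ?sqrtr_ge0.
have bd n : `|u n x - heat_d1 h v x| <= c * s n.
  have := heat_taylor hh hH v0 x (sv n); rewrite -/c /u (ger0_norm (ltW (s0 n))).
  move: (heat_d2 _ _ _) (heat_d1 _ _ _) (heat _ _ _) (heat _ _ _) => d2 d1 u1 u2.
  have -> : (s n)^-1 * (u2 - u1) - s n / 2 * d2 - d1 =
      (s n)^-1 * (u2 - u1 - s n * d1 - s n ^+ 2 / 2 * d2) by field; rewrite gt_eqF.
  have p2 : 0 <= (s n)^-1 by rewrite invr_ge0 ltW.
  rewrite normrM (@ger0_norm _ (s n)^-1)// => hb.
  apply: le_trans (ler_wpM2l p2 hb) _.
  have -> : (s n)^-1 * (c * s n ^+ 3) = c * (s n * s n) by field; rewrite gt_eqF.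
  by rewrite ler_wpM2l// ler_piMr// ltW.
have sn0 : c * s n @[n --> \oo] --> (0 : R).
  have -> : 0 = c * (Num.min 1 v * 0) by rewrite !mulr0.
  by apply: cvgMr; apply: cvgMr; exact: cvg_harmonic.
by apply/subr_cvg0; exact: cvgn_squeeze0 bd sn0.
Qed.

End heat_regularity.

Section heat_approx.
Context (R : realType) (h : R -> R) (H : R).
Local Notation BR := (measurableTypeR R).
Hypotheses (hh : Linfty (h : BR -> R)) (hH : forall y, `|h y| <= H).

(** Away from [x] a Chebyshev bound is used, [1 <= std ^+ 2 * (v / dl ^+ 2)]; the weight times
    [std ^+ 2] is at most 6 and [h] varies by at most [2 * H], whence 12. *)
Lemma heat_approx (x v e dl : R) : 0 < v -> 0 < dl -> 0 <= e ->
  (forall y, `|y - x| <= dl -> `|h y - h x| <= e) ->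
  `|heat h v x - h x| <= e + 12 * H * (v / dl ^+ 2).
Proof.
move=> v0 dl0 e0 hc; have H0 : 0 <= H by exact: le_trans (hH 0).
have w0 y : 0 <= gauss_weight x v y by rewrite mulr_ge0 ?expR_ge0.
have heatE (k : R -> R) : Linfty (k : BR -> R) ->
    heat k v x = \int[normal_prob x (Num.sqrt (4 * v))]_y (k y * gauss_weight x v y).
  move=> hk; have := heat_shift x 0 v0 hk; rewrite mul0r addr0 => ->; apply: eq_Rint => y.
  by rewrite subr0 /gauss_weight; congr (_ * (_ * expR _)); field.
have hw : Linfty (gauss_weight x v : BR -> R).
  by have [+ _ _] := gauss_weight_bounded v x.
have h1 : Linfty (fun y : BR => h y * gauss_weight x v y) by exact: LinftyM.
have h2 : Linfty (fun y : BR => h x * gauss_weight x v y) by apply: LinftyM => //; exact: Linfty_cst.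
have h3 : Linfty (fun y : BR => e * gauss_weight x v y) by apply: LinftyM => //; exact: Linfty_cst.
have w1 : \int[normal_prob x (Num.sqrt (4 * v))]_y gauss_weight x v y = 1.
  rewrite -[RHS](Rintegral_cstT (normal_prob x (Num.sqrt v)) 1).
  rewrite -[RHS]/(heat (fun=> 1) v x) (heatE _ (Linfty_cst _ _)).
  by apply: eq_Rint => y; rewrite mul1r.
have -> : heat h v x - h x =
    \int[normal_prob x (Num.sqrt (4 * v))]_y (h y * gauss_weight x v y - h x * gauss_weight x v y).
  by rewrite (RintB _ h1 h2) (RintZl _ (h x) hw) w1 mulr1 heatE.
have -> : e + 12 * H * (v / dl ^+ 2) =
    \int[normal_prob x (Num.sqrt (4 * v))]_y (e * gauss_weight x v y + 12 * H * (v / dl ^+ 2)).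
  by rewrite (RintD _ h3 (Linfty_cst _ _)) (RintZl _ e hw) w1 mulr1 Rintegral_cstT.
apply: le_trans (le_norm_Rint _ (LinftyB h1 h2)) _; apply: le_Rint.
- exact: Linfty_norm (LinftyB h1 h2).
- exact: LinftyD h3 (Linfty_cst _ _).
move=> y; rewrite -mulrBl normrM (ger0_norm (w0 y)).
have vd : 0 <= v / dl ^+ 2 by rewrite divr_ge0 ?exprn_ge0 ?(ltW v0) ?(ltW dl0).
have [yd|yd] := leP `|y - x| dl.
  apply: ler_wpDr; first by apply: mulr_ge0 => //; exact: mulr_ge0.
  by apply: ler_wpM2r => //; exact: hc.
apply: ler_wpDl; first exact: mulr_ge0.
have hb : `|h y - h x| <= 2 * H by rewrite (le_trans (ler_normB _ _))// mulr2n mulrDl mul1r lerD.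
have ht : 1 <= (std x v y) ^+ 2 * (v / dl ^+ 2).
  have -> : (std x v y) ^+ 2 * (v / dl ^+ 2) = (y - x) ^+ 2 / dl ^+ 2.
    rewrite /std exprMn exprVn sqr_sqrtr ?ltW// -mulrA [v^-1 * _]mulrA mulVf ?mul1r//.
    by rewrite gt_eqF.
  rewrite ler_pdivlMr ?exprn_gt0// mul1r -(real_normK (num_real (y - x))).
  by rewrite lerXn2r ?nnegrE ?(ltW dl0) ?(ltW yd).
have [_ _ hg] := gauss_weight_bounded v x.
apply: (@le_trans _ _ (2 * H * (gauss_weight x v y * (std x v y ^+ 2 * (v / dl ^+ 2))))).
  apply: (@le_trans _ _ (2 * H * gauss_weight x v y)); first exact: ler_wpM2r.
  by rewrite ler_wpM2l ?mulr_ge0// ler_peMr.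
have -> : 12 * H * (v / dl ^+ 2) = 2 * H * (6 * (v / dl ^+ 2)) by ring.
rewrite ler_wpM2l ?mulr_ge0// mulrA ler_wpM2r//.
exact: le_trans (ler_norm _) (hg y).
Qed.

End heat_approx.

(** * Replacement of the samples by heat steps *)

Section lindeberg.
Context d (W : measurableType d) (R : realType) (Pr : probability W R).
Context d' (T : measurableType d') (I : choiceType) (Z : I -> W -> T)
  (P_ : I -> probability T R).
Hypotheses (mZ : forall i, measurable_fun setT (Z i))
  (indep : mutual_independence Pr Z)
  (law : forall i A, measurable A -> Pr (Z i @^-1` A) = P_ i A).
Local Notation BR := (measurableTypeR R).
Variables (h : R -> R) (H : R).
Hypotheses (hh : Linfty (h : BR -> R)) (hH : forall y, `|h y| <= H).
Variables (f : I -> T -> R) (b ep : R).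
Hypotheses (hf : forall i, Linfty (f i)) (fb : forall i x, `|f i x| <= b)
  (f0 : forall i, \int[P_ i]_x f i x = 0) (ep0 : 0 < ep) (bep : b ^+ 2 <= ep / 8).

Let S (s : seq I) w := \sum_(i <- s) f i (Z i w).
Let tau i := \int[P_ i]_x (f i x ^+ 2).
Let c3 := H * (14 * expR 4 / Num.sqrt ep ^+ 3).
Let c4 := H * (144 * expR 1 / ep ^+ 2).

Let H0 : 0 <= H. Proof. exact: le_trans (hH 0). Qed.
Let tau0 i : 0 <= tau i. Proof. by apply: Rintegral_ge0 => x _; exact: sqr_ge0. Qed.
Let fb2 i x : f i x ^+ 2 <= b ^+ 2.
Proof.
by rewrite -real_normK ?num_real// lerXn2r ?nnegrE// (le_trans _ (fb i x)).
Qed.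
Let tau_le i : tau i <= b ^+ 2.
Proof. by apply: Rint_le_cst => //; exact: Linfty_sqr. Qed.

Let mS i s : i \notin s ->
  measurable_fun [set: g_sigma_algebraType (cylinders_off Z i)] (S s : _ -> BR).
Proof.
(* The sum is unchanged as [i] is not in [s], but now every summand, for arbitrary [j], is
   determined by samples other than [i]. *)
move=> si; rewrite (_ : S s = fun w => \sum_(j <- s) (if j == i then 0 else f j (Z j w))).
  apply: measurable_sum => j; case: eqP => [_|ji]; first exact: measurable_cst.
  apply: measurableT_comp; first by case: (hf j).
  by apply: measurable_past; apply/eqP.
apply/funext => w; apply: eq_big_seq => j js; case: eqP => // ji.
by move: si; rewrite -ji js.
Qed.

(** A centred summand of variance [tau i] is traded for a heat step of length [tau i]. By
    independence the first-order term has mean zero and the second-order one has the mean of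
    [tau i / 2 * heat_d2], the first-order effect of the heat step. The remainders use
    [|f|^3 <= b * f^2] and [tau^2 <= b^2 * tau], and [ep <= v] keeps their constants uniform. *)
Lemma lindeberg_step i s v : i \notin s -> ep <= v ->
  `|\int[Pr]_w heat h v (f i (Z i w) + S s w) - \int[Pr]_w heat h (v + tau i) (S s w)| <=
  (c3 + c4 * b) * b * tau i.
Proof.
move=> si epv; have v0 : 0 < v by exact: lt_le_trans epv.
have b0 : 0 <= b by exact: le_trans (fb i point).
have vt0 : 0 < v + tau i by rewrite ltr_wpDr.
have mS' : measurable_fun setT (S s : W -> BR).
  apply: (past_measurable_fun mZ indep law (i := i)); exact: mS.
have hU : Linfty (fun w => f i (Z i w)) := Linfty_comp (mZ i) (hf i).
have hcS (k : BR -> R) : Linfty k -> Linfty (fun w => k (S s w)) by exact: Linfty_comp.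
have h1 := hcS _ (Linfty_heat_d1 hh hH v0); have h2 := hcS _ (Linfty_heat_d2 hh hH v0).
have h0 := hcS _ (Linfty_heat hh hH v0); have ht := hcS _ (Linfty_heat hh hH vt0).
have hUS : Linfty (fun w => heat h v (f i (Z i w) + S s w)).
  have [mu _] := hU.
  by apply: (Linfty_comp _ (Linfty_heat hh hH v0)); exact: measurable_funD.
have c30 : 0 <= c3 by rewrite !mulr_ge0 ?invr_ge0 ?exprn_ge0 ?expR_ge0 ?sqrtr_ge0.
have c40 : 0 <= c4 by rewrite !mulr_ge0 ?invr_ge0 ?exprn_ge0 ?expR_ge0 ?(ltW ep0).
have cv3 : H * (14 * expR 4 / Num.sqrt v ^+ 3) <= c3.
  rewrite ler_wpM2l// ler_wpM2l ?mulr_ge0 ?expR_ge0//.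
  rewrite lef_pV2 ?posrE ?exprn_gt0 ?sqrtr_gt0// lerXn2r ?nnegrE ?sqrtr_ge0//.
  exact: ler_wsqrtr.
have cv4 : H * (144 * expR 1 / v ^+ 2) <= c4.
  rewrite ler_wpM2l// ler_wpM2l ?mulr_ge0 ?expR_ge0//.
  by rewrite lef_pV2 ?posrE ?exprn_gt0// lerXn2r ?nnegrE ?(ltW ep0) ?(ltW v0).
have v38 w : `|heat h v (f i (Z i w) + S s w) - heat h v (S s w) -
    f i (Z i w) * heat_d1 h v (S s w) - f i (Z i w) ^+ 2 / 2 * heat_d2 h v (S s w)| <=
    c3 * b * f i (Z i w) ^+ 2.
  have fv : f i (Z i w) ^+ 2 <= v.
    rewrite (le_trans (fb2 _ _))// (le_trans bep)//; move: epv ep0; lra.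
  rewrite addrC [_ + S s w]addrC addrC.
  apply: le_trans (heat_taylor hh hH v0 (S s w) fv) _.
  apply: le_trans (ler_wpM2r (exprn_ge0 3 (normr_ge0 (f i (Z i w)))) cv3) _.
  have f2 := real_normK (num_real (f i (Z i w))).
  rewrite -[in leRHS]f2 exprS mulrA; apply: ler_wpM2r; first exact: exprn_ge0.
  exact: ler_wpM2l.
have vt w : `|heat h (v + tau i) (S s w) - heat h v (S s w) - tau i / 2 * heat_d2 h v (S s w)| <=
    c4 * b ^+ 2 * tau i.
  have tv : 0 <= tau i <= v / 8.
    rewrite tau0 (le_trans (tau_le _))// (le_trans bep)// ler_wpM2r ?invr_ge0//.
  apply: le_trans (heat_time hh hH v0 (S s w) tv) _.
  apply: le_trans (ler_wpM2r (sqr_ge0 (tau i)) cv4) _.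
  by rewrite expr2 mulrA; apply: ler_wpM2r => //; exact: ler_wpM2l.
have e1 : \int[Pr]_w (heat_d1 h v (S s w) * f i (Z i w)) = 0.
  apply: (freeze0 mZ indep law (V := S s) (S := BR) (mS si)
     (F := fun z => heat_d1 h v z.1 * f i z.2)).
    apply: LinftyM; last exact: Linfty_snd.
    exact: (Linfty_comp (@measurable_fst _ _ BR T) (Linfty_heat_d1 hh hH v0)).
  by move=> x; rewrite /= RintZl ?f0 ?mulr0.
have e2 : \int[Pr]_w (heat_d2 h v (S s w) * (f i (Z i w) ^+ 2 - tau i)) = 0.
  have hft : Linfty (fun x => f i x ^+ 2 - tau i) by apply: LinftyB; [exact: Linfty_sqr|exact: Linfty_cst].
  apply: (freeze0 mZ indep law (V := S s) (S := BR) (mS si)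
     (F := fun z => heat_d2 h v z.1 * (f i z.2 ^+ 2 - tau i))).
    apply: LinftyM; last exact: (Linfty_comp (@measurable_snd _ _ BR T) hft).
    exact: (Linfty_comp (@measurable_fst _ _ BR T) (Linfty_heat_d2 hh hH v0)).
  move=> x; rewrite /= RintZl// RintB ?Rintegral_cstT ?subrr ?mulr0//.
  exact: Linfty_sqr.
have hU2 : Linfty (fun w => f i (Z i w) ^+ 2) by exact: Linfty_sqr.
have hft : Linfty (fun w => f i (Z i w) ^+ 2 - tau i) by apply: LinftyB => //; exact: Linfty_cst.
have hd1 := LinftyM h1 hU; have hd2 := LinftyM h2 hft.
have hd2' : Linfty (fun w => 2^-1 * (heat_d2 h v (S s w) * (f i (Z i w) ^+ 2 - tau i))).
  by apply: LinftyM => //; exact: Linfty_cst.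
rewrite -RintB//.
have E : \int[Pr]_w (heat h v (f i (Z i w) + S s w) - heat h (v + tau i) (S s w)) =
  \int[Pr]_w (heat h v (f i (Z i w) + S s w) - heat h (v + tau i) (S s w) -
     heat_d1 h v (S s w) * f i (Z i w) -
     2^-1 * (heat_d2 h v (S s w) * (f i (Z i w) ^+ 2 - tau i))).
  rewrite [RHS]RintB//; last by apply: LinftyB => //; exact: LinftyB.
  rewrite (RintB _ (LinftyB hUS ht) hd1) (RintZl _ _ hd2) e1 e2 mulr0 !subr0//.
rewrite E.
have hbig : Linfty (fun w => heat h v (f i (Z i w) + S s w) - heat h (v + tau i) (S s w) -
     heat_d1 h v (S s w) * f i (Z i w) -
     2^-1 * (heat_d2 h v (S s w) * (f i (Z i w) ^+ 2 - tau i))).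
  by apply: LinftyB => //; apply: LinftyB => //; exact: LinftyB.
have hb : Linfty (fun w => c3 * b * f i (Z i w) ^+ 2 + c4 * b ^+ 2 * tau i).
  by apply: LinftyD; [apply: LinftyM => //|]; exact: Linfty_cst.
apply: le_trans (le_norm_Rint _ hbig) _.
apply: (@le_trans _ _ (\int[Pr]_w (c3 * b * f i (Z i w) ^+ 2 + c4 * b ^+ 2 * tau i))).
  apply: le_Rint; [exact: Linfty_norm hbig|exact: hb|].
  have key (x1 x2 x3 x4 x5 y t B1 B2 : R) :
      `|x1 - x2 - y * x4 - y ^+ 2 / 2 * x5| <= B1 -> `|x3 - x2 - t / 2 * x5| <= B2 ->
      `|x1 - x3 - x4 * y - 2^-1 * (x5 * (y ^+ 2 - t))| <= B1 + B2.
    move=> l1 l2; have -> : x1 - x3 - x4 * y - 2^-1 * (x5 * (y ^+ 2 - t)) =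
      (x1 - x2 - y * x4 - y ^+ 2 / 2 * x5) - (x3 - x2 - t / 2 * x5) by field.
    by rewrite (le_trans (ler_normB _ _))// lerD.
  by move=> w; exact: key (v38 w) (vt w).
rewrite RintD; [|by apply: LinftyM => //; exact: Linfty_cst|exact: Linfty_cst].
rewrite RintZl// Rintegral_cstT (Rint_law mZ indep law i (Linfty_sqr (hf i))) -/(tau i).
rewrite le_eqVlt; apply/orP; left; apply/eqP.
by generalize (tau i) c3 c4 => *; ring.
Qed.

Lemma lindeberg s v : uniq s -> ep <= v ->
  `|\int[Pr]_w heat h v (S s w) - heat h (v + \sum_(i <- s) tau i) 0| <=
  (c3 + c4 * b) * b * \sum_(i <- s) tau i.
Proof.
(* The time [v] is generalized, since it grows by [tau i] with each sample removed. *)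
elim: s v => [|i s ih] v /=.
  move=> _ epv; rewrite (@eq_Rint _ _ _ _ _ (fun=> heat h v 0)); last by move=> w; rewrite /S big_nil.
  by rewrite Rintegral_cstT big_nil addr0 subrr normr0 mulr0.
move=> /andP[si us] epv; rewrite big_cons addrA.
have epv' : ep <= v + tau i by rewrite (le_trans epv)// lerDl.
have := ih _ us epv'; have := lindeberg_step si epv.
have -> : S (i :: s) = fun w => f i (Z i w) + S s w.
  by apply/funext => w; rewrite /S big_cons.
move=> l1 l2; rewrite mulrDr.
exact: le_trans (ler_distD (\int[Pr]_w heat h (v + tau i) (S s w)) _ _) (lerD l1 l2).
Qed.

End lindeberg.
#[local] Opaque Rintegral.


(** * From empirical moments to the normal limit *)

Section two_samples.
Context d (W : measurableType d) (R : realType) (Pr : probability W R).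
Context d' (T : measurableType d') (I : choiceType) (Z : I -> W -> T)
  (P_ : I -> probability T R).
Hypotheses (mZ : forall i, measurable_fun setT (Z i))
  (indep : mutual_independence Pr Z)
  (law : forall i A, measurable A -> Pr (Z i @^-1` A) = P_ i A).
Variables (s t : nat -> I) (P Q : probability T R) (n m : nat -> nat).
Hypotheses (sinj : injective s) (tinj : injective t) (st : forall i j, s i != t j).
Hypotheses (Ps : forall i, P_ (s i) = P) (Qt : forall j, P_ (t j) = Q).
Hypotheses (n0 : forall k, (0 < n k)%N) (m0 : forall k, (0 < m k)%N).

Let p k w := empirical R (n k) (fun i => Z (s i) w).
Let q k w := empirical R (m k) (fun j => Z (t j) w).
Let rho k : R := (n k)%:R^-1 + (m k)%:R^-1.

Let nK k : (n k)%:R^-1 <= rho k. Proof. by rewrite lerDl invr_ge0. Qed.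
Let mK k : (m k)%:R^-1 <= rho k. Proof. by rewrite lerDr invr_ge0. Qed.

Let hZZ i j (h : T * T -> R) : Linfty h -> Linfty (fun w => h (Z i w, Z j w)).
Proof. exact: (Linfty_comp (measurable_fun_pair (mZ i) (mZ j))). Qed.

Lemma section_var_empirical (h : T * T -> R) k w : Linfty h ->
  section_var (p k w) (q k w) h =
  (n k)%:R^-1 * \sum_(i < n k) ((m k)%:R^-1 * \sum_(j < m k) h (Z (s i) w, Z (t j) w)) ^+ 2.
Proof.
move=> hh; rewrite /section_var Rint_empirical//; last first.
  by apply: Linfty_sqr; exact: (Linfty_int2 (q k w) hh).
congr (_ * _); apply: eq_bigr => i _; congr (_ ^+ 2).
by rewrite Rint_empirical//; exact: (Linfty_section1 (Z (s i) w) hh).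
Qed.

Lemma vanishing_section_var (h : T * T -> R) : Linfty h ->
  (forall x, \int[Q]_y h (x, y) = 0) ->
  vanishing Pr rho (fun k w => section_var (p k w) (q k w) h).
Proof.
move=> hh h0; have [_ [B hB]] := hh.
pose F k i w := ((m k)%:R^-1 * \sum_(j < m k) h (Z (s i) w, Z (t j) w)) ^+ 2.
have hF k i : Linfty (F k i).
  apply: Linfty_sqr; apply: LinftyM; first exact: Linfty_cst.
  by apply: Linfty_sum => j; exact: hZZ.
exists (B ^+ 2), (fun k w => (n k)%:R^-1 * \sum_(i < n k) F k i w); split.
- by move=> k; apply: LinftyM; [exact: Linfty_cst|exact: Linfty_sum].
- by move=> k w; rewrite mulr_ge0 ?invr_ge0// sumr_ge0// => i _; exact: sqr_ge0.
- by move=> k w; rewrite section_var_empirical.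
move=> k; rewrite RintZl; last exact: Linfty_sum.
rewrite Rint_sum//; apply: (@le_trans _ _ (B ^+ 2 / (m k)%:R)); last first.
  by rewrite ler_wpM2l ?sqr_ge0.
rewrite mulrC ler_pdivrMr ?ltr0n// mulr_natr -[X in _ *+ X]card_ord -sumr_const.
apply: ler_sum => i _.
apply: (@sqr_mean_le _ _ _ _ _ _ _ _ _ mZ indep law (m k) (fun j : 'I_(m k) => t j) (s i)) => //.
- by move=> j1 j2 /tinj; exact: val_inj.
- by move=> j; rewrite eq_sym.
- by move=> j x; rewrite Qt.
Qed.

Lemma vanishing_mean (g : T -> R) : Linfty g -> \int[P]_x g x = 0 ->
  vanishing Pr rho (fun k w => (\int[p k w]_x g x) ^+ 2).
Proof.
move=> hg g0; have [_ [B gB]] := hg.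
exists (B ^+ 2), (fun k w => ((n k)%:R^-1 * \sum_(i < n k) g (Z (s i) w)) ^+ 2); split.
- move=> k; apply: Linfty_sqr; apply: LinftyM; first exact: Linfty_cst.
  by apply: Linfty_sum => j; exact: (Linfty_comp (mZ _) hg).
- by move=> k w; exact: sqr_ge0.
- by move=> k w; rewrite Rint_empirical.
move=> k; apply: (@le_trans _ _ (B ^+ 2 / (n k)%:R)); last first.
  by rewrite ler_wpM2l ?sqr_ge0.
apply: (@sqr_mean1_le _ _ _ _ _ _ _ _ _ mZ indep law (n k) (fun i : 'I_(n k) => s i)) => //.
- by move=> j1 j2 /sinj; exact: val_inj.
- by move=> j; rewrite Ps.
Qed.

(** The absolute value must be of order [rho], not merely its square. The second moment is of order
    [1 / (n m) <= rho ^+ 2], and Young's inequality with weight [rho] passes to the first moment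
    without a square root. *)
Lemma vanishing_degenerate (h : T * T -> R) : Linfty h ->
  (forall x, \int[Q]_y h (x, y) = 0) -> (forall y, \int[P]_x h (x, y) = 0) ->
  vanishing Pr rho (fun k w => `|\int[(p k w \x q k w)%E]_z h z|).
Proof.
move=> hh h0 h0'; have [_ [B hB]] := hh.
pose U k w := (n k)%:R^-1 * \sum_(i < n k) ((m k)%:R^-1 * \sum_(j < m k) h (Z (s i) w, Z (t j) w)).
have hU k : Linfty (U k).
  apply: LinftyM; first exact: Linfty_cst.
  apply: Linfty_sum => i; apply: LinftyM; first exact: Linfty_cst.
  by apply: Linfty_sum => j; exact: hZZ.
have rho0 k : 0 < rho k by rewrite addr_gt0// invr_gt0 ltr0n.
have hF k : Linfty (fun w => (rho k)^-1 * U k w ^+ 2).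
  by apply: LinftyM; [exact: Linfty_cst|exact: Linfty_sqr].
exists ((1 + B ^+ 2) / 2), (fun k w => (rho k + (rho k)^-1 * U k w ^+ 2) / 2); split.
- move=> k; apply: LinftyM; last exact: Linfty_cst.
  by apply: LinftyD => //; exact: Linfty_cst.
- move=> k w; rewrite divr_ge0// addr_ge0 ?(ltW (rho0 k))// mulr_ge0 ?sqr_ge0//.
  by rewrite invr_ge0 ltW.
- move=> k w; have -> : \int[(p k w \x q k w)%E]_z h z = U k w.
    rewrite Rint_prod1// Rint_empirical//; last exact: (Linfty_int2 (q k w) hh).
    congr (_ * _); apply: eq_bigr => i _.
    by rewrite Rint_empirical//; exact: (Linfty_section1 (Z (s i) w) hh).
  by have := mulr_le_young 1 (U k w) (rho0 k); rewrite mul1r expr1n mulr1.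
move=> k; rewrite RintZr; last by apply: LinftyD => //; exact: Linfty_cst.
rewrite (RintD _ (Linfty_cst _ _) (hF k)) Rintegral_cstT RintZl; last exact: Linfty_sqr.
have hE : \int[Pr]_w (U k w ^+ 2) <= B ^+ 2 / ((n k)%:R * (m k)%:R).
  apply: (@sqr_degenerate_le _ _ _ _ _ _ _ _ _ mZ indep law (n k) (m k)
    (fun i : 'I_(n k) => s i) (fun j : 'I_(m k) => t j)) => //.
  - by move=> j1 j2 /sinj; exact: val_inj.
  - by move=> j1 j2 /tinj; exact: val_inj.
  - by move=> j x; rewrite Qt.
  - by move=> i y; rewrite Ps.
have nm : ((n k)%:R * (m k)%:R)^-1 <= rho k * rho k.
  by rewrite invfM ler_pM ?invr_ge0.
have h1 : (rho k)^-1 * \int[Pr]_w (U k w ^+ 2) <= B ^+ 2 * rho k.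
  rewrite mulrC ler_pdivrMr//; apply: le_trans hE _.
  by rewrite -[leRHS]mulrA ler_wpM2l ?sqr_ge0.
rewrite mulrAC ler_wpM2r ?invr_ge0// mulrDl mul1r.
exact: lerD.
Qed.

End two_samples.

Section uniform_modulus.
Context (R : realType).

(** Heine's theorem in a form where only [x] is confined to the compact interval, [y] being free to
    leave it. *)
Lemma uniform_modulus (h : R -> R) (K e : R) : continuous h -> 0 < e ->
  exists2 dl : R, 0 < dl & forall x y, `|x| <= K -> `|y - x| <= dl -> `|h y - h x| <= e.
Proof.
move=> ch e0.
have cK : compact `[(- K), K]%classic by exact: segment_compact.
have /compact_near_coveringP/(_ R ((0 : R)^'+)
  (fun dl x => forall y, `|y - x| <= dl -> `|h y - h x| <= e)) := cK.
have Fx x : `[(- K), K]%classic x -> \forall x' \near x & dl \near (0 : R)^'+,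
    forall y, `|y - x'| <= dl -> `|h y - h x'| <= e.
  move=> _; have e2 : 0 < e / 2 by exact: divr_gt0.
  have /cvgrPdist_le/(_ _ e2) := ch x; move/nbhs_ballP => [r /= r0 hr].
  have r2 : 0 < r / 2 by exact: divr_gt0.
  exists (ball x (r / 2), [set dl | dl < r / 2]).
    split; first exact: nbhsx_ballx.
    exact: nbhs_right_lt.
  move=> [x' dl] /= [xx' dlr] y yx.
  have bx' : `|x - x'| < r / 2 by [].
  have h1 : `|h x - h x'| <= e / 2 by apply: hr; rewrite /ball/= (lt_le_trans bx')// ler_pdivrMr// ler_peMr ?ler1n// ltW.
  have h2 : `|h x - h y| <= e / 2.
    apply: hr; rewrite /ball/= distrC (_ : y - x = (y - x') + (x' - x)); last by ring.
    rewrite (le_lt_trans (ler_normD _ _))// [r]splitr ltrD//; first exact: le_lt_trans yx dlr.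
    by rewrite distrC.
  rewrite (_ : h y - h x' = (h x - h x') - (h x - h y)); last by ring.
  by rewrite (le_trans (ler_normB _ _))// [e]splitr lerD.
move=> /(_ _ Fx) hnear.
have [dl [dl0 hdl]] : exists dl : R, 0 < dl /\ `[(- K), K]%classic `<=`
    (fun x => forall y, `|y - x| <= dl -> `|h y - h x| <= e).
  have /filter_ex[dl [h1 h2]] : \forall dl \near (0 : R)^'+, 0 < dl /\ `[(- K), K]%classic `<=`
      (fun x => forall y, `|y - x| <= dl -> `|h y - h x| <= e).
    by apply: filterI => //; exact: nbhs_right_gt.
  by exists dl.
exists dl => // x y xK; apply: (hdl x).
by rewrite /= in_itv/= -ler_norml.
Qed.

End uniform_modulus.

(** * From smoothed to bounded continuous test functions *)

Section gaussian_limit.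
Context d (W : measurableType d) (R : realType) (Pr : probability W R).
Local Notation BR := (measurableTypeR R).
Variables (U X : nat -> W -> R) (V : nat -> R) (C2 : R).
Hypotheses (hU : forall k, Linfty (U k)) (mX : forall k, measurable_fun setT (X k))
  (U2 : forall k, \int[Pr]_w (U k w ^+ 2) <= C2) (V1 : V k @[k --> \oo] --> (1 : R)).
Hypothesis heatU : forall (h : R -> R) (ep : R), Linfty (h : BR -> R) -> 0 < ep ->
  \int[Pr]_w heat h ep (U k w) - heat h (ep + V k) 0 @[k --> \oo] --> (0 : R).
(** Closeness is asked only where [U] is at most [K]: dividing by an estimated standard deviation
    produces an error proportional to [U]. *)
Hypothesis XU : forall dl K ep : R, 0 < dl -> 0 < ep ->
  exists N, forall k, (N <= k)%N -> exists A : set W, [/\ measurable A, fine (Pr A) <= ep &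
    forall w, ~ A w -> `|U k w| <= K -> `|X k w - U k w| <= dl].

Let tail (K u : R) : 0 < K -> K < `|u| -> 1 <= u ^+ 2 / K ^+ 2.
Proof.
move=> K0 Ku; rewrite ler_pdivlMr ?exprn_gt0// mul1r -[leRHS]real_normK ?num_real//.
by rewrite lerXn2r ?nnegrE ?(ltW K0)// ltW.
Qed.

Lemma heat_near1 (h : R -> R) (H v ep : R) : Linfty (h : BR -> R) -> (forall y, `|h y| <= H) ->
  0 < ep <= 16^-1 -> `|v - 1| <= ep ->
  `|heat h (ep + v) 0 - heat h 1 0| <= (8 + 36 * expR 1) * H * ep.
Proof.
move=> hh hH /andP[ep0 ep16] v1; have H0 : 0 <= H by exact: le_trans (hH 0).
(* The smoothing time [ep] absorbs the possible deficit of [v], so that the passage from time 1 is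
   forward, the only direction covered by [heat_time]. The bound [ep <= 1/16] gives [s <= 1/8], and
   [18 = 144 / 8]. *)
pose s := ep + v - 1.
have s2 : 0 <= s /\ s <= 2 * ep by move: v1; rewrite ler_norml /s => /andP[? ?]; split; lra.
have [s0 sep] := s2.
have s8 : 0 <= s <= 1 / 8 by rewrite s0/=; move: sep ep16; lra.
have e1 : 0 <= expR 1 :> R by exact: expR_ge0.
have key (x1 x2 x3 : R) : `|x1 - x2 - s / 2 * x3| <= H * (144 * expR 1) * s ^+ 2 ->
    `|x3| <= H * 8 -> `|x1 - x2| <= (8 + 36 * expR 1) * H * ep.
  move=> l2 l1; have -> : x1 - x2 = (x1 - x2 - s / 2 * x3) + s / 2 * x3 by ring.
  apply: le_trans (ler_normD _ _) _.
  have s20 : 0 <= s / 2 by exact: divr_ge0.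
  have l3 : `|s / 2 * x3| <= s * (4 * H).
    rewrite normrM (ger0_norm s20); apply: le_trans (ler_wpM2l s20 l1) _.
    by rewrite le_eqVlt; apply/orP; left; apply/eqP; field.
  have l4 : H * (144 * expR 1) * s ^+ 2 <= s * (18 * expR 1 * H).
    rewrite (_ : s * (18 * expR 1 * H) = H * (144 * expR 1) * (s * 8^-1)); last by field.
    apply: ler_wpM2l; first by apply: mulr_ge0 => //; exact: mulr_ge0.
    by rewrite expr2 ler_wpM2l//; move: s8 => /andP[_]; rewrite mul1r.
  apply: le_trans (lerD l2 l3) _; apply: le_trans (lerD l4 (lexx _)) _.
  rewrite -mulrDr (_ : (8 + 36 * expR 1) * H * ep = 2 * ep * (18 * expR 1 * H + 4 * H)); last by ring.
  by apply: ler_wpM2r => //; apply: addr_ge0; apply: mulr_ge0 => //; exact: mulr_ge0.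
have l2 := heat_time hh hH ltr01 0 s8; have l1 := heat_d2_norm hh hH ltr01 0.
rewrite expr1n divr1 (_ : 1 + s = ep + v) in l2; last by rewrite /s; ring.
rewrite invr1 mul1r in l1.
exact: key l2 l1.
Qed.

(** The eighths of the tolerance [e] are spent as follows: three from [X] to [U], three from [U] to
    its smoothing, one for the replacement, one for the variance [V k] not being exactly 1. The
    choices are made in the order [K], [dl], [ep], and only then the threshold in [k]. *)
Lemma cvg_gaussian (h : R -> R) : continuous h -> (exists M : R, forall x, `|h x| <= M) ->
  \int[Pr]_w h (X k w) @[k --> \oo] --> \int[normal_prob 0 1]_x h x.
Proof.
move=> ch [H' hH'].
have [H H0 hH] : exists2 H, 0 < H & forall x, `|h x| <= H.
  exists (`|H'| + 1) => [|x]; first by rewrite ltr_wpDl.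
  by rewrite (le_trans (hH' x))// (le_trans (ler_norm _))// lerDl.
have hh : Linfty (h : BR -> R).
  by split; [exact: continuous_measurable_fun|exists H].
have -> : \int[normal_prob 0 1]_x h x = heat h 1 0 by rewrite /heat sqrtr1.
apply/cvgn_epsP => e e0; pose e1 := e / 8; have e10 : 0 < e1 by exact: divr_gt0.
have C20 : 0 <= C2 by apply: le_trans (U2 0%N); apply: Rint_ge_cst => [|w]; [exact: Linfty_sqr|exact: sqr_ge0].
(* Large enough for Chebyshev's bound [2 * H * C2 / K ^+ 2 <= e1]; the summand 1 gives
   [K <= K ^+ 2]. *)
pose K := 1 + 2 * H * C2 / e1.
have K1 : 1 <= K.
  rewrite lerDl; apply: divr_ge0; last exact: ltW.
  by apply: mulr_ge0 => //; apply: mulr_ge0 => //; exact: ltW.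
have K0 : 0 < K by exact: lt_le_trans K1.
have KC : 2 * H * (C2 / K ^+ 2) <= e1.
  rewrite mulrA ler_pdivrMr ?exprn_gt0//.
  apply: (@le_trans _ _ (e1 * K)); last by rewrite ler_wpM2l ?(ltW e10)// expr2 ler_peMr// ltW.
  rewrite /K mulrDr mulr1 mulrCA divff ?gt_eqF// mulr1 lerDr.
  exact: ltW.
have [dl dl0 hdl] := uniform_modulus K ch e10.
have c0 : 0 < 8 + 36 * expR 1 :> R by rewrite addr_gt0// mulr_gt0// expR_gt0.
pose ep := Num.min 16^-1 (Num.min (e1 / (12 * H) * dl ^+ 2) (e1 / ((8 + 36 * expR 1) * H))).
have ep0 : 0 < ep by rewrite !lt_min invr_gt0 ltr0n/= !mulr_gt0 ?invr_gt0 ?mulr_gt0 ?exprn_gt0.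
have ep16 : 0 < ep <= 16^-1 by rewrite ep0 ge_min lexx.
have epdl : 12 * H * (ep / dl ^+ 2) <= e1.
  rewrite mulrA ler_pdivrMr ?exprn_gt0// mulrC -ler_pdivlMr ?mulr_gt0//.
  by rewrite mulrAC ge_min ge_min lexx orbT.
have epc : (8 + 36 * expR 1) * H * ep <= e1.
  by rewrite mulrC -ler_pdivlMr ?mulr_gt0// !ge_min lexx !orbT.
have /cvgn_epsP/(_ _ e10)[N1 hN1] := heatU hh ep0.
have /cvgn_epsP/(_ _ ep0)[N2 hN2] := V1.
have H2 : 0 < e1 / (2 * H) by rewrite divr_gt0 ?mulr_gt0.
have [N3 hN3] := XU K dl0 H2.
exists (maxn N1 (maxn N2 N3)) => k; rewrite !geq_max => /and3P[/hN1 k1 /hN2 k2 /hN3[A [mA PA kA]]].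
rewrite subr0 in k1; have k4 := heat_near1 hh hH ep16 k2.
have hhU : Linfty (fun w => h (U k w)) by have [mU _] := hU k; exact: (Linfty_comp (mU : measurable_fun setT (U k : W -> BR)) hh).
have hhX : Linfty (fun w => h (X k w)) by exact: (Linfty_comp (mX k : measurable_fun setT (X k : W -> BR)) hh).
have hheat : Linfty (fun w => heat h ep (U k w)).
  by have [mU _] := hU k; exact: (Linfty_comp (mU : measurable_fun setT (U k : W -> BR)) (Linfty_heat hh hH ep0)).
have hA : Linfty (\1_A : W -> R).
  split; first exact: measurable_indic.
  by exists 1 => w; rewrite indicE; case: (_ \in _); rewrite ?normr1 ?normr0.
have hUK : Linfty (fun w => 2 * H * (U k w ^+ 2 / K ^+ 2)).
  apply: LinftyM; first exact: Linfty_cst.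
  by apply: LinftyM; [exact: Linfty_sqr|exact: Linfty_cst].
have IUK : \int[Pr]_w (2 * H * (U k w ^+ 2 / K ^+ 2)) <= e1.
  rewrite RintZl; last by apply: LinftyM; [exact: Linfty_sqr|exact: Linfty_cst].
  rewrite RintZr; last exact: Linfty_sqr.
  apply: le_trans KC; rewrite ler_wpM2l ?mulr_ge0 ?(ltW H0)// ler_wpM2r//.
  by rewrite invr_ge0 exprn_ge0 ?(ltW K0).
have hb u v : `|h u - h v| <= 2 * H.
  by rewrite (le_trans (ler_normB _ _))// mulr2n mulrDl mul1r lerD.
have i0' w : 0 <= U k w ^+ 2 / K ^+ 2.
  by apply: divr_ge0; [exact: sqr_ge0|exact: exprn_ge0 (ltW K0)].
have iH : 0 <= 2 * H by apply: mulr_ge0 => //; exact: ltW.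
have step1 : `|\int[Pr]_w h (X k w) - \int[Pr]_w h (U k w)| <= 3 * e1.
  rewrite -RintB//; apply: le_trans (le_norm_Rint _ (LinftyB hhX hhU)) _.
  have hA2 : Linfty (fun w => 2 * H * \1_A w) by apply: LinftyM => //; exact: Linfty_cst.
  apply: (@le_trans _ _ (\int[Pr]_w (e1 + 2 * H * \1_A w + 2 * H * (U k w ^+ 2 / K ^+ 2)))).
    apply: le_Rint; [exact: (Linfty_norm (LinftyB hhX hhU))|by apply: LinftyD => //; apply: LinftyD => //; exact: Linfty_cst|].
    move=> w; have i0 := i0' w.
    rewrite indicE; have [_|wA] := boolP (w \in A).
      rewrite mulr1 (le_trans (hb _ _))// addrAC lerDr addr_ge0 ?(ltW e10)//.
      exact: mulr_ge0.
    have {wA}wA : ~ A w by move=> Aw; move/negP: wA; apply; rewrite inE.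
    rewrite mulr0 addr0; have [UK|UK] := leP `|U k w| K.
      by apply: ler_wpDr; [exact: mulr_ge0|apply: hdl => //; exact: kA].
    rewrite (le_trans (hb _ _))//; apply: ler_wpDl; first exact: ltW.
    by rewrite ler_peMr//; exact: tail.
  rewrite (RintD _ (LinftyD (Linfty_cst _ e1) hA2) hUK) (RintD _ (Linfty_cst _ e1) hA2).
  rewrite Rintegral_cstT (RintZl _ _ hA) (Rint_indic Pr mA).
  have h2A : 2 * H * fine (Pr A) <= e1 by rewrite mulrC -ler_pdivlMr ?mulr_gt0.
  by apply: le_trans (lerD (lerD (lexx e1) h2A) IUK) _; rewrite le_eqVlt; apply/orP; left; apply/eqP; ring.
have step2 : `|\int[Pr]_w h (U k w) - \int[Pr]_w heat h ep (U k w)| <= 3 * e1.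
  rewrite -RintB//; apply: le_trans (le_norm_Rint _ (LinftyB hhU hheat)) _.
  apply: (@le_trans _ _ (\int[Pr]_w (2 * e1 + 2 * H * (U k w ^+ 2 / K ^+ 2)))).
    apply: le_Rint; [exact: (Linfty_norm (LinftyB hhU hheat))|by apply: LinftyD => //; exact: Linfty_cst|].
    move=> w; have i0 := i0' w.
    have [UK|UK] := leP `|U k w| K.
      rewrite distrC; apply: ler_wpDr; first exact: mulr_ge0.
      apply: le_trans (heat_approx hh hH ep0 dl0 (ltW e10) (hdl (U k w) ^~ UK)) _.
      by apply: le_trans (lerD (lexx e1) epdl) _; rewrite le_eqVlt; apply/orP; left; apply/eqP; ring.
    apply: (@le_trans _ _ (2 * H)).
      rewrite (le_trans (ler_normB _ _))// mulr2n mulrDl mul1r lerD//.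
      exact: (heat_norm hh hH).
    apply: ler_wpDl; first by apply: mulr_ge0 => //; exact: ltW.
    by rewrite ler_peMr//; exact: tail.
  rewrite (RintD _ (Linfty_cst _ (2 * e1)) hUK) Rintegral_cstT.
  by apply: le_trans (lerD (lexx (2 * e1)) IUK) _; rewrite le_eqVlt; apply/orP; left; apply/eqP; ring.
have -> : e = 3 * e1 + 3 * e1 + e1 + e1 by rewrite /e1; field.
apply: le_trans (ler_distD (heat h (ep + V k) 0) _ _) _; apply: lerD; last exact: le_trans k4 epc.
apply: le_trans (ler_distD (\int[Pr]_w heat h ep (U k w)) _ _) _; apply: lerD => //.
by apply: le_trans (ler_distD (\int[Pr]_w h (U k w)) _ _) _; exact: lerD.
Qed.

End gaussian_limit.


(** * Efficient scores *)

Section efficient_scores.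
Context d (T : measurableType d) (R : realType).

Lemma Var_shift (P : probability T R) (f : T -> R) (a : R) : Linfty f ->
  Var P (fun x => f x + a) = Var P f.
Proof.
move=> hf; have ha := Linfty_cst T a; have hfa := LinftyD hf ha.
have hf2 := Linfty_sqr hf.
have h2 : Linfty (fun x => 2 * a * f x) by apply: LinftyM => //; exact: Linfty_cst.
rewrite !VarE// (RintD _ hf ha) Rintegral_cstT.
rewrite (@eq_Rint _ _ _ _ _ (fun x => f x ^+ 2 + 2 * a * f x + a ^+ 2)); last by move=> x; ring.
rewrite (RintD _ (LinftyD hf2 h2) (Linfty_cst _ _)) (RintD _ hf2 h2) (RintZl _ _ hf) Rintegral_cstT.
by generalize (\int[P]_x (f x ^+ 2)) (\int[P]_x f x) => u v; ring.
Qed.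

Variables (k e : T * T -> R) (P Q : probability T R) (dl : R).
Hypotheses (dl0 : 0 < dl) (kk : is_kernel dl k P Q) (he : Linfty e).

Let hk : Linfty k. Proof. by case: kk. Qed.
Let hkt : Linfty (transpose k). Proof. exact: Linfty_swap. Qed.
Let hek : Linfty (fun z => e z * k z). Proof. exact: LinftyM. Qed.

(* [phi] and [psi] are the two components of the efficient influence function. *)
Lemma efficient_scores : exists phi psi, [/\ Linfty phi, Linfty psi,
  forall x, \int[Q]_y ((e (x, y) - phi x - psi y) * k (x, y)) = 0,
  forall y, \int[P]_x ((e (x, y) - phi x - psi y) * k (x, y)) = 0 &
  side_limit k e P Q = Var P phi /\
  side_limit (transpose k) (transpose e) Q P = Var Q psi].
Proof.
have [_ [B eB]] := he; have [_ kdl k1 k2] := kk.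
have ktk := is_kernel_transpose kk.
have [phi [hphi phiE lphi _ _]] := side_phi dl0 kk he eB.
have etB z : `|transpose e z| <= B by exact: eB.
have [phi2 [hphi2 phi2E lphi2 _ _]] := side_phi dl0 ktk (Linfty_swap he) etB.
pose ex x := \int[Q]_y (e (x, y) * k (x, y)); pose ey y := \int[P]_x (e (x, y) * k (x, y)).
have hex : Linfty ex by exact: (Linfty_int2 Q hek).
have hey : Linfty ey by exact: (Linfty_int1 P hek).
pose A := kernel_op k Q; pose At := kernel_op (transpose k) P.
(* [psi] is read off the second score equation; the first then becomes the Neumann equation of
   [phi]. *)
pose psi y := ey y - At phi y.
have hAt f : Linfty f -> Linfty (At f) by exact: Linfty_kernel_op.
have hA f : Linfty f -> Linfty (A f) by exact: Linfty_kernel_op.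
have hpsi : Linfty psi by apply: LinftyB => //; exact: hAt.
have Apsi x : A psi x = ex x - phi x.
  have h := phiE x; rewrite /side_source /round_trip -/(A _) -/(At phi) in h.
  rewrite /A /psi (kernel_opB Q hk x hey (hAt _ hphi)) -/A; move: h.
  rewrite -/(A ey) -/(A (At phi)) -/(ex x).
  by generalize (A ey x) (A (At phi) x) (ex x) (phi x) => a b u v h; lra.
have K2psi y : psi y - round_trip (transpose k) Q P psi y = side_source (transpose k) (transpose e) Q P y.
  have -> : round_trip (transpose k) Q P psi y = At ex y - At phi y.
    rewrite -[LHS]/(At (A psi) y) (_ : A psi = fun x => ex x - phi x); last exact/funext.
    exact: (kernel_opB P hkt y hex hphi).
  have -> : side_source (transpose k) (transpose e) Q P y = ey y - At ex y by [].
  by rewrite /psi; generalize (ey y) (At phi y) (At ex y) => a b u; ring.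
have [_ _ kt1 kt2] := ktk.
(* [psi] and the Neumann solution [phi2] of the transposed problem satisfy the same equation, so
   they differ by a constant and have the same variance. *)
have Dfix y : round_trip (transpose k) Q P (fun y => psi y - phi2 y) y = psi y - phi2 y.
  have -> : round_trip (transpose k) Q P (fun y => psi y - phi2 y) y =
      round_trip (transpose k) Q P psi y - round_trip (transpose k) Q P phi2 y.
    rewrite -[LHS]/(At (A (fun y => psi y - phi2 y)) y).
    rewrite (_ : A _ = fun x => A psi x - A phi2 x); last first.
      by apply/funext => x; exact: (kernel_opB Q hk x hpsi hphi2).
    exact: (kernel_opB P hkt y (hA _ hpsi) (hA _ hphi2)).
  have := K2psi y; rewrite -(phi2E y).
  by generalize (round_trip (transpose k) Q P psi y) (round_trip (transpose k) Q P phi2 y) (psi y) (phi2 y) => a b u v h; lra.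
have Dc := fixed_point_const hkt dl0 (fun z => kdl (z.2, z.1)) kt1 kt2 (LinftyB hpsi hphi2) Dfix.
exists phi, psi; split => //.
- move=> x.
  have h1 := Linfty_section1 x hek; have h2 := Linfty_section1 x hk.
  rewrite (@eq_Rint _ _ _ _ _ (fun y => e (x, y) * k (x, y) - phi x * k (x, y) - k (x, y) * psi y)); last first.
    by move=> y; ring.
  have h3 : Linfty (fun y => phi x * k (x, y)) by apply: LinftyM => //; exact: Linfty_cst.
  rewrite (RintB _ (LinftyB h1 h3) (LinftyM h2 hpsi)) (RintB _ h1 h3) (RintZl _ _ h2) k1 mulr1.
  by rewrite -/(ex x) -[X in _ - X]/(A psi x) Apsi; generalize (ex x) (phi x) => a b; ring.
- move=> y.
  have h1 := Linfty_section2 y hek; have h2 := Linfty_section2 y hk.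
  rewrite (@eq_Rint _ _ _ _ _ (fun x => e (x, y) * k (x, y) - k (x, y) * phi x - psi y * k (x, y))); last first.
    by move=> x; ring.
  have h3 : Linfty (fun x => psi y * k (x, y)) by apply: LinftyM => //; exact: Linfty_cst.
  rewrite (RintB _ (LinftyB h1 (LinftyM h2 hphi)) h3) (RintB _ h1 (LinftyM h2 hphi)) (RintZl _ _ h2) k2 mulr1.
  by rewrite -/(ey y) -[X in _ - X - _]/(At phi y) /psi; generalize (ey y) (At phi y) => a b; ring.
split=> //; rewrite lphi2; move: Dc; set t := \int[Q]_z _ => Dc.
rewrite -(Var_shift Q t hphi2); congr (Var Q _); apply/funext => y.
by have := Dc y; move: (psi y) (phi2 y) => u v; lra.
Qed.

(** The marginals of [k'] are exact, so functions of one variable integrate under the plan as under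
    [p] or [q]. *)
Lemma Rint_scores (p q : probability T R) (k' : T * T -> R) (phi psi : T -> R) :
  is_kernel dl k' p q -> Linfty phi -> Linfty psi ->
  \int[p]_x \int[q]_y (e (x, y) * k' (x, y)) =
  \int[(p \x q)%E]_z ((e z - phi z.1 - psi z.2) * k' z) + \int[p]_x phi x + \int[q]_y psi y.
Proof.
move=> [hk' _ k1 k2] hphi hpsi.
have h1 : Linfty (fun z : T * T => phi z.1) by exact: (Linfty_comp (@measurable_fst _ _ T T) hphi).
have h2 : Linfty (fun z : T * T => psi z.2) by exact: (Linfty_comp (@measurable_snd _ _ T T) hpsi).
have hek' : Linfty (fun z => e z * k' z) by exact: LinftyM.
have h1k := LinftyM h1 hk'; have h2k := LinftyM h2 hk'.
have -> : \int[p]_x phi x = \int[(p \x q)%E]_z (phi z.1 * k' z).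
  rewrite Rint_prod1//; apply: eq_Rint => x /=.
  by rewrite (RintZl _ _ (Linfty_section1 x hk')) k1 mulr1.
have -> : \int[q]_y psi y = \int[(p \x q)%E]_z (psi z.2 * k' z).
  rewrite Rint_prod2//; apply: eq_Rint => y /=.
  by rewrite (RintZl _ _ (Linfty_section2 y hk')) k2 mulr1.
have hH : Linfty (fun z => (e z - phi z.1 - psi z.2) * k' z).
  by apply: LinftyM => //; apply: LinftyB => //; exact: LinftyB.
rewrite -(Rint_prod1 _ _ hek') -(RintD _ hH h1k) -(RintD _ (LinftyD hH h1k) h2k).
by apply: eq_Rint => z; ring.
Qed.

End efficient_scores.

Section xi_kernel.
Context d (T : measurableType d) (R : realType) (c : T * T -> R) (M : R).
Hypotheses (hc : Linfty c) (cM : forall z, `|c z| <= M).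

Lemma xi_is_kernel (P Q : probability T R) : is_kernel (expR (- (6 * M))) (xi c P Q) P Q.
Proof.
split; first exact: (Linfty_xi hc cM).
- by move=> z; have /andP[] := xi_bounds hc cM P Q z.
- exact: (xi_marginal1 hc cM).
- exact: (xi_marginal2 hc cM).
Qed.

End xi_kernel.


(** * Limit theorems for empirical plans *)

Section sqrt_limits.
Context (R : realType).

Lemma cvg_inv_size (n : nat -> nat) : n k @[k --> \oo] --> \oo ->
  (n k)%:R^-1 @[k --> \oo] --> (0 : R).
Proof.
move=> hn; apply/cvgn_epsP => e e0.
have hh : (fun j => j.+1%:R^-1) @ \oo --> (0 : R) by exact: cvg_harmonic.
have /cvgn_epsP/(_ _ e0)[j0 /(_ _ (leqnn j0))] := hh.
rewrite subr0 => hj.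
have [K _ hK] : (n @ \oo) [set j | (j0.+1 <= j)%N] := hn _ (nbhs_infty_ge _).
exists K => k /hK nk; rewrite subr0 (le_trans _ hj)// !ger0_norm ?invr_ge0//.
by rewrite lef_pV2 ?posrE ?ltr0n// ?ler_nat// (leq_trans _ nk).
Qed.

Lemma cvg_sqr0 (u : nat -> R) : u k ^+ 2 @[k --> \oo] --> (0 : R) -> u k @[k --> \oo] --> (0 : R).
Proof.
move=> /cvgn_epsP hu; apply/cvgn_epsP => e e0.
have [K hK] := hu _ (exprn_gt0 2 e0).
exists K => k /hK; rewrite !subr0 normrX => h.
by rewrite -(ler_pXn2r (ltn0Sn 1)) ?nnegrE// ltW.
Qed.

(* [x] and [r] stand for the Gaussian part and for the remainder of the numerator. *)
Lemma sqrt_quotient_dist (s s2 x r K dl : R) : 0 < s2 -> dl <= 3 / 4 * s2 ->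
  `|s - s2| <= dl -> `|r| <= dl -> `|x| <= K ->
  `|(Num.sqrt s2 * x + r) / Num.sqrt s - x| <= 2 * (K / Num.sqrt s2 + 1) / Num.sqrt s2 * dl.
Proof.
move=> s20 dls sd rd xK; set u := Num.sqrt s2.
have u0 : 0 < u by rewrite sqrtr_gt0.
have uu : u * u = s2 by rewrite -expr2 sqr_sqrtr ?ltW.
have s0 : 0 < s by move: sd dls s20; rewrite ler_norml => /andP[? ?] *; lra.
set t := Num.sqrt s; have t0 : 0 < t by rewrite sqrtr_gt0.
have tt : t * t = s by rewrite -expr2 sqr_sqrtr ?ltW.
(* The hypothesis [dl <= 3 / 4 * s2] was chosen to give [s >= s2 / 4]. *)
have t2 : u / 2 <= t.
  rewrite -(ler_pXn2r (ltn0Sn 1)) ?nnegrE ?(ltW t0) ?divr_ge0 ?(ltW u0)//.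
  rewrite exprMn !expr2 tt uu; move: sd dls; rewrite ler_norml => /andP[? ?] ?; lra.
have dl0 : 0 <= dl by exact: le_trans sd.
have ut : `|u - t| <= dl / u.
  rewrite ler_pdivlMr// -[X in `|_| * X](ger0_norm (ltW u0)) -normrM.
  have h : `|u - t| * u <= `|u - t| * (u + t) by rewrite ler_wpM2l// lerDl ltW.
  rewrite normrM (ger0_norm (ltW u0)) (le_trans h)//.
  rewrite -[X in _ * X]ger0_norm ?addr_ge0 ?(ltW u0) ?(ltW t0)// -normrM.
  by rewrite -subr_sqr !expr2 uu tt distrC.
have -> : (u * x + r) / t - x = (x * (u - t) + r) / t by field; rewrite gt_eqF.
rewrite normrM normfV (ger0_norm (ltW t0)) ler_pdivrMr//.
have h1 : `|x * (u - t) + r| <= (K / u + 1) * dl.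
  rewrite (le_trans (ler_normD _ _))// mulrDl mul1r lerD// normrM.
  have -> : K / u * dl = K * (dl / u) by ring.
  exact: ler_pM.
have K0 : 0 <= K by exact: le_trans xK.
apply: le_trans h1 _.
have -> : 2 * (K / u + 1) / u * dl * t = (K / u + 1) * dl * (2 / u * t) by ring.
rewrite ler_peMr//; first by rewrite mulr_ge0// addr_ge0// divr_ge0// ltW.
by rewrite mulrAC ler_pdivlMr// mul1r; move: t2; lra.
Qed.

End sqrt_limits.

Section empirical_plans.
Context d (W : measurableType d) (R : realType) (Pr : probability W R).
Context d' (T : measurableType d').
Variables (c eta : T * T -> R) (M : R) (P Q : probability T R) (X Y : nat -> W -> T)
  (n m : nat -> nat).
Hypotheses (hc : Linfty c) (cM : forall z, `|c z| <= M) (he : Linfty eta).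
Hypotheses (mX : forall i, measurable_fun setT (X i)) (mY : forall j, measurable_fun setT (Y j)).
Hypotheses (lawX : forall i A, measurable A -> Pr (X i @^-1` A) = P A)
  (lawY : forall j A, measurable A -> Pr (Y j @^-1` A) = Q A).
Hypotheses (n0 : forall k, (0 < n k)%N) (m0 : forall k, (0 < m k)%N).

Definition joint_sample (s : nat + nat) : W -> T :=
  match s with inl i => X i | inr j => Y j end.
Definition joint_law (s : nat + nat) : probability T R :=
  match s with inl _ => P | inr _ => Q end.
Notation Z := joint_sample.

Hypothesis indep : mutual_independence Pr Z.

Let mZ s : measurable_fun setT (Z s). Proof. by case: s => i /=. Qed.
Let law s A : measurable A -> Pr (Z s @^-1` A) = joint_law s A.
Proof. by case: s => i /=; [exact: lawX|exact: lawY]. Qed.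

Let p k w := empirical R (n k) (fun i => X i w).
Let q k w := empirical R (m k) (fun j => Y j w).
Let rho k : R := (n k)%:R^-1 + (m k)%:R^-1.
Let h := xi c P Q.
Let h' k w := xi c (p k w) (q k w).

Let hh : Linfty h. Proof. exact: (Linfty_xi hc cM). Qed.
Let rp k : random_measure (p k). Proof. exact: empirical_random_measure. Qed.
Let rq k : random_measure (q k). Proof. exact: empirical_random_measure. Qed.
Let rh k : random_Linfty (h' k). Proof. exact: (random_xi hc cM (rp k) (rq k)). Qed.
Let kk := xi_is_kernel hc cM P Q.
Let kk' k w := xi_is_kernel hc cM (p k w) (q k w).

Let inl_inj : injective (@inl nat nat). Proof. by move=> i j []. Qed.
Let inr_inj : injective (@inr nat nat). Proof. by move=> i j []. Qed.

Let svPQ (g : T * T -> R) : Linfty g -> (forall x, \int[Q]_y g (x, y) = 0) ->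
  vanishing Pr rho (fun k w => section_var (p k w) (q k w) g).
Proof.
exact: (@vanishing_section_var _ _ _ _ _ _ _ _ _ mZ indep law inl inr Q n m inr_inj).
Qed.

Let svQP (g : T * T -> R) : Linfty g -> (forall x, \int[P]_y g (x, y) = 0) ->
  vanishing Pr rho (fun k w => section_var (q k w) (p k w) g).
Proof.
rewrite (_ : rho = fun k => (m k)%:R^-1 + (n k)%:R^-1); last by apply/funext => k; exact: addrC.
exact: (@vanishing_section_var _ _ _ _ _ _ _ _ _ mZ indep law inr inl P m n inl_inj).
Qed.

Let vmP (g : T -> R) : Linfty g -> \int[P]_x g x = 0 ->
  vanishing Pr rho (fun k w => (\int[p k w]_x g x) ^+ 2).
Proof.
exact: (@vanishing_mean _ _ _ _ _ _ _ _ _ mZ indep law inl P n m inl_inj).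
Qed.

Let vmQ (g : T -> R) : Linfty g -> \int[Q]_x g x = 0 ->
  vanishing Pr rho (fun k w => (\int[q k w]_x g x) ^+ 2).
Proof.
rewrite (_ : rho = fun k => (m k)%:R^-1 + (n k)%:R^-1); last by apply/funext => k; exact: addrC.
exact: (@vanishing_mean _ _ _ _ _ _ _ _ _ mZ indep law inr Q m n inr_inj).
Qed.

Let hm z := h z - 1.
Let V k w := section_var (p k w) (q k w) hm + section_var (q k w) (p k w) (fun z => hm (z.2, z.1)).

Let hhm : Linfty hm. Proof. by apply: LinftyB => //; exact: Linfty_cst. Qed.

Let vV : vanishing Pr rho V.
Proof.
apply: vanishingD.
  apply: svPQ => // x; rewrite (RintB _ (Linfty_section1 x hh) (Linfty_cst _ _)) Rintegral_cstT.
  by rewrite (xi_marginal1 hc cM) subrr.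
apply: svQP => [|y]; first exact: Linfty_swap.
rewrite (RintB _ (Linfty_section2 y hh) (Linfty_cst _ _)) Rintegral_cstT.
by rewrite (xi_marginal2 hc cM) subrr.
Qed.

Let vk : vanishing Pr rho (fun k w => \int[(p k w \x q k w)%E]_z ((h' k w z - h z) ^+ 2)).
Proof.
apply: vanishing_le (fun k w => xi_stability hc cM P Q (p k w) (q k w)) _.
by apply: vanishingZ vV; apply: mulr_ge0; [rewrite invr_ge0|]; exact: sqr_ge0.
Qed.

Let vkt : vanishing Pr rho (fun k w =>
  \int[(q k w \x p k w)%E]_z ((transpose (h' k w) z - transpose h z) ^+ 2)).
Proof.
apply: vanishing_le vk => k w.
rewrite -(Rint_transpose (p k w) (q k w) (h := fun z => (h' k w z - h z) ^+ 2))//.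
by apply: Linfty_sqr; apply: LinftyB => //; exact: (Linfty_xi hc cM).
Qed.

Lemma measurable_sigma2_hat k N :
  measurable_fun setT (fun w => sigma2_hat c eta (n k) (m k) N (p k w) (q k w)).
Proof.
apply: measurable_funD; apply: measurable_funM => //.
  exact: (measurable_side_var (rp k) (rq k) (rh k) (expR_gt0 _) (kk' k) he).
exact: (measurable_side_var (rq k) (rp k) (random_Linfty_transpose (rh k))
  (expR_gt0 (- (6 * M))) (fun w => is_kernel_transpose (kk' k w)) (Linfty_swap he)).
Qed.

Lemma cvg_sigma2_hat (N : nat -> option nat) (lambda : R) :
  rho k @[k --> \oo] --> (0 : R) -> cvg_to_infinity N ->
  ((m k)%:R / (n k + m k)%:R : R) @[k --> \oo] --> lambda ->
  cvg_in_probability Pr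
    (fun k w => sigma2_hat c eta (n k) (m k) (N k) (p k w) (q k w)) (sigma2 c eta lambda P Q).
Proof.
move=> rho0 hN hl; have [_ [B eB]] := he.
have nm0 k : 0 < (n k + m k)%:R :> R by rewrite ltr0n addn_gt0 n0.
have hl' : ((n k)%:R / (n k + m k)%:R : R) @[k --> \oo] --> 1 - lambda.
  rewrite (_ : (fun k => _) = fun k => 1 - (m k)%:R / (n k + m k)%:R).
    by apply: cvgB => //; exact: cvg_cst.
  apply/funext => k; rewrite -[in LHS](addrK (m k)%:R (n k)%:R) -natrD mulrBl divff//.
  by rewrite gt_eqF.
apply: (@cvg_in_probability_lin _ _ _ _
  (fun k w => side_var (h' k w) eta (p k w) (q k w) (N k))
  (fun k w => side_var (transpose (h' k w)) (transpose eta) (q k w) (p k w) (N k))) => //.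
- apply: (cvg_side_var (expR_gt0 (- (6 * M))) kk kk' he eB vk svPQ svQP vmP rho0 hN) => k.
  exact: (measurable_side_var (rp k) (rq k) (rh k) (expR_gt0 _) (kk' k) he).
- have etB z : `|transpose eta z| <= B by exact: eB.
  apply: (cvg_side_var (expR_gt0 (- (6 * M))) (is_kernel_transpose kk)
    (fun k w => is_kernel_transpose (kk' k w)) (Linfty_swap he) etB vkt svQP svPQ vmQ rho0 hN) => k.
  exact: (measurable_side_var (rq k) (rp k) (random_Linfty_transpose (rh k))
    (expR_gt0 (- (6 * M))) (fun w => is_kernel_transpose (kk' k w)) (Linfty_swap he)).
- by move=> k; rewrite ger0_norm ?divr_ge0// ler_pdivrMr// mul1r ler_nat leq_addl.
- by move=> k; rewrite ger0_norm ?divr_ge0// ler_pdivrMr// mul1r ler_nat leq_addr.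
Qed.

Lemma plan_expansion : exists phi psi, [/\ Linfty phi, Linfty psi,
  \int[P]_x phi x = 0 /\ \int[Q]_y psi y = 0,
  forall lambda, sigma2 c eta lambda P Q =
    lambda * \int[P]_x (phi x ^+ 2) + (1 - lambda) * \int[Q]_y (psi y ^+ 2) &
  vanishing Pr rho (fun k w =>
    `|\int[entropic_plan c (p k w) (q k w)]_z eta z - \int[entropic_plan c P Q]_z eta z -
      (\int[p k w]_x phi x + \int[q k w]_y psi y)|)].
Proof.
have [phi [psi [hphi hpsi H1 H2 [S1 S2]]]] := efficient_scores (expR_gt0 (- (6 * M))) kk he.
pose a := \int[P]_x phi x; pose b := \int[Q]_y psi y.
pose G z := eta z - phi z.1 - psi z.2.
have hG : Linfty G.
  apply: LinftyB; last exact: (Linfty_comp (@measurable_snd _ _ T T) hpsi).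
  by apply: LinftyB => //; exact: (Linfty_comp (@measurable_fst _ _ T T) hphi).
have hGh : Linfty (fun z => G z * h z) by exact: LinftyM.
have [_ [B GB]] := hG; have B0 : 0 <= B by exact: le_trans (GB point).
have hpa : Linfty (fun x => phi x - a) by apply: LinftyB => //; exact: Linfty_cst.
have hpb : Linfty (fun x => psi x - b) by apply: LinftyB => //; exact: Linfty_cst.
have ia : \int[P]_x (phi x - a) = 0 by rewrite (RintB _ hphi (Linfty_cst _ _)) Rintegral_cstT subrr.
have ib : \int[Q]_x (psi x - b) = 0 by rewrite (RintB _ hpsi (Linfty_cst _ _)) Rintegral_cstT subrr.
have VE (m' : probability T R) g (r : R) : Linfty g -> r = \int[m']_x g x ->
    Var m' g = \int[m']_x ((g x - r) ^+ 2).
  move=> hg rE; have hgr : Linfty (fun x => g x - r) by apply: LinftyB => //; exact: Linfty_cst.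
  rewrite -(Var_shift m' (- r) hg) VarE// (RintB _ hg (Linfty_cst _ _)) Rintegral_cstT -rE.
  by rewrite subrr expr0n/= subr0.
exists (fun x => phi x - a), (fun y => psi y - b); split => //.
  by move=> lambda; rewrite side_sigma2 S1 S2 (VE P phi a)// (VE Q psi b).
have E k w : \int[entropic_plan c (p k w) (q k w)]_z eta z - \int[entropic_plan c P Q]_z eta z -
    (\int[p k w]_x (phi x - a) + \int[q k w]_y (psi y - b)) =
    (\int[(p k w \x q k w)%E]_z (G z * h' k w z) - \int[(p k w \x q k w)%E]_z (G z * h z)) +
    \int[(p k w \x q k w)%E]_z (G z * h z).
  rewrite (Rint_entropic_plan hc cM (p k w) (q k w) he) (Rint_entropic_plan hc cM P Q he).
  rewrite (Rint_scores he (kk' k w) hphi hpsi) (Rint_scores he kk hphi hpsi) -/a -/b.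
  have -> : \int[(P \x Q)%E]_z ((eta z - phi z.1 - psi z.2) * xi c P Q z) = 0.
    rewrite (Rint_prod1 _ _ hGh) -[RHS](Rintegral_cstT P); apply: eq_Rint => x; exact: H1.
  rewrite (RintB _ hphi (Linfty_cst _ _)) (RintB _ hpsi (Linfty_cst _ _)) !Rintegral_cstT.
  have key (x r u v : R) : x + u + v - (0 + a + b) - (u - a + (v - b)) = x - r + r by ring.
  exact: key.
have v0 : vanishing Pr rho (fun k w => `|\int[(p k w \x q k w)%E]_z (G z * h z)|).
  exact: (@vanishing_degenerate _ _ _ _ _ _ _ _ _ mZ indep law inl inr P Q n m inl_inj inr_inj).
have s1 : vanishing Pr rho (fun k w => section_var (p k w) (q k w) (fun z => G z * h z)) by exact: svPQ.
have s2 : vanishing Pr rho (fun k w => section_var (q k w) (p k w) (fun z => G (z.2, z.1) * h (z.2, z.1))).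
  by apply: svQP => //; exact: (Linfty_swap hGh).
(* The constant of [linearization], with its local [W] replaced by [10 * M]. *)
pose C1 := (2^-1 + B * expR (6 * M) * expR (10 * M)) * (expR (- (6 * M)) * expR (- (10 * M))) ^- 2.
have C10 : 0 <= C1.
  apply: mulr_ge0; last by rewrite invr_ge0; exact: sqr_ge0.
  apply: addr_ge0; first by rewrite invr_ge0.
  by do 2 (apply: mulr_ge0; last exact: expR_ge0).
have i20 : 0 <= 2^-1 :> R by rewrite invr_ge0.
have v1 := vanishingD (vanishingD (vanishingZ C10 vV) (vanishingZ i20 (vanishingD s1 s2))) v0.
apply: vanishing_le v1 => k w; rewrite E; apply: le_trans (ler_normD _ _) _; apply: lerD => //.
have := linearization hc cM P Q (p k w) (q k w) hG GB.
by rewrite /C1 -/h -/(h' k w) -/hm -/(V k w) mulrA [X in _ <= _ + X]mulrC.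
Qed.

Let a k : R := Num.sqrt ((n k * m k)%:R / (n k + m k)%:R).

Let nR k : 0 < (n k)%:R :> R. Proof. by rewrite ltr0n. Qed.
Let mR k : 0 < (m k)%:R :> R. Proof. by rewrite ltr0n. Qed.
Let nmR k : 0 < (n k + m k)%:R :> R. Proof. by rewrite ltr0n addn_gt0 n0. Qed.

Let a2 k : a k ^+ 2 = (n k)%:R * (m k)%:R / (n k + m k)%:R.
Proof. by rewrite /a sqr_sqrtr ?divr_ge0// natrM. Qed.

(** Consequently [(a * rho) ^+ 2 = rho]: errors of order [rho] are negligible at the scale [a], and
    [U] keeps a bounded second moment. *)
Let a2rho k : a k ^+ 2 * rho k = 1.
Proof.
rewrite a2 /rho; move: (nR k) (mR k) (nmR k); rewrite natrD => x0 y0 xy0.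
by field; rewrite !gt_eqF.
Qed.

Let a0 k : 0 <= a k. Proof. exact: sqrtr_ge0. Qed.

Let arho_cvg : rho k @[k --> \oo] --> (0 : R) -> a k * rho k @[k --> \oo] --> (0 : R).
Proof.
move=> rho0; apply: cvg_sqr0; rewrite (_ : (fun k => _) = rho)//; apply/funext => k.
by rewrite exprMn (expr2 (rho k)) mulrA a2rho mul1r.
Qed.

Section score_sums.
Variables (phi psi : T -> R) (u : R).
Hypotheses (hphi : Linfty phi) (hpsi : Linfty psi) (phi0 : \int[P]_x phi x = 0)
  (psi0 : \int[Q]_y psi y = 0) (u0 : 0 < u).

Let S k w := \int[p k w]_x phi x + \int[q k w]_y psi y.
Let U k w := a k / u * S k w.

Let f k (s : nat + nat) : T -> R := match s with
  | inl _ => fun x => a k / u / (n k)%:R * phi x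
  | inr _ => fun y => a k / u / (m k)%:R * psi y end.

Let sample k := [seq inl i | i <- index_iota 0 (n k)] ++ [seq inr j | j <- index_iota 0 (m k)]
  : seq (nat + nat).

Let hf k s : Linfty (f k s).
Proof. by case: s => i; (apply: LinftyM => //; exact: Linfty_cst). Qed.

Let f0 k s : \int[joint_law s]_x f k s x = 0.
Proof. by case: s => i /=; rewrite RintZl// ?phi0 ?psi0 mulr0. Qed.

Let sumU k w : \sum_(s <- sample k) f k s (Z s w) = U k w.
Proof.
rewrite big_cat !big_map !big_mkord /=.
rewrite /U /S (Rint_empirical (fun i => X i w) (n0 k) hphi) (Rint_empirical (fun i => Y i w) (m0 k) hpsi).
by rewrite mulrDr !mulr_sumr; congr (_ + _); apply: eq_bigr => i _; rewrite !mulrA.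
Qed.

(** The variance of [U k], the sum over both samples. When [u ^+ 2] is the limit variance [sigma2],
    it tends to 1. *)
Let tau k : R := u ^- 2 * ((m k)%:R / (n k + m k)%:R * \int[P]_x (phi x ^+ 2) +
  (n k)%:R / (n k + m k)%:R * \int[Q]_y (psi y ^+ 2)).

Let tauE k : \sum_(s <- sample k) \int[joint_law s]_x (f k s x ^+ 2) = tau k.
Proof.
have E (mu : probability T R) (g : T -> R) (r : R) : Linfty g ->
    \int[mu]_x ((r * g x) ^+ 2) = r ^+ 2 * \int[mu]_x (g x ^+ 2).
  move=> hg; rewrite -RintZl; last exact: Linfty_sqr.
  by apply: eq_Rint => x; rewrite exprMn.
rewrite big_cat !big_map !big_mkord /= !sumr_const !card_ord !E//.
have key (A N1 N2 N3 x y : R) : 0 < N1 -> 0 < N2 -> N3 = N1 + N2 -> A ^+ 2 = N1 * N2 / N3 ->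
    (A / u / N1) ^+ 2 * x * N1 + (A / u / N2) ^+ 2 * y * N2 =
    u ^- 2 * (N2 / N3 * x + N1 / N3 * y).
  move=> N10 N20 -> AE; rewrite !exprMn AE.
  by field; rewrite !gt_eqF// addr_gt0.
rewrite -[X in X + _]mulr_natr -[X in _ + X]mulr_natr.
exact: key (nR k) (mR k) (natrD _ _ _) (a2 k).
Qed.

Lemma score_heat (g : R -> R) (ep : R) : rho k @[k --> \oo] --> (0 : R) ->
  tau k @[k --> \oo] --> (1 : R) -> Linfty (g : measurableTypeR R -> R) -> 0 < ep ->
  \int[Pr]_w heat g ep (U k w) - heat g (ep + tau k) 0 @[k --> \oo] --> (0 : R).
Proof.
move=> rho0 tau1 hg ep0; have [_ [H gH]] := hg.
have [_ [B1 phiB]] := hphi; have [_ [B2 psiB]] := hpsi.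
(* A common bound for all summands, from [1/n] and [1/m] being at most [rho]; it tends to zero,
   which is all the replacement argument needs. *)
pose b k := (B1 + B2) / u * (a k * rho k).
have B10 : 0 <= B1 by exact: le_trans (phiB point).
have B20 : 0 <= B2 by exact: le_trans (psiB point).
have b0 : b k @[k --> \oo] --> (0 : R).
  by rewrite -(mulr0 ((B1 + B2) / u)); apply: cvgMr; exact: arho_cvg.
have fb k s x : `|f k s x| <= b k.
  have key (B r v : R) : 0 <= B -> `|r| <= B -> B <= B1 + B2 -> 0 <= v -> v <= rho k ->
      `|a k / u * v * r| <= b k.
    move=> hB rB BB v0 vr; rewrite normrM ger0_norm; last first.
      by apply: mulr_ge0 => //; apply: divr_ge0 => //; exact: ltW.
    have -> : b k = a k / u * rho k * (B1 + B2) by rewrite /b; ring.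
    apply: ler_pM => //.
    - by apply: mulr_ge0 => //; apply: divr_ge0 => //; exact: ltW.
    - by apply: ler_wpM2l => //; apply: divr_ge0 => //; exact: ltW.
    - exact: le_trans BB.
  case: s => i /=.
    apply: (key B1 (phi x) (n k)%:R^-1 B10 (phiB x)); rewrite ?invr_ge0//; first by rewrite lerDl.
    by rewrite lerDl invr_ge0.
  apply: (key B2 (psi x) (m k)%:R^-1 B20 (psiB x)); rewrite ?invr_ge0//; first by rewrite lerDr.
  by rewrite lerDr invr_ge0.
have us k : uniq (sample k).
  rewrite cat_uniq !map_inj_uniq ?iota_uniq// andbT /=.
  by apply/hasPn => s /mapP[j _ ->]; apply/negP => /mapP[].
pose c3 := H * (14 * expR 4 / Num.sqrt ep ^+ 3); pose c4 := H * (144 * expR 1 / ep ^+ 2).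
have bb0 : b k ^+ 2 @[k --> \oo] --> (0 : R).
  rewrite (_ : (fun k => _) = fun k => b k * b k); last by apply/funext => k; exact: expr2.
  by rewrite -[X in _ --> X](mulr0 (0 : R)); exact: cvgM.
have bd0 : (c3 + c4 * b k) * b k * tau k @[k --> \oo] --> (0 : R).
  suff : (c3 + c4 * b k) * b k * tau k @[k --> \oo] --> (c3 + c4 * 0) * 0 * 1.
    by rewrite mulr0 mul0r.
  by apply: cvgM => //; apply: cvgM => //; apply: cvgD; [exact: cvg_cst|exact: cvgMr].
have ep8 : 0 < ep / 8 by exact: divr_gt0.
apply/cvgn_epsP => e e0.
have /cvgn_epsP/(_ _ ep8)[N1 hN1] := bb0; have /cvgn_epsP/(_ _ e0)[N2 hN2] := bd0.
exists (maxn N1 N2) => k; rewrite geq_max => /andP[/hN1 k1 /hN2 k2]; rewrite !subr0 in k1 k2 *.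
apply: le_trans (le_trans (ler_norm _) k2).
have bep : b k ^+ 2 <= ep / 8 by exact: le_trans (ler_norm _) k1.
have hl := lindeberg mZ indep law hg gH (hf k) (fb k) (f0 k) ep0 bep (us k) (lexx ep).
have E : \int[Pr]_w heat g ep (\sum_(s <- sample k) f k s (Z s w)) = \int[Pr]_w heat g ep (U k w).
  by apply: eq_Rint => w; rewrite sumU.
rewrite tauE E in hl.
refine hl.
Qed.

Lemma Linfty_score k : Linfty (U k).
Proof.
rewrite (_ : U k = fun w => \sum_(s <- sample k) f k s (Z s w)); last first.
  by apply/funext => w; rewrite sumU.
by apply: Linfty_sum => s; exact: (Linfty_comp (mZ s) (hf k s)).
Qed.

Lemma score_second_moment : exists C, forall k, \int[Pr]_w (U k w ^+ 2) <= C.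
Proof.
have [C [F [F1 F2 F3 F4]]] := vanishingZ (ler0n R 2) (vanishingD (vmP hphi phi0) (vmQ hpsi psi0)).
exists (u ^- 2 * C) => k.
have u2 : 0 <= u ^- 2 by rewrite invr_ge0; exact: sqr_ge0.
have c0 : 0 <= u ^- 2 * a k ^+ 2 by apply: mulr_ge0 => //; exact: sqr_ge0.
apply: (@le_trans _ _ (u ^- 2 * a k ^+ 2 * \int[Pr]_w F k w)).
  rewrite -RintZl//; apply: le_Rint; first exact: (Linfty_sqr (Linfty_score k)).
    by apply: LinftyM => //; exact: Linfty_cst.
  move=> w; rewrite /U exprMn exprMn exprVn [a k ^+ 2 * _]mulrC.
  apply: ler_wpM2l => //; apply: le_trans (F3 k w); rewrite /S.
  generalize (\int[p k w]_x phi x) (\int[q k w]_y psi y) => x y.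
  by have := sqr_ge0 (x - y); rewrite !expr2; lra.
apply: le_trans (ler_wpM2l c0 (F4 k)) _.
have key (v y z : R) : v * y * (C * z) = v * C * (y * z) by ring.
by rewrite key a2rho mulr1.
Qed.

End score_sums.

(** The exceptional event consists of a bad variance estimate or a large rescaled remainder. Outside
    it the statistic is close to [U] wherever [U] is bounded, in particular the estimate is away
    from zero there. *)
Lemma studentized_cvg (N : nat -> option nat) (lambda : R) :
  rho k @[k --> \oo] --> (0 : R) -> cvg_to_infinity N ->
  ((m k)%:R / (n k + m k)%:R : R) @[k --> \oo] --> lambda ->
  0 < sigma2 c eta lambda P Q ->
  cvg_in_distribution Pr (fun k w => a k *
    ((\int[entropic_plan c (p k w) (q k w)]_z eta z - \int[entropic_plan c P Q]_z eta z) /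
     Num.sqrt (sigma2_hat c eta (n k) (m k) (N k) (p k w) (q k w)))) (normal_prob 0 1).
Proof.
move=> rho0 hN hl; set s2 := sigma2 c eta lambda P Q => s20.
pose sh k w := sigma2_hat c eta (n k) (m k) (N k) (p k w) (q k w).
have msh k : measurable_fun setT (sh k) by exact: measurable_sigma2_hat.
have [_ csh] : cvg_in_probability Pr sh s2 by exact: cvg_sigma2_hat.
have [phi [psi [hphi hpsi [phi0 psi0] sE vrem]]] := plan_expansion.
pose u := Num.sqrt s2; have u0 : 0 < u by rewrite sqrtr_gt0.
pose S k w := \int[p k w]_x phi x + \int[q k w]_y psi y.
pose D k w := \int[entropic_plan c (p k w) (q k w)]_z eta z - \int[entropic_plan c P Q]_z eta z.
pose U k w := a k / u * S k w.
pose r k w := a k * (D k w - S k w).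
have mD k : measurable_fun setT (D k).
  apply: measurable_funB; last exact: measurable_cst.
  exact: (measurable_entropic_int hc cM (rp k) (rq k) he).
have mS k : measurable_fun setT (S k).
  apply: measurable_funD.
    by apply: (measurable_random_int (rp k) (g := fun=> phi)); exact: random_Linfty_cst.
  by apply: (measurable_random_int (rq k) (g := fun=> psi)); exact: random_Linfty_cst.
have mr k : measurable_fun setT (r k).
  apply: measurable_funM; first exact: measurable_cst.
  exact: measurable_funB.
have mstat k : measurable_fun setT (fun w => a k * (D k w / Num.sqrt (sh k w))).
  have msq : measurable_fun setT (Num.sqrt : measurableTypeR R -> measurableTypeR R).
    by apply: continuous_measurable_fun; exact: sqrt_continuous.
  exact: (measurable_funM (measurable_cst _) (measurable_funM (mD k)
    (measurableT_comp (@measurable_invr R) (measurableT_comp msq (msh k))))).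
have vr : vanishing Pr (fun k => a k * rho k) (fun k w => `|r k w|).
  have [C [F [F1 F2 F3 F4]]] := vrem.
  exists C, (fun k w => a k * F k w); split => k.
  - by apply: LinftyM => //; exact: Linfty_cst.
  - by move=> w; exact: mulr_ge0.
  - by move=> w; rewrite normrM (ger0_norm (a0 k)) ler_wpM2l//; exact: F3.
  - by rewrite RintZl// mulrCA ler_wpM2l.
split=> [k|g cg gM]; first exact: mstat.
pose tau k := u ^- 2 * ((m k)%:R / (n k + m k)%:R * \int[P]_x (phi x ^+ 2) +
  (n k)%:R / (n k + m k)%:R * \int[Q]_y (psi y ^+ 2)).
have tau1 : tau k @[k --> \oo] --> (1 : R).
  have hl' : ((n k)%:R / (n k + m k)%:R : R) @[k --> \oo] --> 1 - lambda.
    rewrite (_ : (fun k => _) = fun k => 1 - (m k)%:R / (n k + m k)%:R).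
      by apply: cvgB => //; exact: cvg_cst.
    apply/funext => k; rewrite -[in LHS](addrK (m k)%:R (n k)%:R) -natrD mulrBl divff//.
    by rewrite gt_eqF.
  have -> : 1 = u ^- 2 * (lambda * \int[P]_x (phi x ^+ 2) + (1 - lambda) * \int[Q]_y (psi y ^+ 2)).
    by rewrite -sE -/s2 sqr_sqrtr ?(ltW s20)// mulVf// gt_eqF.
  by apply: cvgMr; apply: cvgD; apply: cvgMl.
have [C2 hC2] := score_second_moment u hphi hpsi phi0 psi0.
apply: (@cvg_gaussian _ _ _ _ U _ tau C2) => //.
- by move=> k; exact: Linfty_score.
- by move=> h0 ep hh0 ep0; exact: (score_heat hphi hpsi phi0 psi0 u0 rho0 tau1 hh0 ep0).
move=> dl K ep dl0 ep0.
(* The factor in [sqrt_quotient_dist]. The absolute value is there because [K] is an arbitrary real;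
   the accuracy [de] below is chosen so that [cc * de <= dl]. *)
pose cc := 2 * (`|K| / u + 1) / u.
have cc0 : 0 < cc by rewrite divr_gt0// mulr_gt0// ltr_wpDl// divr_ge0// ltW.
pose de := Num.min (3 / 4 * s2) (dl / cc).
have de0 : 0 < de by rewrite lt_min !mulr_gt0//= invr_gt0.
have des : de <= 3 / 4 * s2 by rewrite ge_min lexx.
have ded : cc * de <= dl by rewrite mulrC -ler_pdivlMr// ge_min lexx orbT.
have ep2 : 0 < ep / 2 by exact: divr_gt0.
have m1 k := measurable_dist_ge s2 de (msh k).
have m2 k := measurable_dist_ge 0 de (mr k).
have [N1 hN1] := (prob_cvg0 Pr m1).2 (csh _ de0) _ ep2.
have [N2 hN2] := vanishing_prob (arho_cvg rho0) vr de0 ep2.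
exists (maxn N1 N2) => k; rewrite geq_max => /andP[/hN1 k1 /hN2 k2].
have {}k2 : fine (Pr [set w | de <= `|r k w - 0|]) <= ep / 2.
  by apply: k2 => // w /=; rewrite subr0.
exists ([set w | de <= `|sh k w - s2|] `|` [set w | de <= `|r k w - 0|]); split.
- exact: measurableU.
- rewrite [ep]splitr; apply: le_trans (lerD k1 k2); rewrite -fineD ?fin_num_measure//.
  apply: fine_le; last exact: measureU2.
    by rewrite fin_num_measure//; exact: measurableU.
  by rewrite fin_numD !fin_num_measure.
move=> w nA UK.
have d1 : `|sh k w - s2| <= de by rewrite leNgt; apply/negP => /ltW ?; apply: nA; left.
have d2 : `|r k w| <= de by rewrite leNgt; apply/negP => /ltW ?; apply: nA; right; rewrite /= subr0.
have UK' : `|U k w| <= `|K| by exact: le_trans UK (ler_norm _).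
apply: le_trans ded; apply: le_trans (sqrt_quotient_dist s20 des d1 d2 UK').
rewrite -/u (_ : u * U k w + r k w = a k * D k w); first by rewrite mulrA.
by rewrite /U /r; generalize (S k w) (D k w) => x y; field; rewrite gt_eqF.
Qed.

End empirical_plans.

Theorem proposition3p6 (R : realType) (Omega : ptopologicalType)
    (c eta : borel Omega * borel Omega -> R) (P Q : probability (borel Omega) R)
    (d : measure_display) (W : measurableType d) (Pr : probability W R)
    (X Y : nat -> {RV Pr >-> borel Omega})
    (n m : nat -> nat) (N : nat -> nat -> option nat) (lambda : R) :
  polish R Omega -> Linfty c -> Linfty eta ->
  (forall i, has_law (X i) P) -> (forall j, has_law (Y j) Q) ->
  mutual_independence Pr
    (fun s : nat + nat => match s with
                          | inl i => X i : W -> borel Omega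
                          | inr j => Y j : W -> borel Omega
                          end) ->
  (forall k, (0 < n k)%N /\ (0 < m k)%N) ->
  n k @[k --> \oo] --> \oo -> m k @[k --> \oo] --> \oo ->
  ((m k)%:R / (n k + m k)%:R : R) @[k --> \oo] --> lambda ->
  0 < lambda < 1 ->
  cvg_to_infinity (fun k => N (n k) (m k)) ->
  let P_ k w := empirical R (n k) (fun i => X i w) in
  let Q_ k w := empirical R (m k) (fun j => Y j w) in
  let s2_hat k w :=
    sigma2_hat c eta (n k) (m k) (N (n k) (m k)) (P_ k w) (Q_ k w) in
  let s2 := sigma2 c eta lambda P Q in
  cvg_in_probability Pr s2_hat s2 /\
  (0 < s2 ->
   cvg_in_distribution Pr
     (fun k w =>
        Num.sqrt ((n k * m k)%:R / (n k + m k)%:R) *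
        ((\int[entropic_plan c (P_ k w) (Q_ k w)]_z eta z -
          \int[entropic_plan c P Q]_z eta z) /
         Num.sqrt (s2_hat k w)))
     (normal_prob 0 1)).
Proof.
move=> _ hc he lawX lawY indep nm0 nN mN hl _ hN P_ Q_ s2_hat s2.
have [_ [M cM]] := hc.
have n0 k : (0 < n k)%N by case: (nm0 k).
have m0 k : (0 < m k)%N by case: (nm0 k).
have mX i : measurable_fun setT (X i : W -> borel Omega) by exact: measurable_funP.
have mY j : measurable_fun setT (Y j : W -> borel Omega) by exact: measurable_funP.
have rho0 : ((n k)%:R^-1 + (m k)%:R^-1 : R) @[k --> \oo] --> (0 : R).
  by rewrite -[X in _ --> X](addr0 (0 : R)); apply: cvgD; exact: cvg_inv_size.
split; first exact: (cvg_sigma2_hat hc cM he mX mY lawX lawY n0 m0 indep rho0 hN hl).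
move=> s20.
exact: (studentized_cvg hc cM he mX mY lawX lawY n0 m0 indep rho0 hN hl s20).
Qed.
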